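(* Let $f:S^{n-1}\to Cl_n$ be a real analytic function on the unit sphere $S^{n-1}\subset\mathbb{R}^n$. Then there is a unique left Clifford holomorphic function $F$ defined on an open neighbourhood $U(f)$ of $S^{n-1}$ in $\mathbb{R}^n$ such that $F|_{S^{n-1}}=f$.
   Context: $Cl_n$ is the real Clifford algebra generated by an orthonormal basis $e_1,\ldots,e_n$ of $\mathbb{R}^n$ with $e_ie_j+e_je_i=-2\delta_{ij}$. A function $F$ is left Clifford holomorphic if $\sum_j e_j\partial F/\partial x_j=0$. *)

(* Defs.v *)
From HB Require Import structures.
From mathcomp Require Import all_boot all_order all_algebra.
From mathcomp Require Import all_classical all_reals all_analysis.
Set Implicit Arguments. Unset Strict Implicit. Unset Printing Implicit Defensive.
Import Order.TTheory GRing.Theory Num.Theory.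
Import numFieldNormedType.Exports.
Local Open Scope classical_set_scope.
Local Open Scope ring_scope.

(* The real Clifford algebra Cl_n: the 2^n-dimensional real vector space with
   basis e_A indexed by subsets A of {0,...,n-1}
   (e_A = e_{a1} ... e_{ak} for a1 < ... < ak). *)
Definition Cl (R : realType) (n : nat) := {ffun {set 'I_n} -> R}.

(* e_A e_B = clsign A B * e_(A Δ B), where e_i e_j = - e_j e_i (i <> j) and e_i^2 = -1 :
   the sign counts the inversions (a in A, b in B, b < a) and the common squares. *)
Definition clsign (R : realType) (n : nat) (A B : {set 'I_n}) : R :=
  (-1) ^+ (#|[set p : 'I_n * 'I_n | (p.1 \in A) && (p.2 \in B) && (p.2 < p.1)%N]%SET|
           + #|A :&: B|)%N.

Definition symdiff (n : nat) (A B : {set 'I_n}) : {set 'I_n} := (A :|: B) :\: (A :&: B).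

Definition clmul (R : realType) (n : nat) (u v : Cl R n) : Cl R n :=
  [ffun C => \sum_(A : {set 'I_n}) \sum_(B : {set 'I_n})
      (if symdiff A B == C then clsign R A B * u A * v B else 0)].

Definition cle (R : realType) (n : nat) (j : 'I_n) : Cl R n :=
  [ffun A => if A == [set j]%SET then 1 else 0].
Arguments cle R {n} j.

Definition sphere (R : realType) (n : nat) : set 'rV[R]_n :=
  [set x | \sum_(i < n) (x ord0 i) ^+ 2 = 1].
Arguments sphere R n : clear implicits.

Definition ej (R : realType) (n : nat) (j : 'I_n) : 'rV[R]_n := delta_mx ord0 j.
Arguments ej R {n} j.

Definition partialCl (R : realType) (n : nat) (F : 'rV[R]_n -> Cl R n) (j : 'I_n)
  (x : 'rV[R]_n) : Cl R n :=
  [ffun A => 'D_(ej R j) (fun y => F y A) x].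

Definition left_clifford_holomorphic (R : realType) (n : nat) (U : set 'rV[R]_n)
  (F : 'rV[R]_n -> Cl R n) : Prop :=
  open U /\
  (forall A : {set 'I_n},
     (forall x, U x -> differentiable (fun y => F y A) x) /\
     (forall j : 'I_n, {within U, continuous (fun x => 'D_(ej R j) (fun y => F y A) x)})) /\
  (forall x, U x -> \sum_(j < n) clmul (cle R j) (partialCl F j x) = 0).

Definition mpow_box (R : realType) (n : nat) (c : ('I_n -> nat) -> R)
  (x y : 'rV[R]_n) (K : nat) : R :=
  \sum_(a : {ffun 'I_n -> 'I_K.+1})
     c (fun i => nat_of_ord (a i)) * \prod_(i < n) (y ord0 i - x ord0 i) ^+ a i.

Definition mpow_box_abs (R : realType) (n : nat) (c : ('I_n -> nat) -> R)
  (x y : 'rV[R]_n) (K : nat) : R :=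
  \sum_(a : {ffun 'I_n -> 'I_K.+1})
     `|c (fun i => nat_of_ord (a i)) * \prod_(i < n) (y ord0 i - x ord0 i) ^+ a i|.

Definition real_analytic_on (R : realType) (n : nat) (V : set 'rV[R]_n)
  (h : 'rV[R]_n -> R) : Prop :=
  forall x, V x -> exists (r : R) (c : ('I_n -> nat) -> R), 0 < r /\
    forall y : 'rV[R]_n, (forall i, `|y ord0 i - x ord0 i| < r) ->
      cvgn (mpow_box_abs c x y) /\ mpow_box c x y @ \oo --> h y.

(* f : S^{n-1} -> Cl_n is real analytic: locally near each point of the sphere
   it is the restriction of a (componentwise) real analytic function on an open set of R^n
   (S^{n-1} being a real analytic submanifold of R^n). Only values of f on the sphere matter. *)
Definition real_analytic_on_sphere (R : realType) (n : nat) (f : 'rV[R]_n -> Cl R n) : Prop :=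
  forall p, sphere R n p -> exists (V : set 'rV[R]_n) (g : 'rV[R]_n -> Cl R n),
    [/\ open V, V p,
        (forall A, real_analytic_on V (fun y => g y A)) &
        (forall y, V y -> sphere R n y -> g y = f y)].

(* Main.v *)
Require Import Defs.
From HB Require Import structures.
From mathcomp Require Import all_boot all_order all_algebra.
From mathcomp Require Import all_classical all_reals all_analysis.
From mathcomp Require Import ring lra.
Import Order.TTheory GRing.Theory Num.Theory.
Import numFieldNormedType.Exports.
Local Open Scope classical_set_scope.
Local Open Scope ring_scope.
Set Implicit Arguments.
Unset Strict Implicit.
Unset Printing Implicit Defensive.

(** Write [D] for the Dirac operator and [x] for left multiplication by the vector [x].

    Existence is local: since [D (ln |x|) = x / |x|^2] and [x x = - |x|^2], the series
    [sum_k (ln |x|)^k / k! (x D)^k g] is annihilated by [D] termwise (it telescopes) and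
    agrees with [g] on the sphere.  If [g] is a power series, splitting the loss of
    radius evenly among the [k] derivatives gives [|(x D)^k g| <= C^k k!], so the series
    converges near the sphere.

    Uniqueness has to be proved for solutions that are merely C^1, and it also glues the
    local solutions.  If [H] is monogenic and vanishes on the sphere, the tangential
    derivatives vanish there, hence by [D H = 0] so does the normal one, and [H] extended
    by zero across the sphere is again C^1 and monogenic.  Such functions satisfy an
    interior Lipschitz estimate: a grid average has a small discrete Laplacian, so its
    odd reflection in a hyperplane can be compared with a quadratic barrier.  Iterating
    the estimate on finite differences bounds them like those of an analytic function,
    and Newton's interpolation formula propagates the zero set. *)

(** * Left multiplication by the generators *)

(** A solution extended by zero across the sphere has no second derivatives in general, so
    harmonicity is available only for finite differences. Averaging over grid segments of a fixed
    length [h] lets the outer operator in [D (avg (D H))] act at the cost of a factor [1 / h],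
    however fine the grid; since the discrete [D H] tends to zero with the grid, so does the
    discrete Laplacian of the average. The resulting Lipschitz bound involves only a bound on [H],
    and differences of [H] satisfy the same hypotheses, so it can be applied [j] times, each time
    giving up [s / j] of the radius. With [2 (m + 1)] steps along a segment whose first half lies in
    the zero set, Newton's formula keeps only the orders above [m]; they are at most [8^-(m+1)]
    times a bound of [H], against binomial coefficients of sum [4^(m+1)]. For existence, [x D] is
    iterated on polynomial partial sums only. The order of the logarithmic series and the degree of
    the partial sum are truncated together, and one convergent majorant controls both the functions
    and their first derivatives. *)

Definition twist (n : nat) (j : 'I_n) (C : {set 'I_n}) : {set 'I_n} :=
  [set k | (k == j) (+) (k \in C)]%SET.

Lemma symdiff_set1 (n : nat) (j : 'I_n) (C : {set 'I_n}) :
  symdiff [set j]%SET C = twist j C.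
Proof. by apply/setP => k; rewrite !inE; case: (k == j); case: (k \in C). Qed.

Definition below (n : nat) (j : 'I_n) (C : {set 'I_n}) : nat :=
  #|[set b in C | (b < j)%N]%SET|.

(** The sign in [e_j e_B = lsign j C e_C] for [B = twist j C], expressed through the target [C]:
    elements below [j] are those of [B], and [j] lies in [B] exactly when it is not in [C]. *)
Definition lsign (R : realType) (n : nat) (j : 'I_n) (C : {set 'I_n}) : R :=
  (-1) ^+ (below j C + (j \notin C))%N.
Arguments lsign R {n} j C.

Definition lmul (R : realType) (n : nat) (j : 'I_n) (u : {set 'I_n} -> R)
    (C : {set 'I_n}) : R :=
  lsign R j C * u (twist j C).

Lemma in_twist (n : nat) (j k : 'I_n) (C : {set 'I_n}) :
  (k \in twist j C) = (k == j) (+) (k \in C).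
Proof. by rewrite inE. Qed.

Lemma twistK (n : nat) (j : 'I_n) : involutive (@twist n j).
Proof. by move=> C; apply/setP => k; rewrite !in_twist addbA addbb. Qed.

Lemma twistC (n : nat) (i j : 'I_n) (C : {set 'I_n}) :
  twist i (twist j C) = twist j (twist i C).
Proof. by apply/setP => k; rewrite !in_twist addbCA. Qed.

Lemma below_twist_ge (n : nat) (i j : 'I_n) (C : {set 'I_n}) :
  (i <= j)%N -> below i (twist j C) = below i C.
Proof.
move=> ij; apply: eq_card => b; rewrite !inE.
by case: eqVneq => [->|//]; rewrite [(j < i)%N]ltnNge ij !andbF.
Qed.

Lemma odd_below_twist_lt (n : nat) (i j : 'I_n) (C : {set 'I_n}) :
  (j < i)%N -> odd (below i (twist j C)) = ~~ odd (below i C).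
Proof.
move=> ji; rewrite /below.
wlog jC : C / j \in C => [hw|].
  have [/hw//|jC] := boolP (j \in C).
  by have := hw (twist j C); rewrite in_twist eqxx (negbTE jC) twistK => /(_ isT) ->; rewrite negbK.
rewrite [in RHS](cardsD1 j) !inE jC ji /= negbK; congr odd; apply: eq_card => b.
by rewrite !inE; case: eqVneq => [->|]//=; rewrite jC.
Qed.

(** This is [e_j e_j = -1]: the two inversion counts agree, and exactly one of the two sets contains
    [j]. *)
Lemma lsign_twist (R : realType) (n : nat) (j : 'I_n) (C : {set 'I_n}) :
  lsign R j C * lsign R j (twist j C) = -1.
Proof.
rewrite /lsign -exprD below_twist_ge // in_twist eqxx /=.
rewrite -signr_odd !oddD !oddb.
by case: odd; case: (j \in C); rewrite /= expr1.
Qed.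

(** This is [e_i e_j = - e_j e_i]: for [i < j], toggling [i] flips the parity of the elements below
    [j], while toggling [j] leaves those below [i] alone. *)
Lemma lsign_twistC (R : realType) (n : nat) (i j : 'I_n) (C : {set 'I_n}) :
  i != j ->
  lsign R i C * lsign R j (twist i C) = - (lsign R j C * lsign R i (twist j C)).
Proof.
wlog : i j / (i < j)%N => [hw|] ij.
  case: (ltngtP i j) => [h|h|/val_inj h]; first exact: hw.
    by rewrite [in RHS]hw ?opprK // eq_sym.
  by rewrite h eqxx in ij.
move=> nij; rewrite /lsign -!exprD -[in LHS]signr_odd -[in RHS]signr_odd !oddD !oddb.
rewrite (below_twist_ge _ (ltnW ij)) odd_below_twist_lt // !in_twist.
rewrite [j == i]eq_sym (negbTE nij) /=.
by case: (odd (below i C)); case: (odd (below j C)); case: (i \in C); case: (j \in C);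
  rewrite /= ?expr1 ?expr0 ?opprK.
Qed.

Lemma normr_lsign (R : realType) (n : nat) (j : 'I_n) (C : {set 'I_n}) :
  `|lsign R j C| = 1.
Proof. by rewrite /lsign normrX normrN1 expr1n. Qed.

Lemma clmul_cle (R : realType) (n : nat) (j : 'I_n) (u : Cl R n) (C : {set 'I_n}) :
  clmul (cle R j) u C = lmul j u C.
Proof.
rewrite ffunE (bigD1 [set j]%SET) //= [X in _ + X]big1 ?addr0; last first.
  move=> A Aj; apply: big1 => B _; rewrite ffunE (negbTE Aj).
  by case: ifP; rewrite ?mulr0 ?mul0r.
rewrite (bigD1 (twist j C)) //= [X in _ + X]big1 ?addr0; last first.
  move=> B BC; case: ifP => // /eqP BE; move: BC.
  by rewrite -BE symdiff_set1 twistK eqxx.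
rewrite symdiff_set1 twistK eqxx ffunE eqxx mulr1 /lmul; congr (_ * _).
rewrite /clsign /lsign -(below_twist_ge C (leqnn j)); congr (_ ^+ (_ + _))%N.
  rewrite /below; set f := fun b : 'I_n => (j, b).
  rewrite -(card_imset _ (_ : injective f)); last by move=> a b [].
  apply: eq_card => -[a b]; rewrite !inE /=; apply/idP/imsetP.
    by move=> /andP[/andP[/eqP-> bC] bj]; exists b; rewrite // !inE bC.
  by move=> [b']; rewrite !inE => /andP[h1 h2] [-> ->]; rewrite eqxx h1.
case: (boolP (j \in C)) => jC.
  apply: eq_card0 => k; rewrite !inE; case: eqVneq => [->|//].
  by rewrite jC.
rewrite (_ : _ :&: _ = [set j])%SET ?cards1//; apply/setP => k.
by rewrite !inE; case: eqVneq => [->|//]; rewrite (negbTE jC).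
Qed.

Lemma lmul_sum (R : realType) (n : nat) (T : Type) (r : seq T) (P : pred T) (j : 'I_n)
    (u : T -> {set 'I_n} -> R) (C : {set 'I_n}) :
  lmul j (fun A => \sum_(k <- r | P k) u k A) C = \sum_(k <- r | P k) lmul j (u k) C.
Proof. exact: mulr_sumr. Qed.

(* The Clifford relations enter only through this identity: for commuting [d] the square
   of the Dirac operator is minus the Laplacian. *)
Lemma lmul_square (R : realType) (n : nat) (d : 'I_n -> 'I_n -> {set 'I_n} -> R)
    (C : {set 'I_n}) :
  (forall i j A, d i j A = d j i A) ->
  \sum_(i < n) lmul i (fun A => \sum_(j < n) lmul j (d i j) A) C = - \sum_(i < n) d i i C.
Proof.
move=> dC; pose a i j := lmul i (lmul j (d i j)) C.
have aii i : a i i = - d i i C by rewrite /a /lmul mulrA lsign_twist twistK mulN1r.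
have aij i j : i != j -> a i j = - a j i.
  move=> ij; rewrite /a /lmul !mulrA lsign_twistC // twistC dC mulNr.
  by congr (- _).
(* The off-diagonal part; exchanging the summation indices turns it into its own negative. *)
pose S := \sum_i \sum_j (if i == j then 0 else a i j).
have SE : S = - S.
  rewrite {1}/S exchange_big /= /S -sumrN; apply: eq_bigr => i _.
  rewrite -sumrN; apply: eq_bigr => j _; rewrite [j == i]eq_sym.
  by case: eqVneq => [|ij]; rewrite ?oppr0 // aij // eq_sym.
have {}SE : S = 0 by lra.
transitivity (\sum_i a i i + S); last first.
  by rewrite SE addr0 -sumrN; apply: eq_bigr => i _.
rewrite /S -big_split /=; apply: eq_bigr => i _; rewrite lmul_sum.
rewrite (bigD1 i) //= -/(a i i); congr (_ + _).
rewrite [RHS](bigD1 i) //= eqxx add0r; apply: eq_bigr => j ji.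
by rewrite eq_sym (negbTE ji).
Qed.

(** * Finite differences and the discrete maximum principle *)

Definition ccube (R : realType) (n : nat) (p : 'rV[R]_n) (r : R) (x : 'rV[R]_n) : Prop :=
  forall i, `|x ord0 i - p ord0 i| <= r.

(** Central, so that its square is the second difference at the same point with step [2 * eta];
    averages with that same spacing make it telescope. *)
Definition cdiff (R : realType) (n : nat) (eta : R) (j : 'I_n) (u : 'rV[R]_n -> R)
    (x : 'rV[R]_n) : R :=
  (u (x + eta *: ej R j) - u (x - eta *: ej R j)) / (2 * eta).

Definition ddirac (R : realType) (n : nat) (eta : R)
    (H : 'rV[R]_n -> {set 'I_n} -> R) (x : 'rV[R]_n) (A : {set 'I_n}) : R :=
  \sum_(j < n) lmul j (fun B => cdiff eta j (H^~ B) x) A.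

Definition avg (R : realType) (n : nat) (tau : R) (N : nat) (j : 'I_n)
    (u : 'rV[R]_n -> R) (x : 'rV[R]_n) : R :=
  N%:R^-1 * \sum_(k < N) u (x + (k%:R * tau) *: ej R j).

Definition avgs (R : realType) (n : nat) (tau : R) (N : nat) (l : seq 'I_n)
    (u : 'rV[R]_n -> R) : 'rV[R]_n -> R :=
  foldr (avg tau N) u l.

Lemma shiftE (R : realType) (n : nat) (x : 'rV[R]_n) (t : R) (j i : 'I_n) :
  (x + t *: ej R j) ord0 i = x ord0 i + t * (i == j)%:R.
Proof. by rewrite !mxE eqxx. Qed.

Lemma shiftNE (R : realType) (n : nat) (x : 'rV[R]_n) (t : R) (j i : 'I_n) :
  (x - t *: ej R j) ord0 i = x ord0 i - t * (i == j)%:R.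
Proof. by rewrite -scaleNr shiftE mulNr. Qed.

Lemma ccubeW (R : realType) (n : nat) (p : 'rV[R]_n) (r s : R) (x : 'rV[R]_n) :
  r <= s -> ccube p r x -> ccube p s x.
Proof. by move=> rs px i; apply: le_trans (px i) rs. Qed.

Lemma ccube_shift (R : realType) (n : nat) (p : 'rV[R]_n) (r s t : R) (j : 'I_n)
    (x : 'rV[R]_n) :
  ccube p r x -> r + `|t| <= s -> ccube p s (x + t *: ej R j).
Proof.
move=> px rs i; rewrite shiftE addrAC; apply: le_trans (ler_normD _ _) _.
apply: le_trans rs; apply: lerD (px i) _; rewrite normrM.
by case: (i == j); rewrite ?normr1 ?mulr1 // normr0 mulr0.
Qed.

Lemma ccube_shiftN (R : realType) (n : nat) (p : 'rV[R]_n) (r s t : R) (j : 'I_n)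
    (x : 'rV[R]_n) :
  ccube p r x -> r + `|t| <= s -> ccube p s (x - t *: ej R j).
Proof. by move=> px rs; rewrite -scaleNr; apply: ccube_shift px _; rewrite normrN. Qed.

Lemma avg_le (R : realType) (n : nat) (tau : R) (N : nat) (j : 'I_n)
    (u : 'rV[R]_n -> R) (x : 'rV[R]_n) (a e : R) :
  (0 < N)%N -> (forall k : 'I_N, `|u (x + (k%:R * tau) *: ej R j) - a| <= e) ->
  `|avg tau N j u x - a| <= e.
Proof.
move=> N0 ue; have N0' : (0 : R) < N%:R by rewrite ltr0n.
have -> : avg tau N j u x - a =
    N%:R^-1 * \sum_(k < N) (u (x + (k%:R * tau) *: ej R j) - a).
  rewrite sumrB mulrBr; congr (_ - _).
  by rewrite sumr_const card_ord -[a *+ N]mulr_natl mulKf // gt_eqF.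
rewrite normrM ger0_norm ?invr_ge0 ?ler0n // ler_pdivrMl //.
apply: le_trans (ler_norm_sum _ _ _) _.
by apply: le_trans (ler_sum _ (fun k _ => ue k)) _; rewrite sumr_const card_ord mulr_natl.
Qed.

Lemma avg_step (R : realType) (tau : R) (N : nat) (k : 'I_N) : 0 <= tau ->
  `|k%:R * tau| <= N%:R * tau.
Proof.
move=> t0; rewrite ger0_norm ?mulr_ge0 // ler_wpM2r // ler_nat; exact: ltnW.
Qed.

Lemma avg_bound (R : realType) (n : nat) (tau : R) (N : nat) (j : 'I_n)
    (u : 'rV[R]_n -> R) (p : 'rV[R]_n) (r e : R) :
  (0 < N)%N -> 0 <= tau -> (forall x, ccube p r x -> `|u x| <= e) ->
  forall x, ccube p (r - N%:R * tau) x -> `|avg tau N j u x| <= e.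
Proof.
move=> N0 t0 ue x px; rewrite -[avg _ _ _ _ _]subr0; apply: avg_le => // k.
rewrite subr0; apply: ue; apply: ccube_shift px _.
by rewrite -lerBrDl opprB addrC subrK avg_step.
Qed.

Lemma avgs_bound (R : realType) (n : nat) (tau : R) (N : nat) (l : seq 'I_n)
    (u : 'rV[R]_n -> R) (p : 'rV[R]_n) (r e : R) :
  (0 < N)%N -> 0 <= tau -> (forall x, ccube p r x -> `|u x| <= e) ->
  forall x, ccube p (r - (size l)%:R * (N%:R * tau)) x -> `|avgs tau N l u x| <= e.
Proof.
move=> N0 t0 ue; elim: l => [|j l IH] x /=; first by rewrite mul0r subr0; apply: ue.
move=> px; apply: (avg_bound j N0 t0 IH); apply: ccubeW px.
by rewrite -[(size l).+1]addn1 natrD mulrDl mul1r opprD addrA.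
Qed.

Lemma avgs_close (R : realType) (n : nat) (tau : R) (N : nat) (l : seq 'I_n)
    (u : 'rV[R]_n -> R) (p : 'rV[R]_n) (r e : R) :
  (0 < N)%N -> 0 <= tau ->
  (forall x t j, ccube p r x -> ccube p r (x + t *: ej R j) -> `|t| <= N%:R * tau ->
     `|u (x + t *: ej R j) - u x| <= e) ->
  forall x, ccube p (r - (size l)%:R * (N%:R * tau)) x ->
    `|avgs tau N l u x - u x| <= (size l)%:R * e.
Proof.
move=> N0 t0 ue; have h0 : 0 <= N%:R * tau by rewrite mulr_ge0.
elim: l => [|j l IH] x /= px; first by rewrite subrr normr0 mul0r.
apply: avg_le => // k; have kt := avg_step k t0.
set y := x + _.
have py : ccube p (r - (size l)%:R * (N%:R * tau)) y.
  apply: ccube_shift px _; rewrite -[(size l).+1]addn1 natrD mulrDl mul1r opprD addrA.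
  by move: kt; lra.
have -> : avgs tau N l u y - u x = (avgs tau N l u y - u y) + (u y - u x).
  by rewrite addrA subrK.
apply: le_trans (ler_normD _ _) _; rewrite -[(size l).+1]addn1 natrD mulrDl mul1r.
apply: lerD; first exact: IH.
apply: ue => //.
  by apply: ccubeW px; rewrite gerBl mulr_ge0.
by apply: ccubeW py; rewrite gerBl mulr_ge0.
Qed.

Lemma cdiff_avg (R : realType) (n : nat) (eta tau : R) (N : nat) (i j : 'I_n)
    (u : 'rV[R]_n -> R) (x : 'rV[R]_n) :
  cdiff eta i (avg tau N j u) x = avg tau N j (cdiff eta i u) x.
Proof.
rewrite /cdiff /avg -mulrBr -mulrA -sumrB mulr_suml; congr (_ * _).
by apply: eq_bigr => k _; rewrite [x + _ + _]addrAC [x - _ + _]addrAC.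
Qed.

Lemma cdiff_avgs (R : realType) (n : nat) (eta tau : R) (N : nat) (i : 'I_n)
    (l : seq 'I_n) (u : 'rV[R]_n -> R) :
  cdiff eta i (avgs tau N l u) = avgs tau N l (cdiff eta i u).
Proof.
by elim: l => //= j l IH; apply/funext => x; rewrite cdiff_avg IH.
Qed.

(** The discrete fundamental theorem of calculus: when the spacing of the average equals the width
    of the difference, consecutive terms cancel. *)
Lemma cdiff_avg_telescope (R : realType) (n : nat) (eta : R) (N : nat) (i : 'I_n)
    (u : 'rV[R]_n -> R) (x : 'rV[R]_n) :
  cdiff eta i (avg (2 * eta) N i u) x =
  (u (x + (N%:R * (2 * eta) - eta) *: ej R i) - u (x - eta *: ej R i)) /
    (N%:R * (2 * eta)).
Proof.
rewrite /cdiff /avg -mulrBr -sumrB mulrAC [(N%:R * _)^-1]invfM [RHS]mulrC; congr (_ * _).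
pose g k := u (x + (k%:R * (2 * eta) - eta) *: ej R i).
transitivity (\sum_(k < N) (g k.+1 - g k)).
  apply: eq_bigr => k _; rewrite /g -!addrA -scalerDl -scaleNr -scalerDl.
  congr (u (_ + _ *: _) - u (_ + _ *: _)); last by rewrite addrC.
  by rewrite -[k.+1]addn1 natrD; ring.
by rewrite -(big_mkord xpredT (fun k => g k.+1 - g k)) telescope_sumr // /g mul0r sub0r scaleNr.
Qed.

(** Averaging in direction [i] pays for a difference in direction [i]: the cost is the inverse of
    the averaging length, independent of [eta] once that length is fixed. The other averages commute
    with the difference and do not increase the bound. *)
Lemma cdiff_avgs_bound (R : realType) (n : nat) (eta : R) (N : nat) (i : 'I_n)
    (l : seq 'I_n) (u : 'rV[R]_n -> R) (p : 'rV[R]_n) (r e : R) :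
  (0 < N)%N -> 0 < eta -> (forall x, ccube p r x -> `|u x| <= e) -> i \in l ->
  forall x, ccube p (r - (size l)%:R * (N%:R * (2 * eta))) x ->
    `|cdiff eta i (avgs (2 * eta) N l u) x| <= 2 * e / (N%:R * (2 * eta)).
Proof.
move=> N0 e0 ue; have t0 : 0 <= 2 * eta by rewrite mulr_ge0 // ltW.
set h := N%:R * _.
have h0 : 0 < h by rewrite !mulr_gt0 // ltr0n.
have eh : 2 * eta <= h.
  by rewrite /h; rewrite -[leLHS]mul1r ler_wpM2r // ler1n.
elim: l => //= j l IH; rewrite inE.
have rE : r - (size l).+1%:R * h = r - (size l)%:R * h - h.
  by rewrite -[(size l).+1]addn1 natrD mulrDl mul1r opprD addrA.
rewrite rE; have [<- _|_ /= il] := eqVneq i j; last first.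
  by move=> x px; rewrite cdiff_avg; apply: (avg_bound j N0 t0 (IH il)).
move=> x px; rewrite cdiff_avg_telescope -/h normrM.
rewrite [X in _ * X]ger0_norm ?invr_ge0 ?(ltW h0) // ler_pM2r ?invr_gt0 //.
apply: le_trans (ler_normB _ _) _; rewrite [2 * e]mulr_natl mulr2n.
have b := avgs_bound (l := l) N0 t0 ue.
apply: lerD; apply: b; [apply: ccube_shift px _|apply: ccube_shiftN px _].
  rewrite ger0_norm; first by rewrite -/h; lra.
  by rewrite subr_ge0; apply: le_trans eh; lra.
by rewrite -/h gtr0_norm //; lra.
Qed.

Lemma avgs_sum (R : realType) (n : nat) (tau : R) (N : nat) (l : seq 'I_n)
    (m : nat) (c : 'I_m -> R) (v : 'I_m -> 'rV[R]_n -> R) (x : 'rV[R]_n) :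
  avgs tau N l (fun y => \sum_j c j * v j y) x = \sum_j c j * avgs tau N l (v j) x.
Proof.
elim: l x => [//|k l IH] x.
rewrite -[LHS]/(avg tau N k (avgs tau N l _) x) /avg.
under eq_bigr do rewrite IH.
rewrite exchange_big mulr_sumr /=; apply: eq_bigr => j _.
by rewrite -mulr_sumr mulrCA.
Qed.

Lemma cdiff_sum (R : realType) (n : nat) (eta : R) (i : 'I_n)
    (m : nat) (c : 'I_m -> R) (v : 'I_m -> 'rV[R]_n -> R) (x : 'rV[R]_n) :
  cdiff eta i (fun y => \sum_j c j * v j y) x = \sum_j c j * cdiff eta i (v j) x.
Proof.
rewrite /cdiff -sumrB mulr_suml; apply: eq_bigr => j _.
by rewrite -mulrBr mulrA.
Qed.

Lemma cdiffC (R : realType) (n : nat) (eta : R) (i j : 'I_n) (u : 'rV[R]_n -> R) :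
  cdiff eta i (cdiff eta j u) = cdiff eta j (cdiff eta i u).
Proof.
apply/funext => x; rewrite /cdiff.
rewrite [x + _ + _]addrAC [x - _ + _]addrAC [x - _ - _]addrAC.
rewrite [x + _ *: ej R i - _]addrAC.
by ring.
Qed.

Lemma cdiff2 (R : realType) (n : nat) (eta : R) (j : 'I_n) (u : 'rV[R]_n -> R)
    (x : 'rV[R]_n) :
  cdiff eta j (cdiff eta j u) x =
  (u (x + (2 * eta) *: ej R j) + u (x - (2 * eta) *: ej R j) - 2 * u x) /
    (2 * eta) ^+ 2.
Proof.
rewrite /cdiff subrK addrK -!addrA -opprD -!scalerDl -mulr2n mulr_natl expr2 invfM.
by ring.
Qed.

(** Differences commute with each other and with averages, so the discrete Dirac operator squares to
    minus the discrete Laplacian. The average is placed between its two factors, where it can absorb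
    the outer one. *)
Lemma ddirac_avgs (R : realType) (n : nat) (eta tau : R) (N : nat) (l : seq 'I_n)
    (H : 'rV[R]_n -> {set 'I_n} -> R) (x : 'rV[R]_n) (A : {set 'I_n}) :
  \sum_(i < n)
     lmul i (fun B => cdiff eta i (avgs tau N l (fun y => ddirac eta H y B)) x) A =
  - \sum_(i < n) cdiff eta i (cdiff eta i (avgs tau N l (H^~ A))) x.
Proof.
rewrite -(@lmul_square _ _
  (fun i j B => cdiff eta i (cdiff eta j (avgs tau N l (H^~ B))) x)); last first.
  by move=> i j B; rewrite cdiffC.
apply: eq_bigr => i _; congr (_ * _).
have -> : avgs tau N l (fun y => ddirac eta H y (twist i A)) = fun y =>
    \sum_j lsign R j (twist i A) *
      cdiff eta j (avgs tau N l (H^~ (twist j (twist i A)))) y.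
  apply/funext => y; rewrite avgs_sum; apply: eq_bigr => j _.
  by rewrite cdiff_avgs.
exact: cdiff_sum.
Qed.

(* A near-maximum replaces the maximum, so that no compactness is needed. *)
Lemma discrete_max_principle (R : realType) (n : nat) (X : set 'rV[R]_n)
    (w : 'rV[R]_n -> R) (tau kappa M : R) :
  0 < kappa -> (forall x, X x -> w x <= M) ->
  (forall x, X x -> w x <= 0 \/
     (forall j, X (x + tau *: ej R j) /\ X (x - tau *: ej R j)) /\
     kappa <= \sum_(j < n) (w (x + tau *: ej R j) + w (x - tau *: ej R j) - 2 * w x)) ->
  forall x, X x -> w x <= 0.
Proof.
move=> k0 wM wX x Xx; rewrite leNgt; apply/negP => w0.
have Ssup : has_sup (w @` X).
  by split; [exists (w x), x | exists M => _ [y Xy <-]; apply: wM].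
pose S := sup (w @` X).
have wS y : X y -> w y <= S by move=> Xy; apply: sup_ubound; [case: Ssup|exists y].
have S0 : 0 < S by apply: lt_le_trans (wS _ Xx).
(* At a point within [d] of the supremum each second difference is at most [2 * d], and
   [2 * n * d < kappa]. The minimum with [S] below keeps the value there positive. *)
pose d := kappa / (2 * n%:R + 1).
have n1 : (0 : R) < 2 * n%:R + 1 by rewrite ltr_wpDl // mulr_ge0.
have d0 : 0 < d by rewrite divr_gt0.
have m0 : 0 < Num.min d S by rewrite lt_min d0.
have [_ [y Xy <-] yS] := sup_adherent m0 Ssup.
have wy0 : 0 < w y.
  by apply: le_lt_trans yS; rewrite subr_ge0 ge_min lexx orbT.
have yd : S - w y < d.
  by rewrite ltrBlDr -ltrBlDl; apply: le_lt_trans yS; rewrite lerD2l lerN2 ge_min lexx.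
have [|[Xn]] := wX _ Xy; first by rewrite leNgt wy0.
apply/negP; rewrite -ltNge.
apply: (@le_lt_trans _ _ (\sum_(j < n) 2 * d)).
  apply: ler_sum => j _; have [/wS a /wS b] := Xn j; lra.
have -> : \sum_(j < n) 2 * d = 2 * n%:R * kappa / (2 * n%:R + 1).
  by rewrite sumr_const card_ord -[LHS]mulr_natl /d; ring.
by rewrite ltr_pdivrMr //; lra.
Qed.

(** * Odd reflection and a quadratic barrier *)

Definition reflect_at (R : realType) (n : nat) (p : 'rV[R]_n) (i : 'I_n) (x : 'rV[R]_n) :
    'rV[R]_n :=
  x - (2 * (x ord0 i - p ord0 i)) *: ej R i.

Lemma reflect_at_shift (R : realType) (n : nat) (p : 'rV[R]_n) (i j : 'I_n)
    (x : 'rV[R]_n) (t : R) :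
  reflect_at p i (x + t *: ej R j) =
  reflect_at p i x + (if j == i then - t else t) *: ej R j.
Proof.
apply/rowP => k; rewrite /reflect_at shiftNE !shiftE shiftNE.
have [->|ji] := eqVneq j i; rewrite ?eqxx ?[i == j]eq_sym ?(negbTE ji) /=.
  by case: (k == i) => /=; ring.
by ring.
Qed.

Lemma reflect_at_shiftN (R : realType) (n : nat) (p : 'rV[R]_n) (i j : 'I_n)
    (x : 'rV[R]_n) (t : R) :
  reflect_at p i (x - t *: ej R j) =
  reflect_at p i x - (if j == i then - t else t) *: ej R j.
Proof. by rewrite -scaleNr reflect_at_shift -scaleNr; case: ifP. Qed.

Lemma ccube_reflect_at (R : realType) (n : nat) (p : 'rV[R]_n) (i : 'I_n)
    (x : 'rV[R]_n) (r : R) :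
  ccube p r x -> ccube p r (reflect_at p i x).
Proof.
move=> px k; rewrite /reflect_at shiftNE; have [->|ki] := eqVneq k i.
  rewrite mulr1; have -> : x ord0 i - 2 * (x ord0 i - p ord0 i) - p ord0 i =
    - (x ord0 i - p ord0 i) by ring.
  by rewrite normrN.
by rewrite mulr0 subr0.
Qed.

(** With [y = x - p], the coefficient [n + 1] makes the second differences sum to a negative
    constant, and the linear term makes the function equal to
    [sum_(k != i) y_k^2 + n y_i (2 s - y_i)], hence nonnegative on the half cube [0 <= y_i <= s]. *)
Definition barrier (R : realType) (n : nat) (p : 'rV[R]_n) (i : 'I_n) (s : R)
    (x : 'rV[R]_n) : R :=
  \sum_(k < n) (x ord0 k - p ord0 k) ^+ 2 + 2 * n%:R * s * (x ord0 i - p ord0 i)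
  - (n%:R + 1) * (x ord0 i - p ord0 i) ^+ 2.

Lemma barrier_diff2 (R : realType) (n : nat) (p : 'rV[R]_n) (i : 'I_n) (s tau : R)
    (x : 'rV[R]_n) :
  \sum_(j < n) (barrier p i s (x + tau *: ej R j) + barrier p i s (x - tau *: ej R j)
     - 2 * barrier p i s x) = - (2 * tau ^+ 2).
Proof.
have E j : barrier p i s (x + tau *: ej R j) + barrier p i s (x - tau *: ej R j)
     - 2 * barrier p i s x = 2 * tau ^+ 2 - (n%:R + 1) * 2 * tau ^+ 2 * (i == j)%:R.
  rewrite /barrier !shiftE !shiftNE.
  have S : \sum_(k < n) ((x + tau *: ej R j) ord0 k - p ord0 k) ^+ 2 +
     \sum_(k < n) ((x - tau *: ej R j) ord0 k - p ord0 k) ^+ 2 =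
     2 * \sum_(k < n) (x ord0 k - p ord0 k) ^+ 2 + 2 * tau ^+ 2.
    have -> : 2 * tau ^+ 2 = \sum_(k < n) 2 * tau ^+ 2 * (k == j)%:R.
      rewrite (bigD1 j) //= eqxx mulr1 big1 ?addr0 // => k kj.
      by rewrite (negbTE kj) mulr0.
    rewrite mulr_sumr -!big_split /=; apply: eq_bigr => k _.
    by rewrite shiftE shiftNE; case: (k == j) => /=; ring.
  have ii : ((i == j)%:R : R) ^+ 2 = (i == j)%:R by case: (i == j) => /=; ring.
  move: S; set S1 := \sum_(k < n) _; set S2 := \sum_(k < n) _; set S3 := \sum_(k < n) _.
  set d := (i == j)%:R in ii *; move=> S; have -> : S1 = 2 * S3 + 2 * tau ^+ 2 - S2 by lra.
  transitivity (2 * tau ^+ 2 - (n%:R + 1) * 2 * tau ^+ 2 * d ^+ 2); last by rewrite ii.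
  by ring.
under eq_bigr do rewrite E.
rewrite big_split /= sumr_const card_ord sumrN -mulr_sumr (bigD1 i) //= eqxx big1 ?addr0.
  by rewrite -[_ *+ n]mulr_natl mulr1; ring.
by move=> j ji; rewrite eq_sym (negbTE ji).
Qed.

Lemma barrier_split (R : realType) (n : nat) (p : 'rV[R]_n) (i : 'I_n) (s : R)
    (x : 'rV[R]_n) :
  barrier p i s x = \sum_(k < n | k != i) (x ord0 k - p ord0 k) ^+ 2 +
    n%:R * (x ord0 i - p ord0 i) * (2 * s - (x ord0 i - p ord0 i)).
Proof. by rewrite /barrier (bigD1 i) //=; ring. Qed.

(* Odd reflection across the hyperplane through [p] orthogonal to [e_i], compared with
   a strictly superharmonic quadratic barrier vanishing at [p]. *)
Lemma discrete_lipschitz (R : realType) (n : nat) (p : 'rV[R]_n) (i : 'I_n)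
    (w : 'rV[R]_n -> R) (M s tau kappa : R) (q : nat) :
  0 < M -> 0 < s -> 0 < tau -> 2 * tau <= s -> q%:R * tau <= s ->
  (forall x, ccube p s x -> `|w x| <= M) ->
  (forall x, ccube p (s - tau) x ->
     `|\sum_(j < n) (w (x + tau *: ej R j) + w (x - tau *: ej R j) - 2 * w x)|
       <= kappa * tau ^+ 2) ->
  kappa * s ^+ 2 < 8 * M ->
  w (p + (q%:R * tau) *: ej R i) - w (p - (q%:R * tau) *: ej R i)
    <= 16 * n%:R * M * (q%:R * tau) / s.
Proof.
move=> M0 s0 t0 ts qs wM wk ks.
pose v x := w x - w (reflect_at p i x).
(* Where some coordinate of [x - p] is at least [s / 2] in absolute value, the barrier is at least
   [s^2 / 4], and [c * (s^2 / 4) = 2 * M] dominates [v]. *)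
pose c := 8 * M / s ^+ 2.
have s20 : 0 < s ^+ 2 by rewrite exprn_gt0.
have c0 : 0 < c by rewrite divr_gt0 // mulr_gt0.
pose g x := v x - c * barrier p i s x.
(* The distance to the hyperplane is a whole number of grid steps, so a walk towards it lands on it
   exactly, where [v] vanishes, before it can leave the half cube. *)
pose X : set 'rV[R]_n := [set x | ccube p s x /\ exists m : nat, x ord0 i = p ord0 i + m%:R * tau].
have n1 : (1 : R) <= n%:R by rewrite ler1n; case: n i {p w wM wk v g X} => [[]|].
have yX x : X x -> 0 <= x ord0 i - p ord0 i <= s.
  move=> [px [m xm]]; have := px i; rewrite xm addrAC subrr add0r.
  by rewrite ger0_norm ?mulr_ge0 ?(ltW t0) // => ->; rewrite mulr_ge0 ?(ltW t0).
have bge x : X x -> forall k, s / 2 <= `|x ord0 k - p ord0 k| -> s ^+ 2 / 4 <= barrier p i s x.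
  move=> Xx k sk; have /andP[y0 ys] := yX _ Xx; rewrite barrier_split.
  have S0 : 0 <= \sum_(k < n | k != i) (x ord0 k - p ord0 k) ^+ 2.
    by apply: sumr_ge0 => l _; rewrite sqr_ge0.
  have T0 : (x ord0 i - p ord0 i) * (2 * s - (x ord0 i - p ord0 i)) <=
     n%:R * (x ord0 i - p ord0 i) * (2 * s - (x ord0 i - p ord0 i)).
    by rewrite -mulrA ler_peMl // mulr_ge0 //; lra.
  have [ki|ki] := eqVneq k i.
    move: sk; rewrite ki ger0_norm //; nra.
  have Sk : (x ord0 k - p ord0 k) ^+ 2 <= \sum_(k < n | k != i) (x ord0 k - p ord0 k) ^+ 2.
    by rewrite (bigD1 k) //= lerDl; apply: sumr_ge0 => l _; rewrite sqr_ge0.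
  have : (s / 2) ^+ 2 <= (x ord0 k - p ord0 k) ^+ 2.
    by rewrite -[leRHS]real_normK ?num_real // lerXn2r // ?nnegrE ?divr_ge0 // ltW.
  nra.
have b0 x : X x -> 0 <= barrier p i s x.
  move=> Xx; have /andP[y0 ys] := yX _ Xx; rewrite barrier_split addr_ge0 //.
    by apply: sumr_ge0 => l _; rewrite sqr_ge0.
  by rewrite !mulr_ge0 //; lra.
have vM x : ccube p s x -> v x <= 2 * M.
  move=> px; have := wM _ px; have := wM _ (ccube_reflect_at i px).
  by rewrite /v !ler_norml; lra.
have gX : forall x, X x -> g x <= 0.
  apply: (@discrete_max_principle _ _ X g tau (2 * (c - kappa) * tau ^+ 2) (2 * M)).
  - rewrite !mulr_gt0 // ?exprn_gt0 // subr_gt0 /c ltr_pdivlMr //.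
  - move=> x Xx; have [px _] := Xx; have := vM _ px.
    have : 0 <= c * barrier p i s x by rewrite mulr_ge0 ?(ltW c0) ?b0.
    by rewrite /g; lra.
  move=> x Xx; have [px [m xm]] := Xx.
  case: m xm => [|m] xm.
    left; rewrite /g /v; have -> : reflect_at p i x = x.
      by rewrite /reflect_at xm mul0r addr0 subrr mulr0 scale0r subr0.
    by rewrite subrr sub0r oppr_le0 mulr_ge0 ?(ltW c0) ?b0.
  have [ps|] := pselect (ccube p (s - tau) x); last first.
    move=> /existsNP[k /negP]; rewrite -ltNge => sk; left.
    have : s ^+ 2 / 4 <= barrier p i s x by apply: (bge _ Xx k); lra.
    rewrite -(ler_pM2l c0) /g; have -> : c * (s ^+ 2 / 4) = 2 * M.
      by rewrite /c; field; rewrite gt_eqF.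
    by have := vM _ px; lra.
  right; split.
    move=> j; have tn : s - tau + `|tau| <= s by rewrite gtr0_norm // subrK.
    split; split; first exact: (ccube_shift _ ps tn).
    - rewrite shiftE xm; have [ij|ij] := eqVneq i j.
        by exists m.+2; rewrite mulr1 -[m.+2]addn1 natrD; ring.
      by exists m.+1; rewrite mulr0 addr0.
    - exact: (ccube_shiftN _ ps tn).
    - rewrite shiftNE xm; have [ij|ij] := eqVneq i j.
        by exists m; rewrite mulr1 -[m.+1]addn1 natrD; ring.
      by exists m.+1; rewrite mulr0 subr0.
  set y := reflect_at p i x.
  (* Reflection permutes the grid neighbours, so [v] contributes two discrete Laplacians of [w],
     each at most [kappa * tau^2] in size, against the exact [2 * c * tau^2] of the barrier. *)
  have E : \sum_(j < n) (g (x + tau *: ej R j) + g (x - tau *: ej R j) - 2 * g x) =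
    \sum_(j < n) (w (x + tau *: ej R j) + w (x - tau *: ej R j) - 2 * w x)
    - \sum_(j < n) (w (y + tau *: ej R j) + w (y - tau *: ej R j) - 2 * w y)
    + c * (2 * tau ^+ 2).
    rewrite -[2 * tau ^+ 2]opprK -(barrier_diff2 p i s tau x) mulrN mulr_sumr -!sumrB.
    apply: eq_bigr => j _; rewrite /g /v !reflect_at_shift !reflect_at_shiftN -/y.
    by case: (j == i); rewrite ?scaleNr ?opprK; ring.
  rewrite E; have := wk _ ps; have := wk _ (ccube_reflect_at i ps).
  rewrite -/y !ler_norml; set A := \sum_(j < n) _; set B := \sum_(j < n) _; lra.
have pX : X (p + (q%:R * tau) *: ej R i).
  split; last by exists q; rewrite shiftE eqxx mulr1.
  apply: (@ccube_shift _ _ _ 0); first by move=> k; rewrite subrr normr0.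
  by rewrite add0r ger0_norm // mulr_ge0 // ltW.
have := gX _ pX; rewrite /g /v subr_le0.
have -> : reflect_at p i (p + (q%:R * tau) *: ej R i) = p - (q%:R * tau) *: ej R i.
  rewrite reflect_at_shift eqxx scaleNr; congr (_ - _).
  by rewrite /reflect_at subrr mulr0 scale0r subr0.
move=> /le_trans; apply; rewrite barrier_split shiftE eqxx mulr1.
rewrite big1 ?add0r; last first.
  by move=> k ki; rewrite shiftE (negbTE ki) mulr0 addr0 subrr expr0n.
have -> : p ord0 i + q%:R * tau - p ord0 i = q%:R * tau by ring.
have -> : 16 * n%:R * M * (q%:R * tau) / s = c * (n%:R * (q%:R * tau) * (2 * s)).
  by rewrite /c; field; rewrite gt_eqF.
have t0' : 0 <= q%:R * tau by rewrite mulr_ge0 // ltW.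
rewrite ler_pM2l // ler_wpM2l ?mulr_ge0 //; lra.
Qed.

(** * Discretely monogenic functions *)

Lemma natmul_ge (R : realType) (a b : R) : 0 < b ->
  exists2 N : nat, (0 < N)%N & a <= N%:R * b.
Proof.
move=> b0; exists (Num.truncn (a / b)).+1 => //.
by rewrite -ler_pdivrMr //; apply/ltW/truncnS_gt.
Qed.

(** A derivative-free Dirac equation: the central Dirac sum tends to zero uniformly with its step.
    In this form it passes at once to smaller cubes and to differences of translates, and every
    sufficiently small grid is allowed. *)
Definition dmonogenic (R : realType) (n : nat) (p : 'rV[R]_n) (r : R)
    (H : 'rV[R]_n -> {set 'I_n} -> R) : Prop :=
  (forall e, 0 < e -> exists2 d, 0 < d & forall x y A, ccube p r x -> ccube p r y ->
     (forall i, `|x ord0 i - y ord0 i| <= d) -> `|H x A - H y A| <= e) /\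
  (forall e, 0 < e -> exists2 d, 0 < d & forall eta x A, 0 < eta -> eta <= d ->
     ccube p (r - eta) x -> `|ddirac eta H x A| <= e).

Lemma normr_lmul (R : realType) (n : nat) (j : 'I_n) (u : {set 'I_n} -> R)
    (C : {set 'I_n}) : `|lmul j u C| = `|u (twist j C)|.
Proof. by rewrite normrM normr_lsign mul1r. Qed.

(** The averaging length [h] is fixed before the grid: [h] controls the distance from [H] to its
    average, and afterwards the grid is refined until the discrete Laplacian of that average is
    negligible. The slack [e] is arbitrary, so the bound holds for [H] itself. *)
Lemma dmonogenic_lipschitz_center (R : realType) (n : nat) (p : 'rV[R]_n) (r M t : R)
    (H : 'rV[R]_n -> {set 'I_n} -> R) (i : 'I_n) (A : {set 'I_n}) :
  dmonogenic p r H -> 0 < r -> 0 < M -> 0 < t -> 2 * t <= r ->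
  (forall x B, ccube p r x -> `|H x B| <= M) ->
  H (p + t *: ej R i) A - H (p - t *: ej R i) A <= 32 * n%:R * M * t / r.
Proof.
move=> [Hu Hd] r0 M0 t0 tr HM; apply/ler_addgt0Pr => e e0.
have n0 : (0 : R) < n%:R by rewrite ltr0n; case: n i {p H A Hu Hd HM} => [[]|].
have n1 : (1 : R) <= n%:R by rewrite ler1n -(ltr0n R).
have e10 : 0 < e / (2 * n%:R) by rewrite divr_gt0 // mulr_gt0.
have [d1 d10 Hd1] := Hu _ e10.
have md : 0 < Num.min d1 (r / (8 * n%:R)) by rewrite lt_min d10 divr_gt0 // mulr_gt0.
(* The averaging length will be [t / Q]: at most [d1], so that averages stay close to [H], and at
   most [r / (8 n)], so that [n] successive averages stay in the cube. *)
have [Q Q0 tQ] := natmul_ge t md.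
have QR : (0 : R) < Q%:R by rewrite ltr0n.
pose h := t / Q%:R.
have h0 : 0 < h by rewrite divr_gt0.
have hd1 : h <= d1.
  by rewrite ler_pdivrMr // mulrC; apply: le_trans tQ _; rewrite ler_pM2l // ge_min lexx.
have hr : n%:R * h <= r / 8.
  have : h <= r / (8 * n%:R).
    rewrite ler_pdivrMr // mulrC; apply: le_trans tQ _.
    by rewrite ler_pM2l // ge_min lexx orbT.
  by rewrite invfM mulrA ler_pdivlMr // mulrC.
have hr' : h <= r / 8 by apply: le_trans hr; rewrite ler_peMl // ltW.
(* The tolerance for the discrete Dirac sum; it makes [kappa * (r / 2)^2 = M / 2], below the
   threshold [8 * M] of [discrete_lipschitz]. *)
have e20 : 0 < M * h / (n%:R * r ^+ 2) by apply: divr_gt0; apply: mulr_gt0 => //; rewrite exprn_gt0.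
set e2 := (X in 0 < X) in e20.
have [d2 d20 Hd2] := Hd _ e20.
have [N N0 hN] := natmul_ge h d20.
have NR : (0 : R) < N%:R by rewrite ltr0n.
(* The spacing [tau] divides [h], and [h] divides [t]: the averages then have length exactly [h],
   and both end points lie on grid layers. *)
pose eta := h / N%:R / 2; pose tau := 2 * eta.
have eta0 : 0 < eta by rewrite !divr_gt0.
have tau0 : 0 < tau by rewrite mulr_gt0.
have Ntau : N%:R * tau = h by rewrite /tau /eta; field; rewrite gt_eqF.
have tauh : tau <= h by rewrite -Ntau ler_peMl ?(ltW tau0) // ler1n.
have etad : eta <= d2.
  have : tau <= d2 by rewrite -(ler_pM2l NR) Ntau.
  by rewrite /tau; lra.
pose l := enum 'I_n.
have sl : (size l)%:R = n%:R :> R by rewrite /l size_enum_ord.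
pose w := avgs tau N l (H^~ A).
have tau_ge0 := ltW tau0.
have close y : ccube p (r / 2) y -> `|w y - H y A| <= e / 2.
  move=> py; have -> : e / 2 = (size l)%:R * (e / (2 * n%:R)).
    by rewrite sl; field; rewrite gt_eqF.
  apply: (@avgs_close _ _ _ _ _ _ p r) => //; last first.
    by rewrite sl Ntau; apply: ccubeW py; lra.
  move=> x t' j px px'; rewrite Ntau => t'h; apply: Hd1 => // k.
  rewrite shiftE addrC addKr normrM; case: (k == j); rewrite ?normr1 ?mulr1.
    exact: le_trans hd1.
  by rewrite normr0 mulr0 ltW.
have qt : (Q * N)%:R * tau = t.
  by rewrite natrM -mulrA Ntau /h; field; rewrite gt_eqF.
pose kappa := n%:R * (2 * e2 / h).
have main : w (p + t *: ej R i) - w (p - t *: ej R i) <= 32 * n%:R * M * t / r.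
  have -> : 32 * n%:R * M * t / r = 16 * n%:R * M * t / (r / 2).
    by field; rewrite gt_eqF.
  rewrite -qt; apply: (@discrete_lipschitz _ _ _ _ _ _ _ _ kappa) => //.
  - by rewrite divr_gt0.
  - by lra.
  - by rewrite qt; lra.
  - move=> x px; apply: (avgs_bound N0 tau_ge0 (fun y (py : ccube p r y) => HM y A py)).
    by apply: ccubeW px; rewrite sl Ntau; lra.
  - move=> x px; have t2 : 0 < tau ^+ 2 by rewrite exprn_gt0.
    have -> : \sum_(j < n) (w (x + tau *: ej R j) + w (x - tau *: ej R j) - 2 * w x) =
      tau ^+ 2 * \sum_(j < n) cdiff eta j (cdiff eta j w) x.
      rewrite mulr_sumr; apply: eq_bigr => j _; rewrite cdiff2 -/tau.
      by rewrite [RHS]mulrC divfK // gt_eqF.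
    rewrite normrM ger0_norm ?(ltW t2) // mulrC ler_pM2r //.
    rewrite -normrN -ddirac_avgs; apply: le_trans (ler_norm_sum _ _ _) _.
    apply: (@le_trans _ _ (\sum_(j < n) 2 * e2 / h)); last first.
      by rewrite sumr_const card_ord -[leLHS]mulr_natl.
    apply: ler_sum => j _; rewrite normr_lmul -Ntau.
    apply: (@cdiff_avgs_bound _ _ _ _ _ _ _ p (r - eta)) => //.
    + by move=> y py; apply: Hd2.
    + by rewrite mem_enum.
    by rewrite sl -/tau Ntau; apply: ccubeW px; rewrite /tau in tauh *; lra.
  rewrite /kappa /e2.
  have -> : n%:R * (2 * (M * h / (n%:R * r ^+ 2)) / h) * (r / 2) ^+ 2 = M / 2.
    by field; rewrite !gt_eqF.
  by lra.
have pp (s : R) : `|s| <= r / 2 -> ccube p (r / 2) (p + s *: ej R i).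
  move=> sr; apply: (@ccube_shift _ _ _ 0); last by rewrite add0r.
  by move=> k; rewrite subrr normr0.
have t2 : `|t| <= r / 2 by rewrite gtr0_norm //; lra.
have c1 := close _ (pp t t2).
have t2N : `|- t| <= r / 2 by rewrite normrN.
have := close _ (pp (- t) t2N); rewrite scaleNr => c2.
move: c1 c2; rewrite !ler_norml; lra.
Qed.

Lemma ccube_in (R : realType) (n : nat) (p m : 'rV[R]_n) (r s t : R) (x : 'rV[R]_n) :
  ccube p r m -> ccube m s x -> r + s <= t -> ccube p t x.
Proof.
move=> pm mx rst i; apply: le_trans rst.
have -> : x ord0 i - p ord0 i = (m ord0 i - p ord0 i) + (x ord0 i - m ord0 i) by ring.
by apply: le_trans (ler_normD _ _) _; apply: lerD.
Qed.

Lemma dmonogenic_sub (R : realType) (n : nat) (p m : 'rV[R]_n) (r s : R)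
    (H : 'rV[R]_n -> {set 'I_n} -> R) :
  dmonogenic p r H -> ccube p (r - s) m -> dmonogenic m s H.
Proof.
move=> [Hu Hd] pm; split => e /[dup] e0.
  move=> /Hu[d d0 h]; exists d => // x y A mx my; apply: h.
    by apply: ccube_in pm mx _; rewrite subrK.
  by apply: ccube_in pm my _; rewrite subrK.
move=> /Hd[d d0 h]; exists d => // eta x A eta0 etad mx; apply: h => //.
by apply: ccube_in pm mx _; lra.
Qed.

Lemma dmonogenic_lipschitz_axis (R : realType) (n : nat) (p : 'rV[R]_n) (r M s t : R)
    (H : 'rV[R]_n -> {set 'I_n} -> R) (i : 'I_n) (A : {set 'I_n}) (x : 'rV[R]_n) :
  dmonogenic p r H -> 0 < M -> 0 < s ->
  (forall x B, ccube p r x -> `|H x B| <= M) ->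
  ccube p (r - s) x -> ccube p (r - s) (x + t *: ej R i) ->
  `|H (x + t *: ej R i) A - H x A| <= 16 * n%:R * M * `|t| / s.
Proof.
move=> dH M0 s0 HM.
wlog t0 : t x / 0 < t => [hw px px'|].
  case: (ltgtP t 0) => t0; last first.
  - by rewrite t0 scale0r addr0 subrr !normr0 mulr0 mul0r.
  - exact: hw.
  have Nt0 : 0 < - t by rewrite oppr_gt0.
  have := hw _ _ Nt0 px'; rewrite scaleNr addrK normrN => /(_ px).
  by rewrite distrC.
move=> px px'; rewrite (gtr0_norm t0).
have n1 : (1 : R) <= n%:R by rewrite ler1n; case: n i {p x H A HM px px' dH} => [[]|].
pose m := x + (t / 2) *: ej R i.
have pm : ccube p (r - s) m.
  move=> k; have := px k; have := px' k; rewrite !shiftE !ler_norml.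
  by case: (k == i) => /=; lra.
have x'E : x + t *: ej R i = m + (t / 2) *: ej R i.
  by rewrite /m -addrA -scalerDl -splitr.
have xE : x = m - (t / 2) *: ej R i by rewrite /m addrK.
(* Beyond distance [s] the trivial bound [2 * M] is already small enough; otherwise the cube of
   radius [s] about the midpoint lies inside the given one. *)
have [ts|ts] := lerP t s; last first.
  have rs : r - s <= r by lra.
  have h2 := HM _ A (ccubeW rs px); have h1 := HM _ A (ccubeW rs px').
  apply: le_trans (ler_normB _ _) _; apply: le_trans (lerD h1 h2) _.
  rewrite ler_pdivlMr //.
  have a1 : M * s <= M * t by rewrite ler_pM2l // ltW.
  have a2 : M * t <= n%:R * (M * t) by rewrite ler_peMl // mulr_ge0 ?ltW.
  have a3 : 0 < M * t by rewrite mulr_gt0.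
  lra.
have dm := dmonogenic_sub dH pm.
have HMm y B : ccube m s y -> `|H y B| <= M.
  by move=> my; apply: HM; apply: ccube_in pm my _; rewrite subrK.
have t20 : 0 < t / 2 by rewrite divr_gt0.
have t2s : 2 * (t / 2) <= s by lra.
have c1 := dmonogenic_lipschitz_center i A dm s0 M0 t20 t2s HMm.
(* The centred estimate is one-sided; applied to [- H] it gives the other side. *)
have dmN : dmonogenic m s (fun x A => - H x A).
  case: dm => Hu Hd; split => e /[dup] e0.
    by move=> /Hu[d d0 h]; exists d => // y z B my mz yz; rewrite -opprD normrN; apply: h.
  move=> /Hd[d d0 h]; exists d => // eta y B eta0 etad my.
  have -> : ddirac eta (fun x A => - H x A) y B = - ddirac eta H y B.
    rewrite /ddirac -sumrN; apply: eq_bigr => j _; rewrite /lmul /cdiff; ring.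
  by rewrite normrN; apply: h.
have HMN y B : ccube m s y -> `|- H y B| <= M by rewrite normrN; apply: HMm.
have c2 := dmonogenic_lipschitz_center i A dmN s0 M0 t20 t2s HMN.
have E : 32 * n%:R * M * (t / 2) / s = 16 * n%:R * M * t / s.
  by field; rewrite gt_eqF.
have Hx : H x A = H (m - (t / 2) *: ej R i) A by congr (H _ A).
move: c1 c2; rewrite x'E Hx E => c1 c2.
by rewrite ler_norml; apply/andP; split; lra.
Qed.

(** The coordinates in [l] have already moved from [x] to [y]: the corners of a path from [x] to [y]
    along the axes. *)
Definition mix (R : realType) (n : nat) (x y : 'rV[R]_n) (l : seq 'I_n) : 'rV[R]_n :=
  \row_i (if i \in l then y ord0 i else x ord0 i).

Lemma dmonogenic_lipschitz (R : realType) (n : nat) (p : 'rV[R]_n) (r M s g : R)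
    (H : 'rV[R]_n -> {set 'I_n} -> R) (A : {set 'I_n}) (x y : 'rV[R]_n) :
  dmonogenic p r H -> 0 < M -> 0 < s ->
  (forall x B, ccube p r x -> `|H x B| <= M) ->
  ccube p (r - s) x -> ccube p (r - s) y -> ccube x g y ->
  `|H y A - H x A| <= M * (16 * n%:R ^+ 2 * g / s).
Proof.
move=> dH M0 s0 HM px py xy.
suff K l : `|H (mix x y l) A - H x A| <= (size l)%:R * (16 * n%:R * M * g / s).
  have := K (enum 'I_n); rewrite size_enum_ord.
  have -> : mix x y (enum 'I_n) = y by apply/rowP => i; rewrite mxE mem_enum.
  by move=> /le_trans; apply; rewrite le_eqVlt; apply/orP; left; apply/eqP; ring.
have pmix l' : ccube p (r - s) (mix x y l').
  by move=> k; rewrite mxE; case: ifP.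
elim: l => [|j l IH].
  have -> : mix x y [::] = x by apply/rowP => i; rewrite mxE.
  by rewrite subrr normr0 mul0r.
have E : mix x y (j :: l) =
    mix x y l + (if j \in l then 0 else y ord0 j - x ord0 j) *: ej R j.
  apply/rowP => k; rewrite shiftE !mxE inE; have [->|kj] := eqVneq k j.
    by case: ifP => _ /=; rewrite ?mul0r ?addr0 // mulr1 addrC subrK.
  by rewrite mulr0 addr0.
set t := (if _ then _ else _) in E.
have tg : `|t| <= g.
  rewrite /t; case: ifP => _; last exact: xy.
  by rewrite normr0; apply: le_trans (normr_ge0 _) (xy j).
rewrite -[H _ A](subrK (H (mix x y l) A)) -addrA.
apply: le_trans (ler_normD _ _) _; rewrite /= -[(size l).+1]addn1 natrD mulrDl mul1r.
rewrite [leRHS]addrC; apply: lerD => //; rewrite E.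
apply: le_trans (dmonogenic_lipschitz_axis (s := s) A dH M0 s0 HM _ _) _ => //.
  by rewrite -E.
by rewrite ler_pM2r ?invr_gt0 // ler_wpM2l // !mulr_ge0 // ltW.
Qed.

(** * Iterated finite differences and Newton's formula *)

Definition fdiff (R : realType) (n : nat) (v : 'rV[R]_n)
    (H : 'rV[R]_n -> {set 'I_n} -> R) : 'rV[R]_n -> {set 'I_n} -> R :=
  fun x A => H (x + v) A - H x A.

Lemma ccube_add (R : realType) (n : nat) (p : 'rV[R]_n) (r g s : R) (x v : 'rV[R]_n) :
  ccube p r x -> (forall i, `|v ord0 i| <= g) -> r + g <= s -> ccube p s (x + v).
Proof.
move=> px vg; apply: ccube_in px _ => i; rewrite mxE [_ + v _ _]addrC addrK; exact: vg.
Qed.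

Lemma dmonogenic_fdiff (R : realType) (n : nat) (p v : 'rV[R]_n) (r g : R)
    (H : 'rV[R]_n -> {set 'I_n} -> R) :
  dmonogenic p r H -> 0 <= g -> (forall i, `|v ord0 i| <= g) ->
  dmonogenic p (r - g) (fdiff v H).
Proof.
move=> [Hu Hd] g0 vg.
have rg : r - g <= r by rewrite gerBl.
split => e e0; have e20 : 0 < e / 2 by rewrite divr_gt0.
  have [d d0 h] := Hu _ e20; exists d => // x y A px py xy.
  have -> : fdiff v H x A - fdiff v H y A =
    (H (x + v) A - H (y + v) A) - (H x A - H y A) by rewrite /fdiff; ring.
  apply: le_trans (ler_normB _ _) _; rewrite [e]splitr; apply: lerD; apply: h => //.
  - by apply: ccube_add px vg _; rewrite subrK.
  - by apply: ccube_add py vg _; rewrite subrK.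
  - by move=> i; rewrite !mxE opprD addrACA subrr addr0.
  - exact: ccubeW px.
  - exact: ccubeW py.
have [d d0 h] := Hd _ e20; exists d => // eta x A eta0 etad px.
have -> : ddirac eta (fdiff v H) x A = ddirac eta H (x + v) A - ddirac eta H x A.
  rewrite /ddirac -sumrB; apply: eq_bigr => j _; rewrite /lmul /cdiff /fdiff.
  by rewrite [x + v + _]addrAC [x + v - _]addrAC; ring.
apply: le_trans (ler_normB _ _) _; rewrite [e]splitr; apply: lerD; apply: h => //.
  by apply: ccube_add px vg _; lra.
by apply: ccubeW px; lra.
Qed.

(** A difference is a Lipschitz increment and again discretely monogenic, so the estimate feeds on
    itself. Each round gives up [s] of the radius to the Lipschitz estimate and [g] to the
    translate. *)
Lemma iter_fdiff_bound (R : realType) (n : nat) (p v : 'rV[R]_n) (r M s g : R)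
    (H : 'rV[R]_n -> {set 'I_n} -> R) (k : nat) :
  dmonogenic p r H -> (0 < n)%N -> 0 < M -> 0 < s -> 0 < g ->
  (forall i, `|v ord0 i| <= g) ->
  (forall x B, ccube p r x -> `|H x B| <= M) ->
  dmonogenic p (r - k%:R * (s + g)) (iter k (fdiff v) H) /\
  (forall x B, ccube p (r - k%:R * (s + g)) x ->
    `|iter k (fdiff v) H x B| <= M * (16 * n%:R ^+ 2 * g / s) ^+ k).
Proof.
move=> dH n0 M0 s0 g0 vg HM; elim: k => [|k [dk bk]].
  by rewrite mul0r subr0 expr0 mulr1.
have nR : (0 : R) < n%:R by rewrite ltr0n.
have C0 : 0 < 16 * n%:R ^+ 2 * g / s by rewrite divr_gt0 // !mulr_gt0 // exprn_gt0.
have -> : r - k.+1%:R * (s + g) = r - k%:R * (s + g) - s - g.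
  by rewrite -[k.+1]addn1 natrD; ring.
set rk := r - _ in dk bk *.
have dk1 : dmonogenic p (rk - s - g) (iter k.+1 (fdiff v) H).
  rewrite iterS; apply: dmonogenic_fdiff => //; last exact: ltW.
  apply: (dmonogenic_sub dk) => i; rewrite subrr normr0; lra.
split=> // x B px; rewrite iterS exprSr mulrA.
apply: (dmonogenic_lipschitz (s := s) B dk) => //.
- by rewrite mulr_gt0 // exprn_gt0.
- by apply: ccubeW px; lra.
- by apply: ccube_add px vg _; rewrite subrK.
by move=> i; rewrite mxE [_ + v _ _]addrC addrK.
Qed.

Lemma newton_forward (R : realType) (n : nat) (v x : 'rV[R]_n)
    (H : 'rV[R]_n -> {set 'I_n} -> R) (A : {set 'I_n}) (N : nat) :
  H (x + v *+ N) A = \sum_(j < N.+1) 'C(N, j)%:R * iter j (fdiff v) H x A.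
Proof.
elim: N H => [|N IH] H; first by rewrite mulr0n addr0 big_ord1 bin0 mul1r.
have -> : H (x + v *+ N.+1) A = H (x + v *+ N) A + fdiff v H (x + v *+ N) A.
  by rewrite /fdiff [RHS]addrC subrK mulrSr addrA.
rewrite IH IH [in RHS]big_ord_recl /= bin0 mul1r.
under [in RHS]eq_bigr do rewrite /bump /= add1n binS natrD mulrDl.
rewrite big_split /= addrA; congr (_ + _).
  transitivity (\sum_(j < N.+2) 'C(N, j)%:R * iter j (fdiff v) H x A).
    by rewrite [RHS]big_ord_recr /= bin_small // mul0r addr0.
  by rewrite big_ord_recl bin0 mul1r.
by apply: eq_bigr => j _; rewrite -iterS iterSr.
Qed.

Lemma iter_fdiff_eq0 (R : realType) (n : nat) (v x : 'rV[R]_n)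
    (H : 'rV[R]_n -> {set 'I_n} -> R) (A : {set 'I_n}) (m : nat) :
  (forall k, (k < m)%N -> H (x + v *+ k) A = 0) ->
  forall j k, (j + k < m)%N -> iter j (fdiff v) H (x + v *+ k) A = 0.
Proof.
move=> H0; elim=> [|j IH] k jk; first exact: H0.
rewrite iterS /fdiff -addrA -mulrSr !IH ?subrr // ?addnS //.
by apply: leq_ltn_trans jk; rewrite leq_add2r.
Qed.

(* The bounds on iterated differences are those of an analytic function, so Newton's
   formula with ever finer steps transports a zero half-segment to its full length. *)
Lemma dmonogenic_continuation (R : realType) (n : nat) (p x w : 'rV[R]_n) (r M s g : R)
    (H : 'rV[R]_n -> {set 'I_n} -> R) (A : {set 'I_n}) :
  dmonogenic p r H -> (0 < n)%N -> 0 < M -> 0 < s -> 0 < g ->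
  (forall i, `|w ord0 i| <= g) ->
  (forall x B, ccube p r x -> `|H x B| <= M) ->
  128 * n%:R ^+ 2 * g <= s -> ccube p (r - s - g) x ->
  (forall t : R, 0 <= t -> 2 * t < 1 -> H (x + t *: w) A = 0) ->
  H (x + w) A = 0.
Proof.
move=> dH n0 M0 s0 g0 wg HM gs px H0.
have nR : (0 : R) < n%:R by rewrite ltr0n.
(* A bound by [M / (m + 1)] for every [m] forces the value to be zero. *)
have K m : `|H (x + w) A| * (m.+1)%:R <= M.
  (* Exactly the nodes [0, ..., m] of the [N] steps lie strictly inside the first half, so all
     differences of order at most [m] at [x] vanish. *)
  set N := (m.+1).*2.
  have NR : (0 : R) < N%:R by rewrite ltr0n double_gt0.
  have NE : N%:R = 2 * m.+1%:R :> R by rewrite /N -mul2n natrM.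
  pose v := N%:R^-1 *: w.
  have vk k : v *+ k = (k%:R / N%:R) *: w by rewrite -scaler_nat scalerA.
  have -> : x + w = x + v *+ N by rewrite vk divff ?scale1r // gt_eqF.
  have D j : (j < N.+1)%N -> `|iter j (fdiff v) H x A| <= M * 8^-1 ^+ m.+1.
    move=> jN; have [jm|mj] := ltnP j m.+1.
      have -> : x = x + v *+ 0 by rewrite mulr0n addr0.
      rewrite (@iter_fdiff_eq0 _ _ _ _ _ _ m.+1) ?normr0 ?addn0 //.
        by rewrite mulr_ge0 ?exprn_ge0 ?invr_ge0 // ltW.
      move=> k km; rewrite vk; apply: H0; first by rewrite divr_ge0.
      rewrite mulrA ltr_pdivrMr // mul1r NE ltr_pM2l // ltr_nat //.
    (* With [s / j] of radius per difference and steps of size [g / N], the total loss is at most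
       [s + g], and each difference gains a factor [16 n^2 g (j / N) / s], at most [1 / 8]. *)
    have j0 : (0 : R) < j%:R by rewrite ltr0n; apply: leq_trans mj.
    have sj0 : 0 < s / j%:R by rewrite divr_gt0.
    have gN0 : 0 < g / N%:R by rewrite divr_gt0.
    have vg i : `|v ord0 i| <= g / N%:R.
      by rewrite mxE normrM ger0_norm ?invr_ge0 // mulrC ler_pM2r ?invr_gt0.
    have [_ /(_ x A)] := iter_fdiff_bound j dH n0 M0 sj0 gN0 vg HM.
    have jNR : j%:R / N%:R <= 1 :> R by rewrite ler_pdivrMr // mul1r ler_nat.
    have jg : g * (j%:R / N%:R) <= g by rewrite ler_piMr // ltW.
    move=> /(_ _)/le_trans; apply.
      apply: ccubeW px; have -> : j%:R * (s / j%:R + g / N%:R) = s + g * (j%:R / N%:R).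
        by field; rewrite !gt_eqF.
      lra.
    rewrite ler_pM2l //; set q := (X in X ^+ j <= _).
    have q0 : 0 <= q by rewrite /q !mulr_ge0 ?invr_ge0 ?exprn_ge0 ?divr_ge0 // ltW.
    have q8 : q <= 8^-1.
      have -> : q = 16 * n%:R ^+ 2 * (g * (j%:R / N%:R)) / s.
        by rewrite /q; field; rewrite !gt_eqF.
      rewrite ler_pdivrMr //.
      have : n%:R ^+ 2 * (g * (j%:R / N%:R)) <= n%:R ^+ 2 * g.
        by rewrite ler_wpM2l // exprn_ge0 // ltW.
      lra.
    apply: (@le_trans _ _ (8^-1 ^+ j)); first by rewrite lerXn2r // nnegrE.
    by apply: ler_wiXn2l => //; lra.
  rewrite newton_forward.
  (* The binomial coefficients sum to [2^N = 4^(m+1)], half of whose exponential growth rate in base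
     two remains as decay against [8^-(m+1)]. *)
  have B : `|\sum_(j < N.+1) 'C(N, j)%:R * iter j (fdiff v) H x A| <= M * 2^-1 ^+ m.+1.
    apply: le_trans (ler_norm_sum _ _ _) _.
    apply: (@le_trans _ _ (\sum_(j < N.+1) 'C(N, j)%:R * (M * 8^-1 ^+ m.+1))).
      apply: ler_sum => j _; rewrite normrM ger0_norm // ler_wpM2l //.
      exact: D.
    rewrite -mulr_suml -natr_sum.
    have -> : (\sum_(j < N.+1) 'C(N, j))%N = (4 ^ m.+1)%N.
      rewrite (_ : 4 = 2 ^ 2)%N // -expnM mul2n -/N -[2%N]/(1 + 1)%N expnDn.
      by apply: eq_bigr => j _; rewrite !exp1n !muln1.
    rewrite natrX mulrCA ler_pM2l // -exprMn.
    by rewrite (_ : 4 * 8^-1 = 2^-1) //; field.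
  apply: le_trans (ler_wpM2r _ B) _ => //.
  rewrite -mulrA ler_piMr ?(ltW M0) // exprVn mulrC ler_pdivrMr ?exprn_gt0 // mul1r.
  by rewrite -natrX ler_nat ltnW // ltn_expl.
apply/eqP; rewrite -normr_le0 leNgt; apply/negP => a0.
have [N N0 h] := natmul_ge (M + 1) a0.
have := K N.-1; rewrite prednK // mulrC; lra.
Qed.

(** * Monogenic functions on cubes *)

Definition ocube (R : realType) (n : nat) (p : 'rV[R]_n) (r : R) : set 'rV[R]_n :=
  [set x | forall i, `|x ord0 i - p ord0 i| < r].

Lemma nbhs_ocubeP (R : realType) (n : nat) (x : 'rV[R]_n) (P : set 'rV[R]_n) :
  nbhs x P <-> exists2 e, 0 < e & ocube x e `<=` P.
Proof.
have bE e y : 0 < e -> ball x e y <-> ocube x e y.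
  move=> e0; split=> [[_ h] i|h]; first by have := h ord0 i; rewrite /ball/= distrC.
  by split=> // i j; rewrite ord1 /ball /= distrC; apply: h.
split=> [/nbhs_ballP[e /= e0 h]|[e e0 h]].
  by exists e => // y /(bE _ _ e0)/h.
by apply/nbhs_ballP; exists e => //= y /(bE _ _ e0)/h.
Qed.

Lemma ocube_open (R : realType) (n : nat) (p : 'rV[R]_n) (r : R) : open (ocube p r).
Proof.
rewrite openE => x px; apply/nbhs_ocubeP.
have [n0|[i _ iP]] : n = 0%N \/ exists2 i : 'I_n, true &
    forall k, `|x ord0 k - p ord0 k| <= `|x ord0 i - p ord0 i|.
  case: n p x px => [|n] p x px; [by left|right].
  by have [i _ iP] := @arg_maxP _ _ _ ord0 xpredT (fun k => `|x ord0 k - p ord0 k|) isT;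
     exists i => // k; apply: iP.
- by subst n; exists 1 => // y _ [].
exists (r - `|x ord0 i - p ord0 i|); first by rewrite subr_gt0.
move=> y xy k; have -> : y ord0 k - p ord0 k = (y ord0 k - x ord0 k) + (x ord0 k - p ord0 k) by ring.
have := xy k; have := iP k; have := ler_normD (y ord0 k - x ord0 k) (x ord0 k - p ord0 k); lra.
Qed.

(** Both sides have the same difference quotient. One-variable calculus, such as the mean value
    theorem and the chain rule, enters through this equivalence. *)
Lemma is_derive_line (R : realType) (n : nat) (u : 'rV[R]_n -> R) (x v : 'rV[R]_n)
    (s l : R) :
  is_derive (x + s *: v) v u l <-> is_derive s 1 (fun t : R => u (x + t *: v)) l.
Proof.
have E : (fun h : R => h^-1 *: ((u \o shift (x + s *: v)) (h *: v) - u (x + s *: v))) =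
    (fun h : R => h^-1 *: (((fun t : R => u (x + t *: v)) \o shift s) (h *: 1) -
      u (x + s *: v))).
  apply/funext => h /=; congr (_ *: (u _ - _)).
  by rewrite [h *: 1]mulr1 addrCA -scalerDl.
split=> -[d1 d2]; split; move: d1 d2; rewrite /derivable /derive E //.
Qed.

Lemma compact_ccube (R : realType) (n : nat) (p : 'rV[R]_n) (r : R) :
  compact [set x | ccube p r x].
Proof.
have -> : [set x | ccube p r x] =
    [set x | forall i, `[p ord0 i - r, p ord0 i + r]%classic (x ord0 i)].
  apply/seteqP; split=> x h i; have := h i; rewrite /= in_itv /= ler_distl //.
apply: (@rV_compact _ _ (fun i => `[p ord0 i - r, p ord0 i + r]%classic)) => i.
exact: segment_compact.
Qed.

Lemma uniform_continuity_ccube (R : realType) (n : nat) (p : 'rV[R]_n) (r e : R)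
    (u : 'rV[R]_n -> R) :
  (forall x, ccube p r x -> {for x, continuous u}) -> 0 < e ->
  exists2 d, 0 < d & forall x y, ccube p r x -> ccube p r y ->
     (forall i, `|x ord0 i - y ord0 i| <= d) -> `|u x - u y| <= e.
Proof.
move=> uc e0.
have /compact_near_coveringP C := @compact_ccube R n p r.
pose P (d : R) (x : 'rV[R]_n) := forall y : 'rV[R]_n, (forall i, `|x ord0 i - y ord0 i| <= d) ->
  `|u x - u y| <= e.
have : \forall d \near (0 : R)^'+, [set x | ccube p r x] `<=` P d.
  apply: C => x px; have e20 : 0 < e / 2 by rewrite divr_gt0.
  have /cvgrPdist_lt/(_ _ e20)/nbhs_ocubeP[d d0 dx] := uc _ px.
  (* Half of the radius of continuity is for moving the base point, the other half for the
     increment. *)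
  exists (ocube x (d / 2), [set t : R | t < d / 2]).
    split; last by apply: nbhs_right_lt; rewrite divr_gt0.
    by apply/nbhs_ocubeP; exists (d / 2); rewrite // divr_gt0.
  move=> [y t] [/= xy td] z yz.
  have y1 : `|u x - u y| < e / 2 by apply: dx => i; have := xy i; lra.
  have z1 : `|u x - u z| < e / 2.
    apply: dx => i; have := xy i; have := yz i.
    have := ler_normB (y ord0 i - x ord0 i) (y ord0 i - z ord0 i).
    have -> : y ord0 i - x ord0 i - (y ord0 i - z ord0 i) = z ord0 i - x ord0 i by ring.
    lra.
  have -> : u y - u z = (u x - u z) - (u x - u y) by ring.
  by apply: le_trans (ler_normB _ _) _; lra.
move=> h; have [d [d0 dP]] := @filter_ex _ _ _ _ (filterI (@nbhs_right_gt R 0) h).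
by exists d => // x y px _ xy; apply: dP.
Qed.

Lemma bounded_ccube (R : realType) (n : nat) (p : 'rV[R]_n) (r : R) (u : 'rV[R]_n -> R) :
  (forall x, ccube p r x -> {for x, continuous u}) ->
  exists2 M, 0 < M & forall x, ccube p r x -> `|u x| <= M.
Proof.
move=> uc; have /compact_near_coveringP C := @compact_ccube R n p r.
have : \forall M \near +oo, [set x | ccube p r x] `<=` (fun x => `|u x| <= M).
  apply: C => x px.
  have /cvgrPdist_lt/(_ _ (ltr01))/nbhs_ocubeP[d d0 dx] := uc _ px.
  exists (ocube x d, [set t : R | `|u x| + 1 <= t]).
    split; last exact: nbhs_pinfty_ge.
    by apply/nbhs_ocubeP; exists d.
  move=> [y t] [/= /dx xy td]; apply: le_trans td.
  have := ler_normB (u x) (u x - u y); rewrite opprB addrC subrK; lra.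
move=> h; have [d [d0 dP]] := @filter_ex _ _ _ _ (filterI (nbhs_pinfty_gt (num_real (0 : R))) h).
by exists d.
Qed.

Definition monogenic_on (R : realType) (n : nat) (Q : set 'rV[R]_n)
    (H : 'rV[R]_n -> {set 'I_n} -> R) : Prop :=
  [/\ forall A x, Q x -> differentiable (H^~ A) x,
      forall A j x, Q x -> {for x, continuous (fun y => 'D_(ej R j) (H^~ A) y)} &
      forall x A, Q x -> \sum_(j < n) lmul j (fun B => 'D_(ej R j) (H^~ B) x) A = 0].

(** By the mean value theorem each central difference is a partial derivative at some nearby point,
    a different one for each direction. Uniform continuity moves all of them to [x], where the Dirac
    sum is zero. *)
Lemma dmonogenic_of_C1 (R : realType) (n : nat) (p : 'rV[R]_n) (r : R)
    (H : 'rV[R]_n -> {set 'I_n} -> R) (d : 'I_n -> 'rV[R]_n -> {set 'I_n} -> R) :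
  (forall A x, ccube p r x -> {for x, continuous (H^~ A)}) ->
  (forall A j x, ccube p r x -> is_derive x (ej R j) (H^~ A) (d j x A)) ->
  (forall A j x, ccube p r x -> {for x, continuous (fun y => d j y A)}) ->
  (forall x A, ccube p r x -> \sum_(j < n) lmul j (d j x) A = 0) ->
  dmonogenic p r H.
Proof.
move=> Hc Hd dc H0; split => e e0.
  have [D DP] := @choice _ _ (fun A d => 0 < d /\ forall x y, ccube p r x -> ccube p r y ->
     (forall i, `|x ord0 i - y ord0 i| <= d) -> `|H x A - H y A| <= e)
     (fun A => let: ex_intro2 d a b := uniform_continuity_ccube (@Hc A) e0 in
         ex_intro _ d (conj a b)).
  exists (\big[Num.min/1]_A D A).
    by apply: (big_ind (fun z : R => 0 < z)) => // [x y x0 y0|A _]; [rewrite lt_min x0|case: (DP A)].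
  move=> x y A px py xy; case: (DP A) => _; apply=> // i; apply: le_trans (xy i) _.
  exact: bigmin_le.
pose e1 := e / (n%:R + 1).
have n1 : (0 : R) < n%:R + 1 by rewrite ltr_wpDl.
have e10 : 0 < e1 by rewrite divr_gt0.
have [D DP] := @choice _ _ (fun (Aj : {set 'I_n} * 'I_n) d0 => 0 < d0 /\
     forall x y, ccube p r x -> ccube p r y ->
     (forall i, `|x ord0 i - y ord0 i| <= d0) -> `|d Aj.2 x Aj.1 - d Aj.2 y Aj.1| <= e1)
     (fun Aj => let: ex_intro2 d a b := uniform_continuity_ccube (@dc Aj.1 Aj.2) e10 in
         ex_intro _ d (conj a b)).
exists (\big[Num.min/1]_Aj D Aj).
  by apply: (big_ind (fun z : R => 0 < z)) => // [x y x0 y0|A _]; [rewrite lt_min x0|case: (DP A)].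
move=> eta x A eta0 etaD px.
have pxr : ccube p r x by apply: ccubeW px; lra.
have mvt j B : exists2 xi, ccube p r xi & (forall i, `|xi ord0 i - x ord0 i| <= eta) /\
    cdiff eta j (H^~ B) x = d j xi B.
  have Nee : - eta < eta by lra.
  have pl (s : R) : s \in `[- eta, eta] -> ccube p r (x + s *: ej R j).
    by rewrite in_itv /= -ler_norml => s1; apply: ccube_shift px _; lra.
  pose f (s : R) := H (x + s *: ej R j) B; pose f' (s : R) := d j (x + s *: ej R j) B.
  have df s : s \in `[- eta, eta] -> is_derive s 1 f (f' s).
    by move=> sI; apply: (proj1 (is_derive_line (H^~ B) x (ej R j) s _)); apply: Hd; apply: pl.
  have df' s : s \in `]- eta, eta[ -> is_derive s 1 f (f' s).
    by move=> sI; apply: df; apply: subset_itv_oo_cc sI.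
  have fc : {within `[- eta, eta], continuous f}.
    apply: continuous_in_subspaceT => s; rewrite inE => /df[fs _].
    by apply: differentiable_continuous; apply/derivable1_diffP.
  have [s sI sE] := MVT Nee df' fc.
  exists (x + s *: ej R j); first by apply: pl; apply: subset_itv_oo_cc sI.
  split.
    move=> i; rewrite shiftE addrC addKr normrM.
    move: sI; rewrite in_itv /= -ltr_norml => /ltW sI.
    by case: (i == j); rewrite ?normr1 ?mulr1 // normr0 mulr0 ltW.
  rewrite /cdiff -scaleNr -[LHS]/((f eta - f (- eta)) / (2 * eta)) sE opprK.
  have -> : eta + eta = 2 * eta by ring.
  by rewrite mulfK // gt_eqF // mulr_gt0.
rewrite -[ddirac _ _ _ _]subr0 -(H0 _ A pxr) /ddirac -sumrB.
apply: le_trans (ler_norm_sum _ _ _) _.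
apply: (@le_trans _ _ (\sum_(j < n) e1)); last first.
  rewrite sumr_const card_ord -[leLHS]mulr_natl /e1 mulrA ler_pdivrMr // mulrC ler_pM2l //.
  by lra.
apply: ler_sum => j _; rewrite /lmul -mulrBr normrM normr_lsign mul1r.
have [xi pxi [xix ->]] := mvt j (twist j A).
have [_] := DP (twist j A, j); apply => // i; apply: le_trans (xix i) _.
by apply: le_trans etaD _; apply: bigmin_le.
Qed.

(** * Uniqueness across the sphere *)

Definition sqn (R : realType) (n : nat) (x : 'rV[R]_n) : R := \sum_(i < n) x ord0 i ^+ 2.

Lemma is_deriveP (R : realType) (V : normedModType R) (f : V -> R) (a v : V) (l : R) :
  is_derive a v f l <->
  (fun h : R => h^-1 *: ((f \o shift a) (h *: v) - f a)) @ 0^' --> l.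
Proof.
split=> [[d <-]|h]; first exact: d.
by split; [apply/cvg_ex; exists l|apply: cvg_lim].
Qed.

Lemma differentiable_sqn (R : realType) (n : nat) (x : 'rV[R]_n) :
  differentiable (@sqn R n) x.
Proof.
have -> : @sqn R n = \sum_(i < n) (fun y : 'rV[R]_n => y ord0 i ^+ 2).
  by apply/funext => y; rewrite fct_sumE.
apply: differentiable_sum => i; have c := differentiable_coord x ord0 i.
exact: (differentiableM c c).
Qed.

Lemma continuous_sqn (R : realType) (n : nat) : continuous (@sqn R n).
Proof. by move=> x; apply: differentiable_continuous; apply: differentiable_sqn. Qed.

Lemma continuous_dist (R : realType) (n : nat) (f : 'rV[R]_n -> R) (x : 'rV[R]_n) :
  {for x, continuous f} <-> forall e, 0 < e -> \forall y \near x, `|f x - f y| < e.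
Proof.
split=> [fc e e0|h]; first by have /cvgrPdist_lt/(_ _ e0) := fc.
exact: (@proj2 _ _ (@cvgrPdist_lt _ _ _ (nbhs x) _ f (f x)) h).
Qed.

(* The sign [sg] selects on which side of the sphere the function is replaced by zero:
   inside for [sg = 1], outside for [sg = -1]. *)
Definition cut (R : realType) (n : nat) (sg : R) (f : 'rV[R]_n -> R) (x : 'rV[R]_n) : R :=
  if sg * (sqn x - 1) < 0 then 0 else f x.

Lemma cut_near (R : realType) (n : nat) (sg : R) (f : 'rV[R]_n -> R) (x : 'rV[R]_n) :
  sg != 0 -> sqn x != 1 ->
  (\near x, cut sg f x = 0) /\ sg * (sqn x - 1) < 0 \/
  (\near x, f x = cut sg f x) /\ ~~ (sg * (sqn x - 1) < 0).
Proof.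
move=> s0 x1.
have c : (fun y => sg * (@sqn R n y - 1)) @ x --> sg * (sqn x - 1).
  apply: (@differentiable_continuous _ _ _ _ (fun y => sg * (@sqn R n y - 1))).
  apply: (@differentiableM _ _ (cst sg) (fun y => sqn y - 1)); first exact: differentiable_cst.
  by apply: differentiableB; [exact: differentiable_sqn|exact: differentiable_cst].
have nz : sg * (sqn x - 1) != 0 by rewrite mulf_neq0 // subr_eq0.
case: (ltgtP (sg * (sqn x - 1)) 0) nz => // h _; [left|right]; split=> //.
  have hh : \forall y \near x, sg * (sqn y - 1) < 0 by apply: (cvgr_lt _ c).
  apply: (@filterS _ (nbhs x)) hh => y yh; by rewrite /cut yh.
have hh : \forall y \near x, 0 < sg * (sqn y - 1) by apply: (cvgr_gt _ c).
apply: (@filterS _ (nbhs x)) hh => y yh; by rewrite /cut ltNge (ltW yh).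
Qed.

Lemma cut_norm_le (R : realType) (n : nat) (sg : R) (f : 'rV[R]_n -> R) (x : 'rV[R]_n) :
  `|cut sg f x| <= `|f x|.
Proof. by rewrite /cut; case: ifP => // _; rewrite normr0. Qed.

Lemma continuous_cut (R : realType) (n : nat) (sg : R) (f : 'rV[R]_n -> R)
    (x : 'rV[R]_n) : sg != 0 ->
  {for x, continuous f} -> (sqn x = 1 -> f x = 0) -> {for x, continuous (cut sg f)}.
Proof.
move=> s0 fc f0; have [x1|x1] := eqVneq (sqn x) 1; last first.
  have [[h hx]|[h hx]] := cut_near f s0 x1.
    have cx : cut sg f x = 0 by rewrite /cut hx.
    apply/continuous_dist => e e0; rewrite cx; apply: (@filterS _ (nbhs x)) h => y ->.
    by rewrite subrr normr0.
  have cx : cut sg f x = f x by rewrite /cut (negbTE hx).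
  apply/continuous_dist => e e0; rewrite cx.
  have /continuous_dist/(_ _ e0) fe := fc.
  by apply: (@filterS2 _ (nbhs x)) h fe => y ->.
have c0 : cut sg f x = 0 by rewrite /cut x1 subrr mulr0 ltxx f0.
apply/continuous_dist => e e0; rewrite c0.
have /continuous_dist/(_ _ e0) := fc; apply: (@filterS _ (nbhs x)) => y; rewrite f0 // !sub0r !normrN.
exact: le_lt_trans (cut_norm_le _ _ _).
Qed.

(** Off the sphere the cut function is locally [f] or zero. On the sphere [f] and its derivative
    vanish, and the difference quotient of the cut is dominated by that of [f]. *)
Lemma is_derive_cut (R : realType) (n : nat) (sg : R) (f : 'rV[R]_n -> R)
    (x v : 'rV[R]_n) (l : R) : sg != 0 ->
  is_derive x v f l -> (sqn x = 1 -> f x = 0 /\ l = 0) ->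
  is_derive x v (cut sg f) (if sg * (sqn x - 1) < 0 then 0 else l).
Proof.
move=> s0 fd f0; have [x1|x1] := eqVneq (sqn x) 1; last first.
  have [[h hx]|[h hx]] := cut_near f s0 x1.
    rewrite hx; apply: (near_eq_is_derive _ (is_derive_cst (0 : R) x v)).
    by apply: (@filterS _ (nbhs x)) h => y ->.
  by rewrite (negbTE hx); apply: near_eq_is_derive fd.
have [fx l0] := f0 x1; rewrite l0 if_same.
have c0 : cut sg f x = 0 by rewrite /cut x1 subrr mulr0 ltxx fx.
move: fd; rewrite l0 => /is_deriveP fd; apply/is_deriveP/cvgrPdist_lt => e e0.
have /cvgrPdist_lt/(_ _ e0) := fd; apply: filterS => h; rewrite !sub0r !normrN /=.
rewrite fx c0 !subr0 !normrZ; apply: le_lt_trans.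
by rewrite ler_wpM2l // cut_norm_le.
Qed.

(** * Vanishing of the gradient on the sphere *)

Lemma sqn_rotate (R : realType) (n : nat) (x : 'rV[R]_n) (i j : 'I_n) (a b : R) :
  i != j ->
  sqn (x + a *: ej R i + b *: ej R j) =
  sqn x + a * (2 * x ord0 i + a) + b * (2 * x ord0 j + b).
Proof.
move=> ij; rewrite /sqn.
rewrite (bigD1 i) // (bigD1 j) //= 1?eq_sym // [in RHS](bigD1 i) // [in RHS](bigD1 j) //=;
  last by rewrite eq_sym.
rewrite (eq_bigr (fun k => x ord0 k ^+ 2)); last first.
  by move=> k /andP[ki kj]; rewrite !shiftE (negbTE ki) (negbTE kj) !mulr0 !addr0.
rewrite !shiftE !eqxx [j == i]eq_sym (negbTE ij) /=; ring.
Qed.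

Lemma derive_scalel (R : realType) (V : normedModType R) (k : R -> R) (w : V) (t : R) :
  differentiable k t -> 'D_1 (fun s => k s *: w) t = 'D_1 k t *: w.
Proof.
by move=> dk; rewrite !deriveE ?diffZl //; apply: differentiableZl.
Qed.

(** Rotation in the plane of [e_i] and [e_j] keeps [x] on the sphere, where [f] vanishes; the
    identity is the chain rule along this circle at time zero. *)
Lemma tangential_derivative_eq0 (R : realType) (n : nat) (x : 'rV[R]_n) (i j : 'I_n)
    (f : 'rV[R]_n -> R) :
  sqn x = 1 -> differentiable f x -> (\near x, sqn x = 1 -> f x = 0) ->
  x ord0 i * 'D_(ej R j) f x = x ord0 j * 'D_(ej R i) f x.
Proof.
move=> x1 df f0; have [->//|ij] := eqVneq i j.
(* The displacements of the two coordinates of [x] under rotation by the angle [t]. *)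
pose a (t : R) := (cos t - 1) * x ord0 i - sin t * x ord0 j.
pose b (t : R) := sin t * x ord0 i + (cos t - 1) * x ord0 j.
pose gam (t : R) : 'rV[R]_n := x + a t *: ej R i + b t *: ej R j.
have da : is_derive (0 : R) 1 a (- x ord0 j).
  apply: is_derive_eq; rewrite sin0 cos0 /GRing.scale /=; ring.
have db : is_derive (0 : R) 1 b (x ord0 i).
  apply: is_derive_eq; rewrite sin0 cos0 /GRing.scale /=; ring.
have da' : differentiable a 0 by apply/derivable1_diffP; case: da.
have db' : differentiable b 0 by apply/derivable1_diffP; case: db.
have gam0 : gam 0 = x.
  by rewrite /gam /a /b cos0 sin0 subrr !mul0r subr0 addr0 !scale0r !addr0.
have E : gam = (cst x + (fun t => a t *: ej R i)) + (fun t => b t *: ej R j) by [].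
have ca : differentiable (fun t => a t *: ej R i) (0 : R) by apply: differentiableZl.
have cb : differentiable (fun t => b t *: ej R j) (0 : R) by apply: differentiableZl.
have cx : differentiable (cst x) (0 : R) by apply: differentiable_cst.
have cab : differentiable (cst x + (fun t => a t *: ej R i)) (0 : R).
  exact: differentiableD.
have dgam : differentiable gam 0 by rewrite E; apply: differentiableD.
have gE : 'd gam 0 1 = - x ord0 j *: ej R i + x ord0 i *: ej R j.
  rewrite -deriveE // E.
  rewrite (deriveD (diff_derivable cab) (diff_derivable cb)).
  rewrite (deriveD (diff_derivable cx) (diff_derivable ca)) derive_cst add0r.
  rewrite (derive_scalel _ da') (derive_scalel _ db').
  by rewrite (@derive_val _ _ _ _ _ _ _ da) (@derive_val _ _ _ _ _ _ _ db).
have df' : differentiable f (gam 0) by rewrite gam0.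
have z : 'd (f \o gam) 0 1 = 0.
  rewrite -deriveE; last exact: differentiable_comp.
  rewrite (@near_eq_derive _ _ _ _ (cst 0)) ?derive_cst //.
  have gc : gam @ (0 : R) --> x by rewrite -gam0; apply: differentiable_continuous.
  have g0 : \forall t \near (0 : R), sqn (gam t) = 1 -> f (gam t) = 0 by exact: gc _ f0.
  apply: (@filterS _ (nbhs (0 : R))) g0 => t /= -> //.
  rewrite /gam sqn_rotate // x1 /a /b.
  have : cos t * cos t + sin t * sin t = 1 by rewrite -!expr2 cos2Dsin2.
  set c := cos t; set s := sin t; set p := x ord0 i; set q := x ord0 j => cs.
  have -> : 1 + ((c - 1) * p - s * q) * (2 * p + ((c - 1) * p - s * q)) +
    (s * p + (c - 1) * q) * (2 * q + (s * p + (c - 1) * q)) =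
    1 + (p ^+ 2 + q ^+ 2) * (c * c + s * s - 1) by ring.
  by rewrite cs subrr mulr0 addr0.
rewrite (diff_comp dgam df') in z.
have {}z : 'd f x ('d gam 0 1) = 0 by rewrite -[in LHS]gam0.
rewrite gE linearD !linearZ -!(deriveE _ df) in z.
by apply/eqP; rewrite -subr_eq0 addrC -mulNr; apply/eqP.
Qed.

(** The tangential relations turn [sum_j x_j e_j D_i H] into [x_i sum_j e_j D_j H], which is zero.
    So the vector [x] annihilates [D_i H], and multiplying by [x] once more gives
    [- |x|^2 D_i H = 0]. *)
Lemma gradient_eq0_on_sphere (R : realType) (n : nat) (Q : set 'rV[R]_n)
    (H : 'rV[R]_n -> {set 'I_n} -> R) (x : 'rV[R]_n) (i : 'I_n) (A : {set 'I_n}) :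
  open Q -> monogenic_on Q H -> (forall y B, Q y -> sqn y = 1 -> H y B = 0) ->
  Q x -> sqn x = 1 -> 'D_(ej R i) (H^~ A) x = 0.
Proof.
move=> oQ [Hd _ Hm] H0 Qx x1.
have nQ : \forall y \near x, Q y by apply: open_nbhs_nbhs.
have T j B : x ord0 i * 'D_(ej R j) (H^~ B) x = x ord0 j * 'D_(ej R i) (H^~ B) x.
  apply: tangential_derivative_eq0 => //; first exact: Hd.
  by apply: (@filterS _ (nbhs x)) nQ => y Qy y1; apply: H0.
have := @lmul_square R n (fun k j B => x ord0 k * x ord0 j * 'D_(ej R i) (H^~ B) x) A
  (fun k j B => congr1 (fun z => z * _) (mulrC _ _)).
rewrite big1; last first.
  move=> k _; rewrite /lmul; apply/eqP; rewrite mulf_eq0; apply/orP; right.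
  have := Hm x (twist k A) Qx => /(congr1 (fun z => x ord0 k * x ord0 i * z)).
  rewrite mulr0 mulr_sumr => E; rewrite -[X in _ == X]E; apply/eqP.
  by apply: eq_bigr => j _; rewrite /lmul -mulrA -T; ring.
rewrite -mulr_suml.
have -> : \sum_(k < n) x ord0 k * x ord0 k = 1.
  by rewrite -x1; apply: eq_bigr => k _; rewrite expr2.
by rewrite mul1r => /eqP; rewrite eq_sym oppr_eq0 => /eqP.
Qed.

Lemma sphere_coord_le1 (R : realType) (n : nat) (p : 'rV[R]_n) (i : 'I_n) :
  sqn p = 1 -> `|p ord0 i| <= 1.
Proof.
move=> p1; rewrite -(@expr_le1 _ 2) // real_normK ?num_real // -p1 /sqn (bigD1 i) //=.
by rewrite lerDl sumr_ge0 // => k _; rewrite sqr_ge0.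
Qed.

(** For [x = p + u], [|x - a p|^2 = (1 - a)^2 + 2 (1 - a) p.u + |u|^2], and both [|p.u|] and [|u|^2]
    are at most [n * c]. A shift by more than [3 * n * c] therefore decides the side of the
    sphere. *)
Lemma sqn_shift_side (R : realType) (n : nat) (p x : 'rV[R]_n) (sg c th : R) :
  sqn p = 1 -> sg = 1 \/ sg = -1 -> 0 <= c -> c <= 1 -> ccube p c x ->
  3 * n%:R * c < th -> th <= 1 -> sg * (sqn (x - (sg * th) *: p) - 1) < 0.
Proof.
move=> p1 sg1 c0 c1 px cth th1.
pose u k := x ord0 k - p ord0 k.
have nc : 0 <= n%:R * c by rewrite mulr_ge0.
have E a : sqn (x - a *: p) = (1 - a) ^+ 2 + (2 * (1 - a) * \sum_(k < n) p ord0 k * u k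
    + \sum_(k < n) u k ^+ 2).
  have -> : (1 - a) ^+ 2 = (1 - a) ^+ 2 * sqn p by rewrite p1 mulr1.
  rewrite /sqn !mulr_sumr -!big_split /=.
  by apply: eq_bigr => k _; rewrite !mxE /u; ring.
have uc k : `|u k| <= c by apply: px.
have S1 : `|\sum_(k < n) p ord0 k * u k| <= n%:R * c.
  apply: le_trans (ler_norm_sum _ _ _) _.
  rewrite mulr_natl -[X in _ *+ X]card_ord -sumr_const; apply: ler_sum => k _.
  rewrite normrM -[leRHS]mul1r; apply: ler_pM => //; exact: sphere_coord_le1.
have S2 : \sum_(k < n) u k ^+ 2 <= n%:R * c.
  rewrite mulr_natl -[X in _ *+ X]card_ord -sumr_const; apply: ler_sum => k _.
  rewrite -real_normK ?num_real //; apply: (@le_trans _ _ (c ^+ 2)).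
    by rewrite lerXn2r // nnegrE.
  by rewrite expr2 ler_piMr.
have S20 : 0 <= \sum_(k < n) u k ^+ 2 by apply: sumr_ge0 => k _; rewrite sqr_ge0.
move: S1; rewrite ler_norml E; set S := \sum_(k < n) _; set V := \sum_(k < n) _ in S2 S20 *.
move=> /andP[Sl Su].
case: sg1 => ->; rewrite ?mul1r ?mulN1r ?opprK.
  have : (1 - th) * S <= (1 - th) * (n%:R * c) by rewrite ler_wpM2l //; lra.
  nra.
have : (1 + th) * - (n%:R * c) <= (1 + th) * S by rewrite ler_wpM2l //; lra.
nra.
Qed.

(* Makes the displacement [6 n c], [c] being this radius times [r], short enough for the
   continuation lemma: [128 n^2 (6 n c) <= r / 4]. *)
Definition uniq_radius (R : realType) (n : nat) : R := (12 * 16 ^+ 2 * n%:R ^+ 3)^-1.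
Arguments uniq_radius R n : clear implicits.

(** The segment ending at [x] is directed along [p], so its first half can be placed on the side
    where the cut function is zero; continuation carries the zero to [x]. *)
Lemma monogenic_sphere_unique (R : realType) (n : nat) (p : 'rV[R]_n) (r : R)
    (H : 'rV[R]_n -> {set 'I_n} -> R) (x : 'rV[R]_n) (A : {set 'I_n}) :
  (0 < n)%N -> sqn p = 1 -> 0 < r -> r <= 1 -> monogenic_on (ocube p r) H ->
  (forall y B, ocube p r y -> sqn y = 1 -> H y B = 0) ->
  ccube p (uniq_radius R n * r) x -> H x A = 0.
Proof.
move=> n0 p1 r0 r1 mH H0 px.
have [Hd Hc Hm] := mH.
have n1 : (1 : R) <= n%:R by rewrite ler1n.
have n3 : (1 : R) <= n%:R ^+ 3 by rewrite exprn_ege1.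
pose c := uniq_radius R n * r.
have k0 : 0 < (12 * 16 ^+ 2 * n%:R ^+ 3 : R).
  by apply: mulr_gt0; [rewrite mulr_gt0 // exprn_gt0|apply: lt_le_trans n3].
have n33 : 12 * 16 ^+ 2 * (n%:R ^+ 3 * c) = r.
  by rewrite /c /uniq_radius mulrA mulVKf // gt_eqF.
have cp : 0 < c by apply: mulr_gt0 => //; rewrite invr_gt0.
have n2 : n%:R <= n%:R ^+ 3 :> R by rewrite ler_eXnr.
have n23 : 12 * 16 ^+ 2 * (n%:R ^+ 2 * (n%:R * c)) = r by rewrite -[RHS]n33; ring.
have nc : n%:R * c <= n%:R ^+ 3 * c by rewrite ler_pM2r.
have cn : c <= n%:R * c by rewrite ler_peMl // ltW.
have G0 := fun y j B (Qy : ocube p r y) => @gradient_eq0_on_sphere R n _ H y j B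
  (@ocube_open R n p r) mH H0 Qy.
(* The side replaced by zero is the one that does not contain [x], so the value at [x] is kept. *)
pose sg : R := if sqn x < 1 then -1 else 1.
have sg1 : sg = 1 \/ sg = -1 by rewrite /sg; case: ifP; [right|left].
have sg0 : sg != 0 by case: sg1 => ->; rewrite ?oppr_eq0 oner_eq0.
have Kx : cut sg (H^~ A) x = H x A.
  rewrite /cut ifF //; apply/negbTE; rewrite -leNgt /sg.
  by case: (ltP (sqn x) 1) => h; rewrite ?mulN1r ?mul1r; lra.
rewrite -Kx.
have cQ y : ccube p (r / 2) y -> ocube p r y.
  by move=> py i; apply: le_lt_trans (py i) _; lra.
pose K (y : 'rV[R]_n) B := cut sg (H^~ B) y.
have Kc B y : ccube p (r / 2) y -> {for y, continuous (K^~ B)}.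
  move=> /cQ Qy; apply: continuous_cut => //; last by apply: H0.
  by apply: differentiable_continuous; apply: Hd.
pose D j (y : 'rV[R]_n) B := cut sg (fun y => 'D_(ej R j) (H^~ B) y) y.
have dK : dmonogenic p (r / 2) K.
  apply: (@dmonogenic_of_C1 _ _ _ _ _ D) => //.
  - move=> B j y /cQ Qy; apply: is_derive_cut => //.
      by apply: derivableP; apply: diff_derivable; apply: Hd.
    by move=> y1; split; [apply: H0|apply: G0].
  - move=> B j y /cQ Qy; apply: continuous_cut => //; first exact: Hc.
    by move=> y1; apply: G0.
  move=> y B /cQ Qy; case h : (sg * (sqn y - 1) < 0).
    by apply: big1 => j _; rewrite /lmul /D /cut h mulr0.
  by rewrite -[RHS](Hm y B Qy); apply: eq_bigr => j _; rewrite /lmul /D /cut h.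
have [M MP] := @choice _ _ (fun B M => 0 < M /\ forall y, ccube p (r / 2) y -> `|K y B| <= M)
   (fun B => let: ex_intro2 d a b := bounded_ccube (@Kc B) in ex_intro _ d (conj a b)).
pose M0 := \sum_B M B.
have MM0 B : M B <= M0.
  by rewrite /M0 (bigD1 B) //= lerDl sumr_ge0 // => B' _; apply/ltW; case: (MP B').
have M00 : 0 < M0 by apply: lt_le_trans (MM0 A); case: (MP A).
(* Points of the first half of the segment are at a shift of more than [g / 2 = 3 * n * c] from [x],
   the margin that [sqn_shift_side] requires. *)
pose g := 6 * (n%:R * c).
pose w := (sg * g) *: p.
have g0 : 0 < g by rewrite /g; lra.
have wg i : `|w ord0 i| <= g.
  rewrite mxE normrM [`|sg * g|]normrM (gtr0_norm g0) -mulrA; have -> : `|sg| = 1.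
    by case: sg1 => ->; rewrite ?normrN normr1.
  by rewrite mul1r ler_piMr ?(ltW g0) // sphere_coord_le1.
have -> : x = x - w + w by rewrite subrK.
apply: (@dmonogenic_continuation _ _ p _ _ (r / 2) M0 (r / 4) g K) => //.
- by rewrite divr_gt0.
- by move=> y B py; apply: le_trans (MM0 B); case: (MP B) => _; apply.
- by rewrite /g; lra.
- apply: (@ccube_add _ _ _ c g) => //; first by move=> i; rewrite mxE normrN.
  by rewrite /g; lra.
move=> t t0 t1; rewrite /K /cut.
have -> : x - w + t *: w = x - (sg * ((1 - t) * g)) *: p.
  by rewrite /w; apply/rowP => i; rewrite !mxE; ring.
have tg : g / 2 < (1 - t) * g by rewrite mulrC ltr_pM2r //; lra.
have tg1 : (1 - t) * g <= g by rewrite ler_piMl ?(ltW g0) //; lra.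
rewrite (@sqn_shift_side _ _ p x sg c) //; first exact: ltW.
- by lra.
- by apply: le_lt_trans tg; rewrite /g; lra.
- by apply: le_trans tg1 _; rewrite /g; lra.
Qed.

(** * Continuously differentiable functions and uniform limits *)

Lemma ocube_between (R : realType) (n : nat) (p y : 'rV[R]_n) (r t s : R) (j : 'I_n) :
  ocube p r y -> ocube p r (y + t *: ej R j) -> 0 <= s <= 1 ->
  ocube p r (y + (s * t) *: ej R j).
Proof.
move=> py pyt /andP[s0 s1] i; have := py i; have := pyt i; rewrite !shiftE.
set a := y ord0 i - p ord0 i; set b := t * (i == j)%:R.
have -> : y ord0 i + b - p ord0 i = a + b by rewrite /a; ring.
have -> : y ord0 i + s * t * (i == j)%:R - p ord0 i = (1 - s) * a + s * (a + b).
  by rewrite /a /b; ring.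
move=> h1 h2; apply: le_lt_trans (ler_normD _ _) _; rewrite !normrM.
rewrite (@ger0_norm _ s) // (@ger0_norm _ (1 - s)) ?subr_ge0 //.
have [s00|s00] := eqVneq s 0; first by rewrite s00; lra.
have s0' : 0 < s by rewrite lt_neqAle eq_sym s00.
have : s * `|a + b| < s * r by rewrite ltr_pM2l.
have : (1 - s) * `|a| <= (1 - s) * r by rewrite ler_wpM2l ?subr_ge0 // ltW.
lra.
Qed.

(** Parametrising the segment by [[0, 1]] treats positive, negative and zero [t] alike. *)
Lemma mvt_axis (R : realType) (n : nat) (p y : 'rV[R]_n) (r t : R) (j : 'I_n)
    (f d : 'rV[R]_n -> R) :
  (forall x, ocube p r x -> is_derive x (ej R j) f (d x)) ->
  ocube p r y -> ocube p r (y + t *: ej R j) ->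
  exists2 z, ocube p r z & f (y + t *: ej R j) - f y = t * d z.
Proof.
move=> fd py pyt.
have pl (s : R) : s \in `[0, 1] -> ocube p r (y + s *: (t *: ej R j)).
  by rewrite in_itv /= => s01; rewrite scalerA; apply: ocube_between.
pose g (s : R) := f (y + s *: (t *: ej R j)).
pose g' (s : R) := t * d (y + s *: (t *: ej R j)).
have dg (s : R) : s \in `[0, 1] -> is_derive s 1 g (g' s).
  move=> /pl ps; have fs := fd _ ps.
  rewrite /g; under eq_fun do rewrite scalerA.
  have h1 : is_derive (s * t) 1 (fun u : R => f (y + u *: ej R j)) (d (y + s *: (t *: ej R j))).
    apply: (proj1 (is_derive_line f y (ej R j) (s * t) _)).
    by rewrite -[(s * t) *: _]scalerA.
  have h2 : is_derive s 1 (fun s : R => s * t) t.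
    by apply: is_derive_eq; rewrite /GRing.scale /= ?mulr1 ?mulr0 ?addr0 ?add0r.
  have := @is_derive1_comp _ (fun u : R => f (y + u *: ej R j)) (fun s : R => s * t) s _ _ h1 h2.
  by rewrite /g' mulrC; apply.
have dg' (s : R) : s \in `]0, 1[ -> is_derive s 1 g (g' s).
  by move=> sI; apply: dg; apply: subset_itv_oo_cc sI.
have gc : {within `[0, 1], continuous g}.
  apply: continuous_in_subspaceT => s; rewrite inE => /dg[gs _].
  by apply: differentiable_continuous; apply/derivable1_diffP.
have [s sI sE] := MVT ltr01 dg' gc.
exists (y + s *: (t *: ej R j)); first by apply: pl; apply: subset_itv_oo_cc sI.
by move: sE; rewrite /g /g' scale1r scale0r addr0 subr0 mulr1.
Qed.

(** The candidate differential with partial derivatives [c]; its linear structure is what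
    [diff_unique] asks for. *)
Definition dotl (R : realType) (n : nat) (c : 'I_n -> R) (v : 'rV[R]_n) : R :=
  \sum_(j < n) v ord0 j * c j.

Lemma dotl_is_linear (R : realType) (n : nat) (c : 'I_n -> R) : linear (dotl c).
Proof.
move=> a u v; rewrite /dotl scaler_sumr -big_split /=; apply: eq_bigr => j _.
by rewrite !mxE /GRing.scale /=; ring.
Qed.

HB.instance Definition _ (R : realType) (n : nat) (c : 'I_n -> R) :=
  GRing.isLinear.Build R 'rV[R]_n R _ (dotl c) (@dotl_is_linear R n c).

Lemma coord_le_norm (R : realType) (n : nat) (v : 'rV[R]_n) (j : 'I_n) :
  `|v ord0 j| <= `|v|.
Proof.
rewrite leNgt; apply/negP => h.
have : ball (0 : 'rV[R]_n) `|v ord0 j| v by rewrite -ball_normE /= sub0r normrN.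
by move=> [_ /(_ ord0 j)]; rewrite /ball /= mxE sub0r normrN ltxx.
Qed.

Lemma continuous_dotl (R : realType) (n : nat) (c : 'I_n -> R) : continuous (dotl c).
Proof.
move=> x; apply: differentiable_continuous.
have -> : dotl c = \sum_(j < n) (fun v : 'rV[R]_n => v ord0 j * c j).
  by apply/funext => y; rewrite fct_sumE.
apply: differentiable_sum => j; apply: differentiableM; last exact: differentiable_cst.
exact: differentiable_coord.
Qed.

(** The increment from [x] to [x + h] is split along the axes. The mean value theorem gives each
    piece as [h_j] times a partial derivative near [x], which continuity at [x] compares with the
    one at [x]. *)
Lemma C1_differentiable (R : realType) (n : nat) (x : 'rV[R]_n) (r : R)
    (f : 'rV[R]_n -> R) (d : 'I_n -> 'rV[R]_n -> R) :
  0 < r -> (forall j y, ocube x r y -> is_derive y (ej R j) f (d j y)) ->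
  (forall j, {for x, continuous (d j)}) ->
  differentiable f x.
Proof.
move=> r0 fd dc; pose c j := d j x.
have E : f \o shift x = cst (f x) + dotl c +o_ (0 : 'rV[R]_n) id.
  apply/eqaddoP => e e0.
  pose e1 := e / (n%:R + 1).
  have n1 : (0 : R) < n%:R + 1 by rewrite ltr_wpDl.
  have e10 : 0 < e1 by rewrite divr_gt0.
  have [D DP] := @choice _ _ (fun j d0 => 0 < d0 /\ forall y, ocube x d0 y ->
      `|d j x - d j y| < e1)
     (fun j => let: ex_intro2 d a b := proj1 (nbhs_ocubeP _ _)
        (proj1 (continuous_dist _ _) (dc j) _ e10) in ex_intro _ d (conj a b)).
  pose del := \big[Num.min/r]_j D j.
  have del0 : 0 < del.
    by apply: (big_ind (fun z : R => 0 < z)) => // [a b a0 b0|j _]; [rewrite lt_min a0|case: (DP j)].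
  have delr : del <= r by apply: bigmin_le_id.
  have dd j y : ocube x del y -> `|d j y - c j| <= e1.
    move=> xy; rewrite distrC; apply/ltW; case: (DP j) => _; apply => i.
    by apply: lt_le_trans (xy i) _; apply: bigmin_le.
  have nd : \forall h \near (0 : 'rV[R]_n), ocube 0 del h.
    by apply/nbhs_ocubeP; exists del.
  apply: (@filterS _ (nbhs (0 : 'rV[R]_n))) nd => h hd.
  have hdel i : `|h ord0 i| < del by have := hd i; rewrite mxE subr0.
  rewrite -[((_ : 'rV[R]_n -> R) - _) h]/(f (h + x) - (f x + dotl c h)).
  (* Without repetitions each coordinate moves exactly once, so the sum over [l] counts each [h_j]
     once. *)
  have K l : uniq l -> `|f (mix x (h + x) l) - (f x + \sum_(j <- l) h ord0 j * c j)| <=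
      \sum_(j <- l) e1 * `|h|.
    elim: l => [_|j l IH /= /andP[jl ul]].
      have -> : mix x (h + x) [::] = x by apply/rowP => i; rewrite mxE.
      by rewrite !big_nil addr0 subrr normr0.
    have mE : mix x (h + x) (j :: l) = mix x (h + x) l + h ord0 j *: ej R j.
      apply/rowP => k; rewrite shiftE !mxE inE; have [->|kj] := eqVneq k j.
        by rewrite (negbTE jl) /= mulr1 addrC.
      by rewrite mulr0 addr0.
    have pmix l' : ocube x del (mix x (h + x) l').
      move=> k; rewrite mxE; case: ifP => _; last by rewrite subrr normr0.
      by rewrite mxE addrK.
    have fd' y : ocube x del y -> is_derive y (ej R j) f (d j y).
      by move=> xy; apply: fd => i; apply: lt_le_trans (xy i) _.
    have [|z zd zE] := @mvt_axis _ _ x (mix x (h + x) l) del (h ord0 j) j f (d j) fd' (pmix l).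
      by rewrite -mE.
    rewrite !big_cons mE.
    have -> : f (mix x (h + x) l + h ord0 j *: ej R j) -
        (f x + (h ord0 j * c j + \sum_(j0 <- l) h ord0 j0 * c j0)) =
      h ord0 j * (d j z - c j) + (f (mix x (h + x) l) -
        (f x + \sum_(j0 <- l) h ord0 j0 * c j0)).
      by rewrite mulrBr -zE; ring.
    apply: le_trans (ler_normD _ _) _; apply: lerD; last exact: IH.
    rewrite normrM mulrC; apply: ler_pM => //; [exact: dd|exact: coord_le_norm].
  have := K (index_enum 'I_n) (index_enum_uniq _).
  have -> : mix x (h + x) (index_enum 'I_n) = h + x.
    by apply/rowP => i; rewrite mxE mem_index_enum.
  move=> /le_trans; apply; rewrite sumr_const card_ord -[leLHS]mulr_natl mulrA.
  apply: ler_wpM2r => //; rewrite /e1 mulrA ler_pdivrMr // mulrC ler_pM2l //; lra.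
have U := diff_unique (@continuous_dotl R n c) E.
by apply/diff_locallyP; rewrite U; split=> //; apply: continuous_dotl.
Qed.

(** * Limits of functions and of their derivatives under a common majorant *)

(** Both [T] and [u + T] are nondecreasing and bounded, so [u] converges as their difference; the
    error bound is the tail of [T]. *)
Lemma summable_increments (R : realType) (u T : nat -> R) (l : R) :
  (forall N, `|u N.+1 - u N| <= T N.+1 - T N) -> T @ \oo --> l ->
  cvgn u /\ forall N, `|limn u - u N| <= l - T N.
Proof.
move=> uT Tl.
have T_nd : nondecreasing_seq T.
  by apply/nondecreasing_seqP => N; have := uT N; have := normr_ge0 (u N.+1 - u N); lra.
have Tle N : T N <= l.
  by rewrite -(cvg_lim _ Tl) //; apply: nondecreasing_cvgn_le => //; apply/cvg_ex; exists l.
have uTk N k : `|u (N + k)%N - u N| <= T (N + k)%N - T N.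
  elim: k => [|k IH]; first by rewrite addn0 !subrr normr0.
  rewrite addnS; have := uT (N + k)%N.
  have := ler_normD (u (N + k).+1 - u (N + k)%N) (u (N + k)%N - u N).
  by rewrite addrA subrK; lra.
have cw : cvgn (fun N => u N + T N).
  apply: nondecreasing_is_cvgn.
    by apply/nondecreasing_seqP => N; have := uT N; rewrite ler_norml; lra.
  exists (u 0%N + l - T 0%N + l) => _ [N _ <-].
  have := uTk 0%N N; rewrite add0n ler_norml; have := Tle N; lra.
have cu : cvgn u.
  have -> : u = (fun N => (u N + T N) - T N) by apply/funext => N; rewrite addrK.
  by apply: is_cvgB => //; apply/cvg_ex; exists l.
split=> // N.
have c1 : (fun M => `|u M - u N|) @ \oo --> `|limn u - u N|.
  by apply: cvg_norm; apply: cvgB => //; apply: cvg_cst.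
rewrite -(cvg_lim _ c1) //; apply: limr_le; first by apply/cvg_ex; eexists; exact: c1.
exists N => // M /= NM; rewrite -(subnKC NM); apply: le_trans (uTk _ _) _.
by have := Tle (N + (M - N))%N; lra.
Qed.

Lemma continuous_uniform_limit (R : realType) (n : nat) (p x : 'rV[R]_n) (r : R)
    (u : nat -> 'rV[R]_n -> R) (F : 'rV[R]_n -> R) (b : nat -> R) :
  (forall N, {for x, continuous (u N)}) -> ocube p r x ->
  (forall N y, ocube p r y -> `|F y - u N y| <= b N) -> b @ \oo --> (0 : R) ->
  {for x, continuous F}.
Proof.
move=> uc px Fu b0; apply/continuous_dist => e e0.
have e30 : 0 < e / 3 by rewrite divr_gt0.
have [N bN] : exists N, b N < e / 3.
  have /cvgrPdist_lt/(_ _ e30)[N _ h] := b0; exists N.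
  by have := h N (leqnn N); rewrite /= sub0r normrN; apply: le_lt_trans; apply: ler_norm.
have /continuous_dist/(_ _ e30) c1 := uc N.
have c2 : \forall y \near x, ocube p r y by apply: open_nbhs_nbhs; split=> //; apply: ocube_open.
apply: (@filterS2 _ (nbhs x)) c1 c2 => y h1 h2.
have := Fu N x px; have := Fu N y h2.
have -> : F x - F y = (F x - u N x) + (u N x - u N y) - (F y - u N y) by ring.
have := ler_normB ((F x - u N x) + (u N x - u N y)) (F y - u N y).
have := ler_normD (F x - u N x) (u N x - u N y); lra.
Qed.

(** The mean value theorem cannot be applied to [F], whose derivative is sought. It is applied to
    [u M - u N], and letting [M] grow bounds the increments of [F - u N] by a multiple of [|t|]. *)
Lemma is_derive_uniform_limit (R : realType) (n : nat) (p x : 'rV[R]_n) (r : R) (j : 'I_n)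
    (u d : nat -> 'rV[R]_n -> R) (F D : 'rV[R]_n -> R) (T : nat -> R) (l : R) :
  (forall N y, ocube p r y -> is_derive y (ej R j) (u N) (d N y)) ->
  (forall y, ocube p r y -> u^~ y @ \oo --> F y) ->
  (forall N y, ocube p r y -> `|D y - d N y| <= l - T N) -> T @ \oo --> l ->
  ocube p r x ->
  is_derive x (ej R j) F (D x).
Proof.
move=> ud uF dD Tl px.
have b0 : (fun N => l - T N) @ \oo --> (0 : R).
  by rewrite -[X in _ --> X](subrr l); apply: cvgB => //; apply: cvg_cst.
have small e : 0 < e -> exists2 N, l - T N < e & forall M, (N <= M)%N -> l - T M < e.
  move=> e0; have /cvgrPdist_lt/(_ _ e0)[N _ h] := b0; exists N.
    by have := h N (leqnn N); rewrite /= sub0r normrN; apply: le_lt_trans; apply: ler_norm.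
  by move=> M /h; rewrite /= sub0r normrN; apply: le_lt_trans; apply: ler_norm.
have diffs N e y t : 0 < e -> l - T N < e -> ocube p r y -> ocube p r (y + t *: ej R j) ->
    `|(F (y + t *: ej R j) - F y) - (u N (y + t *: ej R j) - u N y)| <= `|t| * (2 * e).
  move=> e0 Ne py pyt.
  have [M1 _ M1P] := small _ e0.
  have c1 : (fun M => `|(u M (y + t *: ej R j) - u M y) - (u N (y + t *: ej R j) - u N y)|)
      @ \oo --> `|(F (y + t *: ej R j) - F y) - (u N (y + t *: ej R j) - u N y)|.
    apply: cvg_norm; apply: cvgB; last exact: cvg_cst.
    by apply: cvgB; apply: uF.
  rewrite -(cvg_lim _ c1) //; apply: limr_le; first by apply/cvg_ex; eexists; exact: c1.
  exists M1 => // M /= M1M.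
  have dd z : ocube p r z -> is_derive z (ej R j) (u M \- u N) (d M z - d N z).
    move=> pz; have h1 := ud M _ pz; have h2 := ud N _ pz.
    exact: is_deriveB.
  have [z pz zE] := mvt_axis dd py pyt.
  have -> : u M (y + t *: ej R j) - u M y - (u N (y + t *: ej R j) - u N y) =
    t * (d M z - d N z) by rewrite -zE /=; ring.
  rewrite normrM ler_wpM2l //.
  have -> : d M z - d N z = (D z - d N z) - (D z - d M z) by ring.
  have := dD N _ pz; have := dD M _ pz; have := M1P _ M1M.
  have := ler_normB (D z - d N z) (D z - d M z); lra.
apply/is_deriveP/cvgrPdist_lt => e e0.
(* One quarter for [D - d N], one for the difference quotient of [u N], and two for the increment of
   [F - u N]. *)
have e40 : 0 < e / 4 by rewrite divr_gt0.
have [N Ne _] := small _ e40.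
have /is_deriveP/cvgrPdist_lt/(_ _ e40) c1 := ud N _ px.
have [del del0 dx] : exists2 del, 0 < del & ocube x del `<=` ocube p r.
  by apply/nbhs_ocubeP/open_nbhs_nbhs; split=> //; apply: ocube_open.
have c2 : \forall h \near (0 : R)^', `|h| < del /\ h != 0.
  near=> h; split; last by near: h; exact: nbhs_dnbhs_neq.
  near: h; apply: dnbhs0_lt; exact: del0.
apply: (@filterS2 _ (0 : R)^') c1 c2 => h /= h1 [hd h0].
have pxh : ocube p r (x + h *: ej R j).
  apply: dx => i; rewrite shiftE addrC addKr normrM; case: (i == j); rewrite ?normr1 ?mulr1 //.
  by rewrite normr0 mulr0.
have := diffs N _ x h e40 Ne px pxh; have := dD N _ px.
rewrite [h *: _ + x]addrC in h1 *; rewrite /GRing.scale /= in h1 *.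
set a := F _ - F x; set b := u N _ - u N x in h1 *.
move=> h2 h3.
have h4 : `|h^-1 * (a - b)| <= 2 * (e / 4).
  by rewrite normrM normfV mulrC ler_pdivrMr ?normr_gt0 // mulrC.
have -> : D x - h^-1 * a = (D x - d N x) + (d N x - h^-1 * b) - h^-1 * (a - b) by ring.
have := ler_normB ((D x - d N x) + (d N x - h^-1 * b)) (h^-1 * (a - b)).
have := ler_normD (D x - d N x) (d N x - h^-1 * b); lra.
Unshelve. all: by end_near. Qed.

(** * Polynomials with weighted coefficient norms *)

Definition pterm (R : realType) (n : nat) : Type := (R * ('I_n -> nat))%type.

Definition pmono (R : realType) (n : nat) (p : 'rV[R]_n) (a : 'I_n -> nat)
    (y : 'rV[R]_n) : R := \prod_(i < n) (y ord0 i - p ord0 i) ^+ a i.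

Definition peval (R : realType) (n : nat) (p : 'rV[R]_n) (l : seq (pterm R n))
    (y : 'rV[R]_n) : R := \sum_(t <- l) t.1 * pmono p t.2 y.

Definition pdeg (n : nat) (a : 'I_n -> nat) : nat := \sum_(i < n) a i.

Definition pnorm (R : realType) (n : nat) (s : R) (l : seq (pterm R n)) : R :=
  \sum_(t <- l) `|t.1| * s ^+ pdeg t.2.

(* [u] is a polynomial in [y - p] whose coefficients satisfy [sum |c_a| s^|a| <= M];
   a representation as a list of terms need not collect equal monomials. *)
Definition poly_bound (R : realType) (n : nat) (p : 'rV[R]_n) (s M : R)
    (u : 'rV[R]_n -> R) : Prop :=
  exists2 l : seq (pterm R n), u = peval p l & pnorm s l <= M.

Lemma poly_boundW (R : realType) (n : nat) (p : 'rV[R]_n) (s s' M M' : R)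
    (u : 'rV[R]_n -> R) :
  0 <= s' -> s' <= s -> M <= M' -> poly_bound p s M u -> poly_bound p s' M' u.
Proof.
move=> s0 ss MM [l uE lM]; exists l => //; apply: le_trans MM; apply: le_trans lM.
apply: ler_sum => t _; rewrite ler_wpM2l // lerXn2r // nnegrE //; exact: le_trans ss.
Qed.

Lemma poly_boundD (R : realType) (n : nat) (p : 'rV[R]_n) (s M N : R)
    (u v : 'rV[R]_n -> R) :
  poly_bound p s M u -> poly_bound p s N v ->
  poly_bound p s (M + N) (fun y => u y + v y).
Proof.
move=> [l -> lM] [k -> kN]; exists (l ++ k).
  by apply/funext => y; rewrite /peval big_cat.
by rewrite /pnorm big_cat /=; apply: lerD.
Qed.

Lemma poly_bound0 (R : realType) (n : nat) (p : 'rV[R]_n) (s : R) :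
  poly_bound p s 0 (fun=> 0).
Proof. by exists [::]; [apply/funext => y; rewrite /peval big_nil|rewrite /pnorm big_nil]. Qed.

Lemma poly_boundZ (R : realType) (n : nat) (p : 'rV[R]_n) (s M c : R)
    (u : 'rV[R]_n -> R) :
  poly_bound p s M u -> poly_bound p s (`|c| * M) (fun y => c * u y).
Proof.
move=> [l -> lM]; exists [seq (c * t.1, t.2) | t <- l].
  apply/funext => y; rewrite /peval big_map mulr_sumr.
  by apply: eq_bigr => t _; rewrite mulrA.
rewrite /pnorm big_map /=; apply: (@le_trans _ _ (`|c| * pnorm s l)).
  by rewrite /pnorm mulr_sumr; apply: ler_sum => t _; rewrite normrM mulrA.
by rewrite ler_wpM2l.
Qed.

Lemma poly_bound_sum (R : realType) (n m : nat) (p : 'rV[R]_n) (s : R)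
    (M : R) (u : 'I_m -> 'rV[R]_n -> R) :
  (forall i, poly_bound p s M (u i)) ->
  poly_bound p s (m%:R * M) (fun y => \sum_(i < m) u i y).
Proof.
move=> uM; suff K (r : seq 'I_m) :
    poly_bound p s ((size r)%:R * M) (fun y => \sum_(i <- r) u i y).
  by have := K (index_enum 'I_m); rewrite /index_enum -enumT size_enum_ord.
elim: r => [|i r IH].
  rewrite mul0r; under eq_fun do rewrite big_nil; exact: poly_bound0.
under eq_fun do rewrite big_cons.
by rewrite -[size (i :: r)]add1n natrD mulrDl mul1r; apply: poly_boundD.
Qed.

Lemma pdegD1 (n : nat) (a : 'I_n -> nat) (j : 'I_n) :
  pdeg (fun i => (a i + (i == j))%N) = (pdeg a).+1.
Proof.
rewrite /pdeg big_split /= -addn1; congr (_ + _)%N.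
by rewrite (bigD1 j) //= eqxx big1 // => i /negbTE ->.
Qed.

Lemma pmonoD1 (R : realType) (n : nat) (p : 'rV[R]_n) (a : 'I_n -> nat) (j : 'I_n)
    (y : 'rV[R]_n) :
  pmono p (fun i => (a i + (i == j))%N) y = (y ord0 j - p ord0 j) * pmono p a y.
Proof.
rewrite /pmono; under eq_bigr do rewrite exprD.
rewrite big_split /= mulrC; congr (_ * _).
by rewrite (bigD1 j) //= eqxx expr1 big1 ?mulr1 // => i /negbTE ->; rewrite expr0.
Qed.

(** Write [y_j = p_j + (y_j - p_j)]: as [|p_j| <= 1] and [s <= 1], each summand costs at most a
    factor [1]. *)
Lemma poly_bound_mulX (R : realType) (n : nat) (p : 'rV[R]_n) (s M : R) (j : 'I_n)
    (u : 'rV[R]_n -> R) :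
  0 <= s -> s <= 1 -> `|p ord0 j| <= 1 -> poly_bound p s M u ->
  poly_bound p s (2 * M) (fun y : 'rV[R]_n => y ord0 j * u y).
Proof.
move=> s0 s1 p1 uM.
have M0 : 0 <= M.
  case: uM => l _; apply: le_trans; apply: sumr_ge0 => t _.
  by rewrite mulr_ge0 // exprn_ge0.
have -> : (fun y : 'rV[R]_n => y ord0 j * u y) =
    (fun y : 'rV[R]_n => p ord0 j * u y + (y ord0 j - p ord0 j) * u y).
  by apply/funext => y; rewrite -mulrDl addrC subrK.
have -> : 2 * M = M + M by ring.
apply: poly_boundD.
  by apply: poly_boundW (poly_boundZ _ uM) => //; rewrite ler_piMl.
case: uM => l -> lM.
exists [seq (t.1, fun i => (t.2 i + (i == j))%N) | t <- l].
  apply/funext => y; rewrite /peval big_map mulr_sumr.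
  by apply: eq_bigr => t _; rewrite /= pmonoD1 mulrCA.
apply: le_trans lM; rewrite /pnorm big_map; apply: ler_sum => t _ /=.
by rewrite pdegD1 ler_wpM2l // exprS ler_piMl // exprn_ge0.
Qed.

Lemma differentiable_pmono (R : realType) (n : nat) (p : 'rV[R]_n) (a : 'I_n -> nat)
    (y : 'rV[R]_n) : differentiable (pmono p a) y.
Proof.
rewrite /pmono; elim: (index_enum 'I_n) => [|i r IH].
  under eq_fun do rewrite big_nil; exact: differentiable_cst.
under eq_fun do rewrite big_cons.
apply: differentiableM => //.
have d1 : differentiable (fun z : 'rV[R]_n => z ord0 i - p ord0 i) y.
  by apply: differentiableB; [exact: differentiable_coord|exact: differentiable_cst].
elim: (a i) => [|k IHk]; first by under eq_fun do rewrite expr0; exact: differentiable_cst.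
by under eq_fun do rewrite exprS; apply: differentiableM.
Qed.

Lemma differentiable_peval (R : realType) (n : nat) (p : 'rV[R]_n) (l : seq (pterm R n))
    (y : 'rV[R]_n) : differentiable (peval p l) y.
Proof.
elim: l => [|t l IH].
  rewrite /peval; under eq_fun do rewrite big_nil; exact: differentiable_cst.
rewrite /peval; under eq_fun do rewrite big_cons; apply: differentiableD => //.
apply: differentiableM; [exact: differentiable_cst|exact: differentiable_pmono].
Qed.

Lemma is_derive_pmono (R : realType) (n : nat) (p : 'rV[R]_n) (a : 'I_n -> nat)
    (j : 'I_n) (y : 'rV[R]_n) :
  is_derive y (ej R j) (pmono p a)
    ((a j)%:R * pmono p (fun i => (a i - (i == j))%N) y).
Proof.
have h : is_derive (y + (0 : R) *: ej R j) (ej R j) (pmono p a)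
    ((a j)%:R * pmono p (fun i => (a i - (i == j))%N) y).
  apply/is_derive_line.
  pose K := \prod_(i < n | i != j) (y ord0 i - p ord0 i) ^+ a i.
  have -> : (fun t : R => pmono p a (y + t *: ej R j)) =
      (fun t : R => (t + (y ord0 j - p ord0 j)) ^+ a j * K).
    apply/funext => t; rewrite /pmono (bigD1 j) //= shiftE eqxx mulr1; congr (_ * _).
      by congr (_ ^+ _); ring.
    by apply: eq_bigr => i ij; rewrite shiftE (negbTE ij) mulr0 addr0.
  rewrite /pmono (bigD1 j) //= eqxx subn1.
  rewrite [in X in is_derive _ _ _ X](eq_bigr (fun i => (y ord0 i - p ord0 i) ^+ a i)); last first.
    by move=> i /negbTE ->; rewrite subn0.
  rewrite -/K.
  have d1 : is_derive (0 : R) 1 (fun t : R => t + (y ord0 j - p ord0 j)) 1.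
    by apply: is_derive_eq; rewrite addr0.
  have d3 := is_deriveM (is_deriveX (a j) d1) (is_derive_cst K (0 : R) 1).
  have -> : (fun t : R => (t + (y ord0 j - p ord0 j)) ^+ a j * K) =
      (fun t : R => t + (y ord0 j - p ord0 j)) ^+ a j * cst K.
    by rewrite exprfctE.
  apply: (is_derive_eq d3); rewrite /GRing.scale /= add0r /cst; ring.
by move: h; rewrite scale0r addr0.
Qed.

Lemma poly_bound_differentiable (R : realType) (n : nat) (p : 'rV[R]_n) (s M : R)
    (u : 'rV[R]_n -> R) (y : 'rV[R]_n) : poly_bound p s M u -> differentiable u y.
Proof. by move=> [l -> _]; apply: differentiable_peval. Qed.

(** By convexity the graph of [t^k] lies above its tangent at [s']; this is Cauchy's estimate for a
    single monomial. *)
Lemma mulrn_expr_le (R : realType) (s s' : R) (k : nat) :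
  0 <= s' -> s' <= s -> k%:R * s' ^+ k.-1 * (s - s') + s' ^+ k <= s ^+ k.
Proof.
move=> s0 ss; elim: k => [|k IH]; first by rewrite !mul0r add0r.
rewrite /=; case: k IH => [|k] IH; first by rewrite !expr0 !expr1 !mul1r; lra.
have sk : s' ^+ k.+1 <= s ^+ k.+1 by rewrite lerXn2r // nnegrE //; apply: le_trans ss.
have h1 : s' * (k.+1%:R * s' ^+ k * (s - s') + s' ^+ k.+1) <= s' * s ^+ k.+1.
  by rewrite ler_wpM2l.
have h2 : (s - s') * s' ^+ k.+1 <= (s - s') * s ^+ k.+1 by rewrite ler_wpM2l // subr_ge0.
have E1 : s ^+ k.+2 = s' * s ^+ k.+1 + (s - s') * s ^+ k.+1 by rewrite exprS; ring.
have E2 : k.+2%:R * s' ^+ k.+1 * (s - s') + s' ^+ k.+2 =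
  s' * (k.+1%:R * s' ^+ k * (s - s') + s' ^+ k.+1) + (s - s') * s' ^+ k.+1.
  by rewrite -[k.+2%:R]natr1 !exprS; ring.
by rewrite E1 E2; apply: lerD.
Qed.

(** Cauchy's estimate, term by term on coefficients: an exponent is at most the total degree, to
    which the tangent inequality applies. *)
Lemma poly_bound_derive (R : realType) (n : nat) (p : 'rV[R]_n) (s s' M : R) (j : 'I_n)
    (u : 'rV[R]_n -> R) :
  0 <= s' -> s' < s -> poly_bound p s M u ->
  poly_bound p s' (M / (s - s')) (fun y => 'D_(ej R j) u y).
Proof.
move=> s0 ss [l -> lM].
have ss0 : 0 < s - s' by rewrite subr_gt0.
exists [seq (t.1 * (t.2 j)%:R, fun i => (t.2 i - (i == j))%N) | t <- l].
  apply/funext => y.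
  have : is_derive y (ej R j) (peval p l)
     (peval p [seq (t.1 * (t.2 j)%:R, fun i => (t.2 i - (i == j))%N) | t <- l] y).
    elim: {lM} l => [|t l IH]; rewrite /peval.
      under eq_fun do rewrite big_nil; rewrite big_nil; exact: is_derive_cst.
    rewrite map_cons big_cons /=; under eq_fun do rewrite big_cons.
    have d1 := is_deriveZ t.1 (is_derive_pmono p t.2 j y).
    by apply: (is_derive_eq (is_deriveD d1 IH)); rewrite /GRing.scale /= mulrA.
  by case.
rewrite ler_pdivlMr //; apply: le_trans lM; rewrite /pnorm big_map mulr_suml.
apply: ler_sum => t _ /=; rewrite normrM -!mulrA ler_wpM2l // normr_nat.
have [->|tj] := posnP (t.2 j).
  by rewrite mul0r exprn_ge0 //; apply: le_trans (ltW ss).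
have degE : pdeg t.2 = (pdeg (fun i => (t.2 i - (i == j))%N)).+1.
  rewrite -(pdegD1 _ j); apply: eq_bigr => i _.
  by have [->|_] := eqVneq i j; rewrite ?subn0 ?addn0 // subn1 addn1 prednK.
rewrite degE; set k := pdeg _.
have tk : (t.2 j <= k.+1)%N by rewrite -degE /pdeg (bigD1 j) //= leq_addr.
have := @mulrn_expr_le _ s s' k.+1 s0 (ltW ss); rewrite /= -mulrA => h.
apply: le_trans h; rewrite -[leLHS]addr0; apply: lerD; last exact: exprn_ge0.
by rewrite ler_wpM2r ?ler_nat // mulr_ge0 ?exprn_ge0 // ltW.
Qed.

Lemma poly_bound_le (R : realType) (n : nat) (p : 'rV[R]_n) (s M : R)
    (u : 'rV[R]_n -> R) (y : 'rV[R]_n) :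
  poly_bound p s M u -> ccube p s y -> `|u y| <= M.
Proof.
move=> [l -> lM] py; apply: le_trans lM; apply: le_trans (ler_norm_sum _ _ _) _.
apply: ler_sum => t _; rewrite normrM ler_wpM2l // /pmono normr_prod /pdeg.
rewrite -prodrXr; apply: ler_prod => i _; rewrite normr_ge0 normrX /=.
by rewrite lerXn2r // nnegrE //; apply: le_trans (py i).
Qed.

(** * The Cauchy-Kovalevskaya series *)

Definition dirac (R : realType) (n : nat) (u : 'rV[R]_n -> {set 'I_n} -> R)
    (y : 'rV[R]_n) (A : {set 'I_n}) : R :=
  \sum_(j < n) lmul j (fun B => 'D_(ej R j) (u^~ B) y) A.

Definition xmul (R : realType) (n : nat) (y : 'rV[R]_n) (v : {set 'I_n} -> R)
    (A : {set 'I_n}) : R :=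
  \sum_(i < n) y ord0 i * lmul i v A.

Definition xdirac (R : realType) (n : nat) (u : 'rV[R]_n -> {set 'I_n} -> R)
    (y : 'rV[R]_n) : {set 'I_n} -> R := xmul y (dirac u y).

Definition polyv (R : realType) (n : nat) (p : 'rV[R]_n) (s M : R)
    (u : 'rV[R]_n -> {set 'I_n} -> R) : Prop :=
  forall A, poly_bound p s M (u^~ A).

Lemma xmul_xmul (R : realType) (n : nat) (y : 'rV[R]_n) (v : {set 'I_n} -> R)
    (A : {set 'I_n}) : xmul y (xmul y v) A = - (sqn y * v A).
Proof.
have := @lmul_square R n (fun i j B => y ord0 i * y ord0 j * v B) A
  (fun i j B => congr1 (fun z => z * _) (mulrC _ _)).
rewrite -mulr_suml; set L := (X in X = _ -> _); move=> h.
have -> : sqn y = \sum_i y ord0 i * y ord0 i by apply: eq_bigr => i _; rewrite expr2.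
rewrite -h /L; apply: eq_bigr => i _; rewrite /lmul /xmul mulrCA; congr (_ * _).
by rewrite mulr_sumr; apply: eq_bigr => j _; rewrite /lmul; ring.
Qed.

Lemma polyv_lmul_derive (R : realType) (n : nat) (p : 'rV[R]_n) (s s' M : R)
    (u : 'rV[R]_n -> {set 'I_n} -> R) (j : 'I_n) (A : {set 'I_n}) :
  0 <= s' -> s' < s -> polyv p s M u ->
  poly_bound p s' (M / (s - s')) (fun y => lmul j (fun B => 'D_(ej R j) (u^~ B) y) A).
Proof.
move=> s0 ss uM; rewrite -[_ / _]mul1r -(normr_lsign R j A).
apply: poly_boundZ; exact: poly_bound_derive.
Qed.

Lemma polyv_dirac (R : realType) (n : nat) (p : 'rV[R]_n) (s s' M : R)
    (u : 'rV[R]_n -> {set 'I_n} -> R) :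
  0 <= s' -> s' < s -> polyv p s M u -> polyv p s' (n%:R * (M / (s - s'))) (dirac u).
Proof. by move=> s0 ss uM A; apply: poly_bound_sum => j; apply: polyv_lmul_derive. Qed.

Lemma polyv_xdirac (R : realType) (n : nat) (p : 'rV[R]_n) (s s' M : R)
    (u : 'rV[R]_n -> {set 'I_n} -> R) :
  sqn p = 1 -> 0 <= s' -> s' < s -> s <= 1 -> polyv p s M u ->
  polyv p s' (M * (2 * n%:R ^+ 2 / (s - s'))) (xdirac u).
Proof.
move=> p1 s0 ss s1 uM A.
have -> : M * (2 * n%:R ^+ 2 / (s - s')) = n%:R * (2 * (n%:R * (M / (s - s')))) by ring.
apply: poly_bound_sum => i; apply: poly_bound_mulX => //.
- by apply: le_trans (ltW ss) _.
- exact: sphere_coord_le1.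
have := poly_boundZ (lsign R i A) (polyv_dirac s0 ss uM (twist i A)).
by rewrite normr_lsign mul1r.
Qed.

Lemma polyv_iter (R : realType) (n : nat) (p : 'rV[R]_n) (s M d : R)
    (u : 'rV[R]_n -> {set 'I_n} -> R) (k : nat) :
  sqn p = 1 -> s <= 1 -> 0 < d -> k%:R * d <= s -> polyv p s M u ->
  polyv p (s - k%:R * d) (M * (2 * n%:R ^+ 2 / d) ^+ k) (iter k (@xdirac R n) u).
Proof.
move=> p1 s1 d0 kd uM; elim: k kd => [_|k IH kd].
  by rewrite mul0r subr0 expr0 mulr1.
have kE : k.+1%:R * d = k%:R * d + d by rewrite -natr1 mulrDl mul1r.
have k0 : 0 <= k%:R * d by rewrite mulr_ge0 // ltW.
rewrite kE in kd *; have {}IH := IH (le_trans _ kd).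
have XE X : M * X ^+ k.+1 = M * X ^+ k * X by rewrite exprSr mulrA.
rewrite iterS XE.
have dE : d = s - k%:R * d - (s - (k%:R * d + d)) by ring.
by rewrite [X in _ * (_ / X)]dE; apply: polyv_xdirac => //; try lra; apply: IH; lra.
Qed.

(* The factor [expR 1] accounts for [k ^ k <= e ^ k * k!]. *)
Definition ck_rate (R : realType) (n : nat) (s : R) : R := 4 * n%:R ^+ 2 / s * expR 1.

Lemma ck_rate_ge0 (R : realType) (n : nat) (s : R) : 0 < s -> 0 <= ck_rate n s.
Proof. by move=> s0; rewrite /ck_rate !mulr_ge0 ?invr_ge0 ?exprn_ge0 ?expR_ge0 // ltW. Qed.

(** [k^k / k!] is a single term of the exponential series of [e^k]. *)
Lemma expn_le_fact (R : realType) (k : nat) : k%:R ^+ k <= k`!%:R * expR 1 ^+ k :> R.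
Proof.
case: k => [|k]; first by rewrite !expr0 mul1r.
have := @expR_ge1Dxn R k.+1%:R k (ler0n _ _) => h.
have f0 : (0 : R) < (k.+1)`!%:R by rewrite ltr0n fact_gt0.
rewrite -expRM_natl mulr1 -ler_pdivrMl // mulrC; lra.
Qed.

Lemma polyv_iter_fact (R : realType) (n : nat) (p : 'rV[R]_n) (s M : R)
    (u : 'rV[R]_n -> {set 'I_n} -> R) (k : nat) :
  sqn p = 1 -> 0 < s -> s <= 1 -> 0 <= M -> polyv p s M u ->
  polyv p (s / 2) (M * (k`!%:R * ck_rate n s ^+ k)) (iter k (@xdirac R n) u).
Proof.
move=> p1 s0 s1 M0 uM A; case: k => [|k].
  by rewrite fact0 expr0 !mulr1; apply: poly_boundW (uM A) => //; lra.
set m := k.+1; have m0 : (0 : R) < m%:R by rewrite ltr0n.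
(* Each of the [m] steps loses [s / (2 m)], half of the radius in total; the resulting factor [m^m]
   is then traded for [m!]. *)
have d0 : 0 < s / 2 / m%:R by rewrite !divr_gt0.
have dE : m%:R * (s / 2 / m%:R) = s / 2 by field; rewrite gt_eqF.
have ds : m%:R * (s / 2 / m%:R) <= s by rewrite dE; lra.
have := @polyv_iter R n p s M _ u m p1 s1 d0 ds uM A; rewrite dE.
apply: poly_boundW; [lra|lra|].
rewrite ler_wpM2l //.
have -> : 2 * n%:R ^+ 2 / (s / 2 / m%:R) = (4 * n%:R ^+ 2 / s) * m%:R :> R.
  by field; rewrite !gt_eqF.
have -> : ck_rate n s ^+ m = (4 * n%:R ^+ 2 / s) ^+ m * expR 1 ^+ m by rewrite -exprMn.
have C0 : 0 <= 4 * n%:R ^+ 2 / s :> R.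
  by rewrite !mulr_ge0 ?invr_ge0 ?exprn_ge0 // ltW.
move: (4 * n%:R ^+ 2 / s) C0 => C C0.
by rewrite exprMn [leRHS]mulrCA ler_wpM2l ?expn_le_fact // exprn_ge0.
Qed.

Lemma differentiable_iter (R : realType) (n : nat) (p : 'rV[R]_n) (s M : R)
    (u : 'rV[R]_n -> {set 'I_n} -> R) (k : nat) (A : {set 'I_n}) (y : 'rV[R]_n) :
  sqn p = 1 -> 0 < s -> s <= 1 -> 0 <= M -> polyv p s M u ->
  differentiable ((iter k (@xdirac R n) u)^~ A) y.
Proof.
move=> p1 s0 s1 M0 uM.
exact: poly_bound_differentiable (@polyv_iter_fact _ _ _ _ _ _ k p1 s0 s1 M0 uM A).
Qed.

(** Directional derivatives are additive on derivable functions; the polynomial bounds supply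
    derivability of all iterates. *)
Lemma iter_xdiracB (R : realType) (n : nat) (p : 'rV[R]_n) (s M N : R)
    (u v : 'rV[R]_n -> {set 'I_n} -> R) (k : nat) :
  sqn p = 1 -> 0 < s -> s <= 1 -> 0 <= M -> 0 <= N -> polyv p s M u -> polyv p s N v ->
  iter k (@xdirac R n) (fun y A => u y A - v y A) =
  (fun y A => iter k (@xdirac R n) u y A - iter k (@xdirac R n) v y A).
Proof.
move=> p1 s0 s1 M0 N0 uM vN; elim: k => // k IH; rewrite !iterS IH.
apply/funext => y; apply/funext => A; rewrite /xdirac /xmul -sumrB.
apply: eq_bigr => i _; rewrite -mulrBr; congr (_ * _); rewrite /lmul -mulrBr.
congr (_ * _); rewrite /dirac -sumrB; apply: eq_bigr => j _; rewrite /lmul -mulrBr.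
congr (_ * _); rewrite deriveB //; apply: diff_derivable.
  exact: differentiable_iter uM.
exact: differentiable_iter vN.
Qed.

(** * The series in powers of the logarithm of the radius *)

(** This is [ln |y|], written through the square to avoid the square root. *)
Definition logr (R : realType) (n : nat) (y : 'rV[R]_n) : R := ln (sqn y) / 2.

Lemma is_derive_logr (R : realType) (n : nat) (y : 'rV[R]_n) (j : 'I_n) :
  0 < sqn y -> is_derive y (ej R j) (@logr R n) (y ord0 j / sqn y).
Proof.
move=> y0.
have h : is_derive (y + (0 : R) *: ej R j) (ej R j) (@logr R n) (y ord0 j / sqn y).
  apply/is_derive_line.
  have sE (t : R) : sqn (y + t *: ej R j) = sqn y + t * (2 * y ord0 j + t).
    rewrite /sqn (bigD1 j) //= [in RHS](bigD1 j) //= shiftE eqxx.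
    rewrite (eq_bigr (fun i => y ord0 i ^+ 2)); last first.
      by move=> i ij; rewrite shiftE (negbTE ij) mulr0 addr0.
    by rewrite mulr1; ring.
  have d1 : is_derive (0 : R) 1 (fun t : R => sqn (y + t *: ej R j)) (2 * y ord0 j).
    under eq_fun do rewrite sE.
    by apply: is_derive_eq; rewrite /GRing.scale /=; ring.
  have y0' : 0 < sqn (y + (0 : R) *: ej R j) by rewrite scale0r addr0.
  have d2 := is_derive1_comp (is_derive1_ln y0') d1.
  have d3 := is_deriveM d2 (is_derive_cst (2^-1 : R) (0 : R) 1).
  apply: (is_derive_eq d3); rewrite /= scale0r addr0 /GRing.scale /= /cst /=.
  by field; rewrite gt_eqF.
by move: h; rewrite scale0r addr0.
Qed.

Definition ck_term (R : realType) (n : nat) (k : nat) (u : 'rV[R]_n -> {set 'I_n} -> R)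
    (y : 'rV[R]_n) (A : {set 'I_n}) : R :=
  logr y ^+ k / k`!%:R * iter k (@xdirac R n) u y A.

(** The product rule applied to [ck_term]; at [k = 0] the factor [k%:R] removes the term with the
    truncated exponent. *)
Definition ck_dterm (R : realType) (n : nat) (j : 'I_n) (k : nat)
    (u : 'rV[R]_n -> {set 'I_n} -> R) (y : 'rV[R]_n) (A : {set 'I_n}) : R :=
  k%:R * logr y ^+ k.-1 / k`!%:R * (y ord0 j / sqn y) * iter k (@xdirac R n) u y A +
  logr y ^+ k / k`!%:R * 'D_(ej R j) ((iter k (@xdirac R n) u)^~ A) y.

Lemma is_derive_ck_term (R : realType) (n : nat) (p : 'rV[R]_n) (s M : R) (k : nat)
    (u : 'rV[R]_n -> {set 'I_n} -> R) (y : 'rV[R]_n) (A : {set 'I_n}) (j : 'I_n) :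
  sqn p = 1 -> 0 < s -> s <= 1 -> 0 <= M -> polyv p s M u -> 0 < sqn y ->
  is_derive y (ej R j) (fun z => ck_term k u z A) (ck_dterm j k u y A).
Proof.
move=> p1 s0 s1 M0 uM y0.
have d1 := is_deriveX k (is_derive_logr j y0).
have d2 : is_derive y (ej R j) ((iter k (@xdirac R n) u)^~ A)
    ('D_(ej R j) ((iter k (@xdirac R n) u)^~ A) y).
  by apply: derivableP; apply: diff_derivable; apply: differentiable_iter uM.
have d3 := is_deriveM (is_deriveM d1 (is_derive_cst (k`!%:R^-1 : R) y (ej R j))) d2.
have -> : (fun z => ck_term k u z A) =
    ((@logr R n) ^+ k * cst (k`!%:R^-1)) * (iter k (@xdirac R n) u)^~ A.
  by apply/funext => z; rewrite exprfctE.
apply: (is_derive_eq d3); rewrite /ck_dterm /GRing.scale /= exprfctE /cst /=.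
by rewrite !mulrfctE; ring.
Qed.

(** The iterates are bounded at radius [s / 2], and one further derivative uses [s / 4] more. The
    ratio [1 / 4] leaves room for the factor [k] from differentiating [(ln |y|)^k], and the lower
    bound on [sqn] controls the gradient of the logarithm. *)
Definition ck_region (R : realType) (n : nat) (p : 'rV[R]_n) (s : R) (y : 'rV[R]_n) : Prop :=
  [/\ ccube p (s / 4) y, `|logr y| * ck_rate n s <= 4^-1 & 2^-1 <= sqn y].

Lemma ck_region_near (R : realType) (n : nat) (p : 'rV[R]_n) (s : R) :
  sqn p = 1 -> 0 < s ->
  exists2 r, 0 < r & forall y, ocube p r y -> ck_region p s y.
Proof.
move=> p1 s0.
have B0 := ck_rate_ge0 n s0.
have sc : (fun y => @sqn R n y) @ p --> (1 : R) by rewrite -p1; apply: continuous_sqn.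
have lc : {for p, continuous (@logr R n)}.
  have p0 : 0 < sqn p by rewrite p1.
  have c1 : {for sqn p, continuous (@ln R)} by apply: continuous_ln.
  have c2 : {for p, continuous (@ln R \o @sqn R n)}.
    by apply: continuous_comp => //; apply: continuous_sqn.
  apply/continuous_dist => e e0; have e20 : 0 < e * 2 by rewrite mulr_gt0.
  have /continuous_dist/(_ _ e20) := c2; apply: (@filterS _ (nbhs p)) => y /=.
  by rewrite /logr -mulrBl normrM (@ger0_norm _ 2^-1) ?invr_ge0 // ltr_pdivrMr.
have l0 : logr p = 0 by rewrite /logr p1 ln1 mul0r.
have e0 : 0 < (4 * (ck_rate n s + 1))^-1 by rewrite invr_gt0 mulr_gt0 // ltr_wpDl.
have /continuous_dist/(_ _ e0)/nbhs_ocubeP[r1 r10 h1] := lc.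
have : \forall y \near p, 2^-1 < sqn y by apply: (cvgr_gt _ sc); lra.
move=> /nbhs_ocubeP[r2 r20 h2].
exists (Num.min (s / 4) (Num.min r1 r2)); first by rewrite !lt_min r10 r20 divr_gt0.
move=> y py; split.
- by move=> i; apply/ltW; apply: lt_le_trans (py i) _; rewrite ge_min lexx.
- have := h1 y; rewrite /= l0 sub0r normrN => /(_ _)/ltW h.
  apply: (@le_trans _ _ ((4 * (ck_rate n s + 1))^-1 * ck_rate n s)).
    by apply: ler_wpM2r => //; apply: h => i; apply: lt_le_trans (py i) _; rewrite !ge_min lexx orbT.
  rewrite mulrC ler_pdivrMr; last by rewrite mulr_gt0 // ltr_wpDl.
  by rewrite mulrA mulVf // mul1r; lra.
- by apply/ltW/h2 => i; apply: lt_le_trans (py i) _; rewrite !ge_min lexx !orbT.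
Qed.

(** The summands account for the term itself, for the derivative of the logarithm and for the
    derivative of the iterate. The [16] is [4] from [|y_j| / |y|^2 <= 4] times [4] from
    [quarter_pow]. *)
Definition ck_const (R : realType) (n : nat) (s : R) : R := 1 + 16 * ck_rate n s + 4 / s.

Lemma quarter_pow (R : realType) (k : nat) : k.+1%:R * 4^-1 ^+ k <= 4 * 2^-1 ^+ k.+1 :> R.
Proof.
have -> : 4^-1 ^+ k = 2^-1 ^+ k * 2^-1 ^+ k :> R.
  by rewrite -exprMn; congr (_ ^+ _); field.
rewrite mulrA exprS mulrA; apply: ler_wpM2r; first by rewrite exprn_ge0.
rewrite exprVn ler_pdivrMr ?exprn_gt0 // -natrX.
have -> : 4 / 2 = 2%:R :> R by field.
by rewrite -natrM ler_nat -expnS ltnW // ltn_expl.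
Qed.

(** The factorial in the bound of the iterates cancels that of the series and leaves
    [(|ln |y|| * ck_rate)^k <= 4^-k]. The middle estimate is for the remainder left when the Dirac
    operator of a partial sum telescopes. *)
Lemma ck_term_bound (R : realType) (n : nat) (p : 'rV[R]_n) (s M : R) (k : nat)
    (u : 'rV[R]_n -> {set 'I_n} -> R) (y : 'rV[R]_n) (A : {set 'I_n}) :
  sqn p = 1 -> 0 < s -> s <= 1 -> 0 <= M -> polyv p s M u -> ck_region p s y ->
  [/\ `|ck_term k u y A| <= M * ck_const n s * 2^-1 ^+ k,
      forall j, `|logr y ^+ k / k`!%:R * 'D_(ej R j) ((iter k (@xdirac R n) u)^~ A) y|
        <= M * ck_const n s * 2^-1 ^+ k &
      forall j, `|ck_dterm j k u y A| <= M * ck_const n s * 2^-1 ^+ k].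
Proof.
move=> p1 s0 s1 M0 uM [py yB y2].
have B0 := ck_rate_ge0 n s0; set B := ck_rate n s in B0 yB *.
have f0 : (0 : R) < k`!%:R by rewrite ltr0n fact_gt0.
have uk := @polyv_iter_fact R n p s M u k p1 s0 s1 M0 uM.
have py2 : ccube p (s / 2) y by apply: ccubeW py; lra.
have b1 : `|iter k (@xdirac R n) u y A| <= M * (k`!%:R * B ^+ k).
  exact: poly_bound_le (uk A) py2.
have b2 j : `|'D_(ej R j) ((iter k (@xdirac R n) u)^~ A) y| <= M * (k`!%:R * B ^+ k) * (4 / s).
  have -> : 4 / s = (s / 2 - s / 4)^-1.
    by rewrite (_ : s / 2 - s / 4 = s / 4) ?invf_div //; field.
  apply: (@poly_bound_le _ _ p (s / 4) _ (fun y => 'D_(ej R j) ((iter k (@xdirac R n) u)^~ A) y)) => //.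
  have h1 : 0 <= s / 4 by lra.
  have h2 : s / 4 < s / 2 by lra.
  exact: (poly_bound_derive j h1 h2 (uk A)).
pose q := `|logr y| * B.
have q0 : 0 <= q by rewrite mulr_ge0.
have q4 m : q ^+ m <= 4^-1 ^+ m by rewrite lerXn2r // nnegrE.
have h42 : 4^-1 ^+ k <= 2^-1 ^+ k :> R by rewrite lerXn2r // ?nnegrE //; lra.
have p20 : 0 <= 2^-1 ^+ k :> R by rewrite exprn_ge0.
have s40 : 0 <= 4 / s by rewrite divr_ge0 // ltW.
have qE : `|logr y| ^+ k / k`!%:R * (M * (k`!%:R * B ^+ k)) = M * q ^+ k.
  rewrite /q [(_ * B) ^+ k]exprMn; move: (k`!%:R) (`|logr y| ^+ k) (B ^+ k) f0 => fk lk Bk fk0.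
  by field; rewrite gt_eqF.
have nl : `|logr y ^+ k / k`!%:R| = `|logr y| ^+ k / k`!%:R.
  by rewrite normrM normrX [X in _ * X]ger0_norm // invr_ge0 ltW.
have nl0 : 0 <= `|logr y| ^+ k / k`!%:R by rewrite divr_ge0 ?exprn_ge0 // ltW.
have Mq : M * q ^+ k <= M * 2^-1 ^+ k by rewrite ler_wpM2l // (le_trans (q4 k)).
have M2 : 0 <= M * 2^-1 ^+ k by rewrite mulr_ge0.
have KE : M * ck_const n s * 2^-1 ^+ k =
   M * 2^-1 ^+ k + 16 * B * (M * 2^-1 ^+ k) + M * 2^-1 ^+ k * (4 / s).
  by rewrite /ck_const -/B; ring.
have B16 : 0 <= 16 * B by apply: mulr_ge0.
have t1 : 0 <= 16 * B * (M * 2^-1 ^+ k) by apply: mulr_ge0.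
have t2 : 0 <= M * 2^-1 ^+ k * (4 / s) by rewrite mulr_ge0.
have c2 j : `|logr y ^+ k / k`!%:R * 'D_(ej R j) ((iter k (@xdirac R n) u)^~ A) y|
    <= M * 2^-1 ^+ k * (4 / s).
  rewrite normrM nl; apply: le_trans (ler_wpM2l nl0 (b2 j)) _.
  by rewrite [leLHS]mulrA qE; apply: ler_wpM2r.
split.
- rewrite KE /ck_term normrM nl; apply: le_trans (ler_wpM2l nl0 b1) _; rewrite qE.
  by apply: le_trans Mq _; lra.
- by move=> j; apply: le_trans (c2 j) _; rewrite KE; lra.
move=> j; rewrite /ck_dterm; apply: le_trans (ler_normD _ _) _; have := c2 j.
suff : `|k%:R * logr y ^+ k.-1 / k`!%:R * (y ord0 j / sqn y) * iter k (@xdirac R n) u y A|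
    <= 16 * B * (M * 2^-1 ^+ k) by rewrite KE; lra.
have yq : `|y ord0 j / sqn y| <= 4.
  rewrite normrM normfV [X in _ / X]ger0_norm; last by lra.
  rewrite ler_pdivrMr; last by lra.
  have := py j; have := sphere_coord_le1 j p1; have := ler_normD (p ord0 j) (y ord0 j - p ord0 j).
  by rewrite addrC subrK; lra.
case: k uk f0 b1 {b2 h42 p20 qE nl nl0 Mq M2 KE t1 t2 c2} => [|k] uk f0 b1.
  by rewrite !mul0r normr0; apply: mulr_ge0 => //; apply: mulr_ge0 => //; rewrite exprn_ge0.
rewrite normrM; apply: (@le_trans _ _
  (k.+1%:R * `|logr y| ^+ k / (k.+1)`!%:R * 4 * (M * ((k.+1)`!%:R * B ^+ k.+1)))).
  apply: ler_pM => //; rewrite normrM; apply: ler_pM => //.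
  by rewrite 2!normrM normrX normr_nat normfV normr_nat.
have -> : k.+1%:R * `|logr y| ^+ k / (k.+1)`!%:R * 4 * (M * ((k.+1)`!%:R * B ^+ k.+1)) =
   4 * B * M * (k.+1%:R * q ^+ k).
  rewrite /q [(_ * B) ^+ k]exprMn [B ^+ k.+1]exprS; move: ((k.+1)`!%:R) (`|logr y| ^+ k) (B ^+ k) f0 => fk lk Bk fk0.
  by field; rewrite gt_eqF.
have -> : 16 * B * (M * 2^-1 ^+ k.+1) = 4 * B * M * (4 * 2^-1 ^+ k.+1) by ring.
apply: ler_wpM2l; first by apply: mulr_ge0 => //; apply: mulr_ge0.
by apply: le_trans (quarter_pow _ k); apply: ler_wpM2l.
Qed.

(** Differentiating the logarithm in the term of order [m + 1] multiplies [x D (x D)^m u] by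
    [x / |x|^2], which gives [- D (x D)^m u] and cancels the remainder of order [m]. *)
Lemma dirac_ck_sum (R : realType) (n : nat) (m : nat)
    (u : 'rV[R]_n -> {set 'I_n} -> R) (y : 'rV[R]_n) (A : {set 'I_n}) :
  0 < sqn y ->
  \sum_(j < n) lmul j (fun B => \sum_(k < m.+1) ck_dterm j k u y B) A =
  logr y ^+ m / m`!%:R * dirac (iter m (@xdirac R n) u) y A.
Proof.
move=> y0; elim: m => [|m IH].
  rewrite fact0 expr0 divr1 mul1r /dirac; apply: eq_bigr => j _.
  by rewrite /lmul big_ord1 /ck_dterm fact0 !mul0r add0r expr0 divr1 mul1r.
have -> : \sum_(j < n) lmul j (fun B => \sum_(k < m.+2) ck_dterm j k u y B) A =
  \sum_(j < n) lmul j (fun B => \sum_(k < m.+1) ck_dterm j k u y B) A +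
  \sum_(j < n) lmul j (fun B => ck_dterm j m.+1 u y B) A.
  by rewrite -big_split; apply: eq_bigr => j _; rewrite /lmul big_ord_recr mulrDr.
rewrite IH.
have -> : \sum_(j < n) lmul j (fun B => ck_dterm j m.+1 u y B) A =
  m.+1%:R * logr y ^+ m / (m.+1)`!%:R / sqn y * xmul y (iter m.+1 (@xdirac R n) u y) A +
  logr y ^+ m.+1 / (m.+1)`!%:R * dirac (iter m.+1 (@xdirac R n) u) y A.
  rewrite /xmul /dirac !mulr_sumr -big_split; apply: eq_bigr => j _.
  by rewrite /lmul /ck_dterm /=; ring.
rewrite addrA -[RHS]add0r; congr (_ + _).
rewrite iterS /xdirac xmul_xmul factS natrM -/(@xdirac R n).
have f0 : (0 : R) < m`!%:R by rewrite ltr0n fact_gt0.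
have m0 : (0 : R) < m.+1%:R by rewrite ltr0n.
move: (dirac _ _ _) (m`!%:R) (m.+1%:R) (logr y ^+ m) (sqn y) f0 m0 y0 => d f m1 lm s f0 m0 s0.
by field; rewrite !gt_eqF.
Qed.

Lemma differentiable_logr (R : realType) (n : nat) (y : 'rV[R]_n) :
  0 < sqn y -> differentiable (@logr R n) y.
Proof.
move=> y0; apply: (@differentiableM _ _ (@ln R \o @sqn R n) (cst 2^-1)); last exact: differentiable_cst.
apply: differentiable_comp; first exact: differentiable_sqn.
by apply/derivable1_diffP; case: (is_derive1_ln y0).
Qed.

Lemma differentiable_ck_dterm (R : realType) (n : nat) (p : 'rV[R]_n) (s M : R) (k : nat)
    (u : 'rV[R]_n -> {set 'I_n} -> R) (y : 'rV[R]_n) (A : {set 'I_n}) (j : 'I_n) :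
  sqn p = 1 -> 0 < s -> s <= 1 -> 0 <= M -> polyv p s M u -> 0 < sqn y ->
  differentiable (fun z => ck_dterm j k u z A) y.
Proof.
move=> p1 s0 s1 M0 uM y0.
have dl := differentiable_logr y0.
have dX m : differentiable (fun z => @logr R n z ^+ m) y.
  elim: m => [|m IH]; first by under eq_fun do rewrite expr0; exact: differentiable_cst.
  by under eq_fun do rewrite exprS; apply: differentiableM.
have di : differentiable ((iter k (@xdirac R n) u)^~ A) y by apply: differentiable_iter uM.
have dd : differentiable (fun z => 'D_(ej R j) ((iter k (@xdirac R n) u)^~ A) z) y.
  have s2 : (0 : R) < s / 2 by rewrite divr_gt0.
  apply: poly_bound_differentiable (poly_bound_derive j (lexx 0) s2 _).
  exact: (@polyv_iter_fact _ _ p s M u k p1 s0 s1 M0 uM A).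
have dc (c : R) : differentiable (cst c : 'rV[R]_n -> R) y by apply: differentiable_cst.
have dq : differentiable (fun z : 'rV[R]_n => z ord0 j / sqn z) y.
  apply: (@differentiableM _ _ (fun z : 'rV[R]_n => z ord0 j) (fun z => (@sqn R n z)^-1)).
    exact: differentiable_coord.
  by apply: differentiableV; [exact: differentiable_sqn|rewrite gt_eqF].
exact: (differentiableD
  (differentiableM (differentiableM (differentiableM
     (differentiableM (dc k%:R) (dX k.-1)) (dc (k`!%:R^-1))) dq) di)
  (differentiableM (differentiableM (dX k) (dc (k`!%:R^-1))) dd)).
Qed.

Lemma ck_termB (R : realType) (n : nat) (p : 'rV[R]_n) (s M N : R)
    (u v : 'rV[R]_n -> {set 'I_n} -> R) (k : nat) (y : 'rV[R]_n) (A : {set 'I_n}) :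
  sqn p = 1 -> 0 < s -> s <= 1 -> 0 <= M -> 0 <= N -> polyv p s M u -> polyv p s N v ->
  ck_term k (fun y A => u y A - v y A) y A = ck_term k u y A - ck_term k v y A /\
  forall j, ck_dterm j k (fun y A => u y A - v y A) y A = ck_dterm j k u y A - ck_dterm j k v y A.
Proof.
move=> p1 s0 s1 M0 N0 uM vN.
have E := iter_xdiracB k p1 s0 s1 M0 N0 uM vN.
split=> [|j]; rewrite /ck_term /ck_dterm E; first by rewrite mulrBr.
rewrite deriveB; first by ring.
  by apply: diff_derivable; apply: differentiable_iter uM.
by apply: diff_derivable; apply: differentiable_iter vN.
Qed.

Lemma half_sum_le (R : realType) (N : nat) : \sum_(k < N) 2^-1 ^+ k <= 2 :> R.
Proof.
have -> : \sum_(k < N) 2^-1 ^+ k = 2 - 2 * 2^-1 ^+ N :> R.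
  elim: N => [|N IH]; first by rewrite big_ord0 expr0; ring.
  by rewrite big_ord_recr /= IH exprS; field.
by rewrite gerBl mulr_ge0 // exprn_ge0.
Qed.

(** From [N] to [N + 1] one series term is added and every earlier term is recomputed from a better
    polynomial. Both contributions are written as the increment of one explicit sequence. *)
Lemma truncation_increment (R : realType) (t : nat -> nat -> R) (S : nat -> R)
    (K Sinf : R) (N : nat) :
  (forall k m, `|t k m| <= S m * K * 2^-1 ^+ k) ->
  (forall k m, `|t k m.+1 - t k m| <= (S m.+1 - S m) * K * 2^-1 ^+ k) ->
  0 <= K -> S N <= S N.+1 -> S N.+1 <= Sinf ->
  `|\sum_(k < N.+2) t k N.+1 - \sum_(k < N.+1) t k N| <=
  K * (2 * S N.+1 - Sinf * 2^-1 ^+ N.+1) - K * (2 * S N - Sinf * 2^-1 ^+ N).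
Proof.
move=> t1 t2 K0 SN Si.
rewrite big_ord_recr /= addrAC -sumrB; apply: le_trans (ler_normD _ _) _.
have h1 : `|t N.+1 N.+1| <= Sinf * K * 2^-1 ^+ N.+1.
  by apply: le_trans (t1 _ _) _; rewrite !ler_wpM2r // exprn_ge0.
have h2 : `|\sum_(k < N.+1) (t k N.+1 - t k N)| <= (S N.+1 - S N) * K * 2.
  apply: le_trans (ler_norm_sum _ _ _) _.
  apply: (@le_trans _ _ (\sum_(k < N.+1) (S N.+1 - S N) * K * 2^-1 ^+ k)).
    by apply: ler_sum => k _; apply: t2.
  rewrite -mulr_sumr ler_wpM2l ?half_sum_le // mulr_ge0 // subr_ge0 //.
apply: le_trans (lerD h2 h1) _; rewrite le_eqVlt; apply/orP; left; apply/eqP.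
by rewrite exprS; field.
Qed.

Lemma half_pow_cvg0 (R : realType) (c : R) : (fun N => c * 2^-1 ^+ N) @ \oo --> (0 : R).
Proof. by apply: cvg_geometric; rewrite ger0_norm ?invr_ge0 // invf_lt1 // ltr1n. Qed.

(** [U N] are polynomial approximations with coefficient norms at most [S N]. The diagonal sums
    [E N] use orders up to [N] of the series of [U N], so every derivative taken is that of an
    elementary function, and the limit is passed only once. *)
Lemma ck_existence (R : realType) (n : nat) (p : 'rV[R]_n) (s : R)
    (U : nat -> 'rV[R]_n -> {set 'I_n} -> R) (S : nat -> R) (Sinf : R) :
  sqn p = 1 -> 0 < s -> s <= 1 -> (forall N, polyv p s (S N) (U N)) ->
  (forall N, polyv p s (S N.+1 - S N) (fun y A => U N.+1 y A - U N y A)) ->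
  (forall N, 0 <= S N) -> (forall N, S N <= S N.+1) -> (forall N, S N <= Sinf) ->
  S @ \oo --> Sinf ->
  exists (r : R) (F : 'rV[R]_n -> {set 'I_n} -> R),
    [/\ 0 < r, monogenic_on (ocube p r) F &
        forall y A, ocube p r y -> sqn y = 1 -> (fun N => U N y A) @ \oo --> F y A].
Proof.
move=> p1 s0 s1 US UdS S0 SS Sle Sc.
have [r r0 rP] := ck_region_near p1 s0.
have ysq y : ocube p r y -> 0 < sqn y by move=> /rP[_ _ h]; apply: lt_le_trans h.
pose K := ck_const n s.
have K0 : 0 <= K.
  have s4 : 0 <= 4 / s by rewrite divr_ge0 // ltW.
  by rewrite /K /ck_const; have := ck_rate_ge0 n s0; move: (ck_rate n s) (4 / s) s4 => b c; lra.
have Sd0 N : 0 <= S N.+1 - S N by rewrite subr_ge0.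
(* The majorant from [truncation_increment]; it serves the sums and their partial derivatives
   alike. *)
pose T N := K * (2 * S N - Sinf * 2^-1 ^+ N); pose l := K * (2 * Sinf).
have Tl : T @ \oo --> l.
  rewrite /l -[2 * Sinf]subr0; apply: cvgM; first exact: cvg_cst.
  apply: cvgB; last exact: half_pow_cvg0.
  by apply: cvgM => //; exact: cvg_cst.
pose E N y A := \sum_(k < N.+1) ck_term k (U N) y A.
pose dE j N y A := \sum_(k < N.+1) ck_dterm j k (U N) y A.
have Einc y A : ocube p r y -> forall N, `|E N.+1 y A - E N y A| <= T N.+1 - T N.
  move=> py N; apply: (@truncation_increment _ (fun k N => ck_term k (U N) y A)) => // k m.
    by have [] := ck_term_bound k A p1 s0 s1 (S0 m) (US m) (rP _ py).
  have [<- _] := ck_termB k y A p1 s0 s1 (S0 m.+1) (S0 m) (US m.+1) (US m).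
  by have [] := ck_term_bound k A p1 s0 s1 (Sd0 m) (UdS m) (rP _ py).
have dEinc j y A : ocube p r y -> forall N, `|dE j N.+1 y A - dE j N y A| <= T N.+1 - T N.
  move=> py N; apply: (@truncation_increment _ (fun k N => ck_dterm j k (U N) y A)) => // k m.
    by have [] := ck_term_bound k A p1 s0 s1 (S0 m) (US m) (rP _ py).
  have [_ <-] := ck_termB k y A p1 s0 s1 (S0 m.+1) (S0 m) (US m.+1) (US m).
  by have [] := ck_term_bound k A p1 s0 s1 (Sd0 m) (UdS m) (rP _ py).
pose F y A := limn (fun N => E N y A).
pose D j y A := limn (fun N => dE j N y A).
have FE y A : ocube p r y -> (fun N => E N y A) @ \oo --> F y A.
  by move=> py; have [] := summable_increments (Einc y A py) Tl.
have DE j y A : ocube p r y -> forall N, `|D j y A - dE j N y A| <= l - T N.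
  by move=> py; have [] := summable_increments (dEinc j y A py) Tl.
have b0 : (fun N => l - T N) @ \oo --> (0 : R).
  by rewrite -[X in _ --> X](subrr l); apply: cvgB => //; apply: cvg_cst.
have FD j y A : ocube p r y -> is_derive y (ej R j) (F^~ A) (D j y A).
  move=> py; apply: (@is_derive_uniform_limit _ _ p y r j (fun N y => E N y A)
    (fun N y => dE j N y A) (F^~ A) (fun y => D j y A) T l) => //.
  - move=> N z pz; rewrite /E /dE.
    have -> : (fun z => \sum_(k < N.+1) ck_term k (U N) z A) =
        \sum_(k < N.+1) (fun z => ck_term k (U N) z A).
      by apply/funext => x; rewrite fct_sumE.
    apply: is_derive_sum => k.
    exact: (is_derive_ck_term k A j p1 s0 s1 (S0 N) (US N) (ysq _ pz)).
  - by move=> z pz; apply: FE.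
  - by move=> N z pz; apply: DE.
have Dc j y A : ocube p r y -> {for y, continuous (fun z => D j z A)}.
  move=> py; apply: (@continuous_uniform_limit _ _ p y r (fun N z => dE j N z A) _
    (fun N => l - T N)) => // [N|N z pz]; last exact: DE.
  apply: differentiable_continuous; rewrite /dE.
  have -> : (fun z => \sum_(k < N.+1) ck_dterm j k (U N) z A) =
      \sum_(k < N.+1) (fun z => ck_dterm j k (U N) z A).
    by apply/funext => x; rewrite fct_sumE.
  apply: differentiable_sum => k.
  exact: (differentiable_ck_dterm k A j p1 s0 s1 (S0 N) (US N) (ysq _ py)).
have FDE j y A : ocube p r y -> 'D_(ej R j) (F^~ A) y = D j y A.
  by move=> py; have [] := FD j y A py.
exists r, F; split=> //.
- split.
  + move=> A x px; have [del del0 dx] : exists2 del, 0 < del & ocube x del `<=` ocube p r.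
      by apply/nbhs_ocubeP/open_nbhs_nbhs; split=> //; apply: ocube_open.
    apply: (@C1_differentiable _ _ x del _ (fun j y => D j y A)) => //.
      by move=> j y /dx; apply: FD.
    by move=> j; apply: Dc.
  + move=> A j x px; apply/continuous_dist => e e0.
    have /continuous_dist/(_ _ e0) c1 := Dc j x A px.
    have c2 : \forall y \near x, ocube p r y.
      by apply: open_nbhs_nbhs; split=> //; apply: ocube_open.
    apply: (@filterS2 _ (nbhs x)) c1 c2 => y h1 h2.
    by rewrite !FDE.
  move=> x A px.
  have -> : \sum_(j < n) lmul j (fun B => 'D_(ej R j) (F^~ B) x) A =
      \sum_(j < n) lmul j (D j x) A.
    by apply: eq_bigr => j _; rewrite /lmul FDE.
  (* The first summand is the error of replacing [D] by [dE], the second the remainder of the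
     telescoped Dirac sum. *)
  pose b N := n%:R * (l - T N) + n%:R * (Sinf * K * 2^-1 ^+ N).
  have nsum (c : R) : n%:R * c = \sum_(j < n) c by rewrite sumr_const card_ord mulr_natl.
  have bN N : `|\sum_(j < n) lmul j (D j x) A| <= b N.
    have -> : \sum_(j < n) lmul j (D j x) A =
      \sum_(j < n) lmul j (fun B => D j x B - dE j N x B) A +
      \sum_(j < n) lmul j (fun B => dE j N x B) A.
      rewrite -big_split; apply: eq_bigr => j _; rewrite /lmul /=; ring.
    apply: le_trans (ler_normD _ _) _; apply: lerD.
      apply: le_trans (ler_norm_sum _ _ _) _.
      rewrite [leRHS]nsum; apply: ler_sum => j _.
      by rewrite normr_lmul; apply: DE.
    rewrite dirac_ck_sum ?ysq // /dirac mulr_sumr; apply: le_trans (ler_norm_sum _ _ _) _.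
    rewrite [leRHS]nsum; apply: ler_sum => j _.
    rewrite /lmul mulrCA normrM normr_lsign mul1r.
    have [_ /(_ j) h _] := ck_term_bound N (twist j A) p1 s0 s1 (S0 N) (US N) (rP _ px).
    by apply: le_trans h _; rewrite -/K !ler_wpM2r // exprn_ge0.
  have bc : b @ \oo --> (0 : R).
    rewrite -[X in _ --> X]addr0 -[in X in _ --> X + _](mulr0 n%:R) -[in X in _ --> _ + X](mulr0 n%:R).
    apply: cvgD; apply: cvgM => //; try exact: cvg_cst.
    exact: half_pow_cvg0.
  have : `|\sum_(j < n) lmul j (D j x) A| <= limn b.
    apply: limr_ge; first by apply/cvg_ex; exists 0.
    by exists 0%N => // N _; apply: bN.
  by rewrite (cvg_lim _ bc) // normr_le0 => /eqP.
(* On the sphere the logarithm is zero, and only the term of order [0] survives. *)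
move=> y A py y1; have -> : (fun N => U N y A) = (fun N => E N y A).
  apply/funext => N; rewrite /E big_ord_recl big1 ?addr0.
    by rewrite /ck_term fact0 expr0 divr1 mul1r.
  by move=> k _; rewrite /ck_term /logr y1 ln1 mul0r expr0n /= !mul0r.
exact: FE.
Qed.

(** * Local existence and gluing *)

Lemma box_split (R : realType) (n : nat) (K : nat) (G : ('I_n -> nat) -> R) :
  \sum_(a : {ffun 'I_n -> 'I_K.+2}) G (fun i => a i) =
  \sum_(a : {ffun 'I_n -> 'I_K.+1}) G (fun i => a i) +
  \sum_(a : {ffun 'I_n -> 'I_K.+2} | ~~ [forall i, (a i < K.+1)%N]) G (fun i => a i).
Proof.
rewrite (bigID (fun a : {ffun 'I_n -> 'I_K.+2} => [forall i, (a i < K.+1)%N])) /=.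
congr (_ + _).
pose h (a : {ffun 'I_n -> 'I_K.+1}) : {ffun 'I_n -> 'I_K.+2} :=
  [ffun i => widen_ord (leqnSn K.+1) (a i)].
pose h' (a : {ffun 'I_n -> 'I_K.+2}) : {ffun 'I_n -> 'I_K.+1} := [ffun i => inord (a i)].
rewrite (reindex_onto h h') /=.
  apply: eq_big => [a|a _]; last by congr G; apply/funext => i; rewrite ffunE.
  apply/andP; split.
    by apply/forallP => i; rewrite ffunE /=.
  by apply/eqP/ffunP => i; rewrite !ffunE /= inord_val.
move=> a /forallP aK; apply/ffunP => i; rewrite !ffunE; apply: val_inj => /=.
by rewrite inordK.
Qed.

(** At the corner [p + (s, ..., s)] the absolute box sum is the weighted coefficient norm, so
    absolute convergence at this one point supplies all bounds. Boxes of exponents are nested, and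
    the difference consists of the new shell. *)
Lemma mpow_box_poly (R : realType) (n : nat) (c : ('I_n -> nat) -> R) (p : 'rV[R]_n)
    (s : R) (N : nat) : 0 <= s ->
  let S N := mpow_box_abs c p (p + const_mx s) N in
  poly_bound p s (S N) (fun y => mpow_box c p y N) /\
  poly_bound p s (S N.+1 - S N) (fun y => mpow_box c p y N.+1 - mpow_box c p y N).
Proof.
move=> s0 S; pose G (a : 'I_n -> nat) := `|c a| * s ^+ pdeg a.
have SE K : S K = \sum_(a : {ffun 'I_n -> 'I_K.+1}) G (fun i => a i).
  rewrite /S /mpow_box_abs; apply: eq_bigr => a _; rewrite normrM /G; congr (_ * _).
  rewrite /pdeg -prodrXr normr_prod; apply: eq_bigr => i _.
  by rewrite !mxE addrAC subrr add0r normrX ger0_norm.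
split.
  exists [seq (c (fun i => a i), fun i => a i : nat) | a : {ffun 'I_n -> 'I_N.+1}].
    by apply/funext => y; rewrite /peval big_image.
  by rewrite /pnorm big_image SE.
pose P (a : {ffun 'I_n -> 'I_N.+2}) := ~~ [forall i, (a i < N.+1)%N].
exists [seq (c (fun i => a i), fun i => a i : nat) | a : {ffun 'I_n -> 'I_N.+2} in P].
  apply/funext => y; rewrite /peval big_image /=.
  have := @box_split R n N (fun a => c a * pmono p a y).
  by rewrite /mpow_box => ->; rewrite addrAC subrr add0r.
by rewrite /pnorm big_image /= !SE box_split addrAC subrr add0r.
Qed.

Lemma ocube_center (R : realType) (n : nat) (p : 'rV[R]_n) (r : R) : 0 < r -> ocube p r p.
Proof. by move=> r0 i; rewrite subrr normr0. Qed.

Lemma ocubeS (R : realType) (n : nat) (p : 'rV[R]_n) (r s : R) :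
  r <= s -> ocube p r `<=` ocube p s.
Proof. by move=> rs y py i; apply: lt_le_trans (py i) rs. Qed.

Lemma monogenic_onS (R : realType) (n : nat) (P Q : set 'rV[R]_n)
    (H : 'rV[R]_n -> {set 'I_n} -> R) :
  P `<=` Q -> monogenic_on Q H -> monogenic_on P H.
Proof.
by move=> PQ [h1 h2 h3]; split=> [A x /PQ|A j x /PQ|x A /PQ]; [apply: h1|apply: h2|apply: h3].
Qed.

Lemma local_existence (R : realType) (n : nat) (f : 'rV[R]_n -> Cl R n) (p : 'rV[R]_n) :
  real_analytic_on_sphere f -> sqn p = 1 ->
  exists (r : R) (F : 'rV[R]_n -> {set 'I_n} -> R),
    [/\ 0 < r, r <= 1, monogenic_on (ocube p r) F &
        forall y A, ocube p r y -> sqn y = 1 -> F y A = f y A].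
Proof.
move=> fa p1; have [V [g [oV Vp ga gf]]] := fa p p1.
have [rc rcP] := @choice _ _ (fun A (rc : R * (('I_n -> nat) -> R)) => 0 < rc.1 /\
    forall y : 'rV[R]_n, (forall i, `|y ord0 i - p ord0 i| < rc.1) ->
      cvgn (mpow_box_abs rc.2 p y) /\ mpow_box rc.2 p y @ \oo --> g y A)
  (fun A => let: ex_intro r (ex_intro c h) := ga A p Vp in ex_intro _ (r, c) h).
have [v v0 vV] : exists2 v, 0 < v & ocube p v `<=` V.
  by apply/nbhs_ocubeP/open_nbhs_nbhs.
pose m := \big[Num.min/1]_A (rc A).1.
have m0 : 0 < m.
  by apply: (big_ind (fun z : R => 0 < z)) => // [x y x0 y0|A _]; [rewrite lt_min x0|case: (rcP A)].
have m1 : m <= 1 by apply: bigmin_le_id.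
have mA A : m <= (rc A).1 by apply: bigmin_le.
(* Strictly inside every radius of convergence, so that the corner at distance [s] is a point of
   absolute convergence. *)
pose s := m / 2.
have s0 : 0 < s by rewrite divr_gt0.
have s1 : s <= 1 by rewrite /s; lra.
have sA A : s < (rc A).1 by apply: lt_le_trans (mA A); rewrite /s; lra.
pose SA A N := mpow_box_abs (rc A).2 p (p + const_mx s) N.
(* Summing over the components gives one majorant for all of them; its increments dominate each
   component's because they are all nonnegative. *)
pose S N := \sum_A SA A N.
pose U N (y : 'rV[R]_n) A := mpow_box (rc A).2 p y N.
have SAc A : cvgn (SA A).
  have [_ h] := rcP A; have [|//] := h (p + const_mx s).
  by move=> i; rewrite !mxE addrAC subrr add0r gtr0_norm.
have UP A N := @mpow_box_poly R n (rc A).2 p s N (ltW s0).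
have nneg M u : poly_bound p s M u -> 0 <= M.
  by move=> [l _]; apply: le_trans; apply: sumr_ge0 => t _; rewrite mulr_ge0 // exprn_ge0 // ltW.
have SA0 A N : 0 <= SA A N by have [/nneg] := UP A N.
have SAd A N : 0 <= SA A N.+1 - SA A N by have [_ /nneg] := UP A N.
have SAnd A : nondecreasing_seq (SA A).
  by apply/nondecreasing_seqP => N; rewrite -subr_ge0.
pose Sinf := \sum_A limn (SA A).
have Sc : S @ \oo --> Sinf.
  rewrite /S /Sinf; elim: (index_enum _) => [|A l IH].
    by under eq_fun do rewrite big_nil; rewrite big_nil; apply: cvg_cst.
  by under eq_fun do rewrite big_cons; rewrite big_cons; apply: cvgD.
have [||||||r [F [r0 mF FU]]] := @ck_existence R n p s U S Sinf p1 s0 s1.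
- move=> N A; apply: poly_boundW (proj1 (UP A N)) => //; first exact: ltW.
  by rewrite /S (bigD1 A) //= lerDl sumr_ge0.
- move=> N A; apply: poly_boundW (proj2 (UP A N)) => //; first exact: ltW.
  by rewrite /S -sumrB (bigD1 A) //= lerDl sumr_ge0.
- by move=> N; apply: sumr_ge0.
- by move=> N; rewrite -subr_ge0 /S -sumrB sumr_ge0.
- move=> N; apply: ler_sum => A _; exact: nondecreasing_cvgn_le.
- exact: Sc.
pose r' := Num.min (Num.min r v) s.
exists r', F; split.
- by rewrite !lt_min r0 v0.
- by rewrite ge_min s1 orbT.
- by apply: monogenic_onS mF => y py i; apply: lt_le_trans (py i) _; rewrite !ge_min lexx.
move=> y A py y1.
have pr : ocube p r y by move=> i; apply: lt_le_trans (py i) _; rewrite !ge_min lexx.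
have pv : ocube p v y by move=> i; apply: lt_le_trans (py i) _; rewrite !ge_min lexx orbT.
have ps : ocube p s y by move=> i; apply: lt_le_trans (py i) _; rewrite !ge_min lexx orbT.
have [_ h] := rcP A.
have [_ c1] := h y (fun i => lt_trans (ps i) (sA A)).
rewrite -(gf y (vV _ pv) y1).
exact: (cvg_unique _ (FU y A pr y1) c1).
Qed.

(** * Differences, localisation and patching of monogenic functions *)

Lemma monogenic_onB (R : realType) (n : nat) (Q : set 'rV[R]_n)
    (F G : 'rV[R]_n -> {set 'I_n} -> R) :
  open Q -> monogenic_on Q F -> monogenic_on Q G ->
  monogenic_on Q (fun x A => F x A - G x A).
Proof.
move=> oQ [F1 F2 F3] [G1 G2 G3].
have DB A j x : Q x -> 'D_(ej R j) (fun y => F y A - G y A) x =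
    'D_(ej R j) (F^~ A) x - 'D_(ej R j) (G^~ A) x.
  by move=> Qx; rewrite deriveB //; apply: diff_derivable; [apply: F1|apply: G1].
split.
- by move=> A x Qx; apply: differentiableB; [apply: F1|apply: G1].
- move=> A j x Qx; apply/continuous_dist => e e0.
  have e20 : 0 < e / 2 by rewrite divr_gt0.
  have /continuous_dist/(_ _ e20) c1 := F2 A j x Qx.
  have /continuous_dist/(_ _ e20) c2 := G2 A j x Qx.
  have c3 : \forall y \near x, Q y by apply: open_nbhs_nbhs.
  apply: (@filterS3 _ (nbhs x)) c1 c2 c3 => y h1 h2 Qy; rewrite !DB //.
  have -> : 'D_(ej R j) (F^~ A) x - 'D_(ej R j) (G^~ A) x -
    ('D_(ej R j) (F^~ A) y - 'D_(ej R j) (G^~ A) y) =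
    ('D_(ej R j) (F^~ A) x - 'D_(ej R j) (F^~ A) y) -
    ('D_(ej R j) (G^~ A) x - 'D_(ej R j) (G^~ A) y) by ring.
  by apply: le_lt_trans (ler_normB _ _) _; lra.
move=> x A Qx; transitivity (\sum_(j < n) lmul j (fun B => 'D_(ej R j) (F^~ B) x) A -
   \sum_(j < n) lmul j (fun B => 'D_(ej R j) (G^~ B) x) A).
  by rewrite -sumrB; apply: eq_bigr => j _; rewrite /lmul DB // mulrBr.
by rewrite F3 // G3 // subr0.
Qed.

(** Near each point the partial derivatives of [F] are those of a monogenic function; their
    continuity then gives total differentiability. *)
Lemma monogenic_on_local (R : realType) (n : nat) (Q : set 'rV[R]_n)
    (F : 'rV[R]_n -> {set 'I_n} -> R) :
  (forall x, Q x -> exists (d : R) (G : 'rV[R]_n -> {set 'I_n} -> R),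
     [/\ 0 < d, monogenic_on (ocube x d) G & forall y A, ocube x d y -> F y A = G y A]) ->
  monogenic_on Q F.
Proof.
move=> h.
have near_eq x d G A : ocube x d `<=` (fun y => F y A = G y A) -> forall y, ocube x d y ->
    \near y, G y A = F y A.
  move=> FG y xy; have c : \forall z \near y, ocube x d z.
    by apply: open_nbhs_nbhs; split=> //; apply: ocube_open.
  by apply: (@filterS _ (nbhs y)) c => z /FG.
have K x : Q x -> exists (d : R) (G : 'rV[R]_n -> {set 'I_n} -> R),
    [/\ 0 < d, monogenic_on (ocube x d) G & forall y A j, ocube x d y ->
       is_derive y (ej R j) (F^~ A) ('D_(ej R j) (G^~ A) y)].
  move=> /h[d [G [d0 mG FG]]]; exists d, G; split=> // y A j xy.
  have [G1 _ _] := mG.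
  apply: (@near_eq_is_derive _ _ _ (G^~ A)).
    by apply: near_eq xy => z; apply: FG.
  by apply: derivableP; apply: diff_derivable; apply: G1.
split.
- move=> A x /K[d [G [d0 [G1 G2 G3] FG]]].
  apply: (@C1_differentiable _ _ x d _ (fun j y => 'D_(ej R j) (G^~ A) y)) => //.
  by move=> j; apply: G2; apply: ocube_center.
- move=> A j x /K[d [G [d0 [G1 G2 G3] FG]]]; apply/continuous_dist => e e0.
  have /continuous_dist/(_ _ e0) c1 := G2 A j x (ocube_center x d0).
  have c3 : \forall y \near x, ocube x d y by apply/nbhs_ocubeP; exists d.
  apply: (@filterS2 _ (nbhs x)) c1 c3 => y h1 xy.
  have [_ ->] := FG x A j (ocube_center x d0); have [_ ->] := FG y A j xy; exact: h1.
move=> x A /K[d [G [d0 [G1 G2 G3] FG]]]; rewrite -[RHS](G3 x A (ocube_center x d0)).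
apply: eq_bigr => j _; rewrite /lmul; congr (_ * _).
by have [] := FG x (twist j A) j (ocube_center x d0).
Qed.

Lemma left_clifford_holomorphicP (R : realType) (n : nat) (U : set 'rV[R]_n)
    (F : 'rV[R]_n -> Cl R n) :
  left_clifford_holomorphic U F <-> open U /\ monogenic_on U (fun x A => F x A).
Proof.
have E x A : (\sum_(j < n) clmul (cle R j) (partialCl F j x)) A =
    \sum_(j < n) lmul j (fun B => 'D_(ej R j) (fun y => F y B) x) A.
  by rewrite sum_ffunE; apply: eq_bigr => j _; rewrite clmul_cle /lmul ffunE.
split.
  move=> [oU [FA F0]]; split=> //; split.
  - by move=> A x Ux; apply: (FA A).1.
  - move=> A j x Ux; have := (FA A).2 j; rewrite continuous_open_subspace // => c.
    by apply: c; rewrite inE.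
  - by move=> x A Ux; rewrite -E F0 // ffunE.
move=> [oU [F1 F2 F3]]; split=> //; split.
  move=> A; split; first by move=> x; apply: F1.
  move=> j; rewrite continuous_open_subspace // => x; rewrite inE; exact: F2.
by move=> x Ux; apply/ffunP => A; rewrite E F3 // ffunE.
Qed.

Lemma uniq_radius_bounds (R : realType) (n : nat) : (0 < n)%N -> 0 < uniq_radius R n /\ 4 * uniq_radius R n <= 1.
Proof.
move=> n0; have n3 : (1 : R) <= n%:R ^+ 3 by rewrite exprn_ege1 // ler1n.
have k4 : 4 <= 12 * 16 ^+ 2 * n%:R ^+ 3 :> R.
  apply: (@le_trans _ _ (12 * 1 * 1)); first by lra.
  apply: ler_pM => //; apply: ler_pM => //; by rewrite exprn_ege1 // ler1n.
rewrite /uniq_radius; split; first by rewrite invr_gt0; apply: lt_le_trans k4.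
by rewrite ler_pdivrMr ?mul1r //; apply: lt_le_trans k4.
Qed.

Lemma sqn_dim_gt0 (R : realType) (n : nat) (p : 'rV[R]_n) : sqn p = 1 -> (0 < n)%N.
Proof. by case: n p => // p; rewrite /sqn big_ord0 => /eqP; rewrite eq_sym oner_eq0. Qed.

Lemma monogenic_sphere_eq (R : realType) (n : nat) (p : 'rV[R]_n) (r : R)
    (F G : 'rV[R]_n -> {set 'I_n} -> R) (x : 'rV[R]_n) (A : {set 'I_n}) :
  sqn p = 1 -> 0 < r -> r <= 1 -> monogenic_on (ocube p r) F ->
  monogenic_on (ocube p r) G ->
  (forall y B, ocube p r y -> sqn y = 1 -> F y B = G y B) ->
  ocube p (uniq_radius R n * r) x -> F x A = G x A.
Proof.
move=> p1 r0 r1 mF mG FG px; apply/eqP; rewrite -subr_eq0; apply/eqP.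
have n0 := sqn_dim_gt0 p1.
apply: (@monogenic_sphere_unique R n p r (fun x A => F x A - G x A)) => //.
- by apply: monogenic_onB => //; apply: ocube_open.
- by move=> y B py y1; rewrite FG // subrr.
- by move=> i; apply/ltW/px.
Qed.

(** The value at a point is taken from any local solution whose shrunken cube contains it;
    uniqueness across the sphere makes the choice irrelevant. *)
Lemma global_existence (R : realType) (n : nat) (f : 'rV[R]_n -> Cl R n) :
  real_analytic_on_sphere f ->
  exists (U : set 'rV[R]_n) (F : 'rV[R]_n -> Cl R n),
    [/\ sphere R n `<=` U, left_clifford_holomorphic U F &
        forall x, sphere R n x -> F x = f x].
Proof.
move=> fa.
have C p : exists rF : R * ('rV[R]_n -> {set 'I_n} -> R), sqn p = 1 ->
    [/\ 0 < rF.1, rF.1 <= 1, monogenic_on (ocube p rF.1) rF.2 &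
        forall y A, ocube p rF.1 y -> sqn y = 1 -> rF.2 y A = f y A].
  have [p1|p1] := pselect (sqn p = 1); last by exists (0, fun _ _ => 0).
  by have [r [F h]] := local_existence fa p1; exists (r, F).
have [rF rFP] := choice C.
pose r p := (rF p).1; pose Fp p := (rF p).2.
(* Halved because uniqueness will be applied on a cube of half the radius. *)
pose c : R := uniq_radius R n / 2.
have cons p q x A : sqn p = 1 -> sqn q = 1 -> ocube p (c * r p) x -> ocube q (c * r q) x ->
    Fp p x A = Fp q x A.
  (* With [r q] the smaller radius, the cube of radius [r q / 2] about [q] lies in the domains of
     both local solutions. *)
  wlog rqp : p q / r q <= r p => [hw p1 q1 px qx|].
    have [/hw|/ltW/hw h] := lerP (r q) (r p); first exact.
    by symmetry; apply: h.
  move=> p1 q1 px qx; have [rp0 rp1 mp fp] := rFP p p1; have [rq0 rq1 mq fq] := rFP q q1.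
  rewrite -/(r p) -/(Fp p) in rp0 rp1 mp fp; rewrite -/(r q) -/(Fp q) in rq0 rq1 mq fq.
  have [c00 c04] := uniq_radius_bounds R (sqn_dim_gt0 p1).
  have c0' : 0 < c by rewrite divr_gt0.
  have c8 : c <= 8^-1 by rewrite /c; lra.
  have qp : ocube q (r q / 2) `<=` ocube p (r p).
    move=> y qy i; have := qy i; have := px i; have := qx i.
    have -> : y ord0 i - p ord0 i = (y ord0 i - q ord0 i) +
      ((x ord0 i - p ord0 i) - (x ord0 i - q ord0 i)) by ring.
    have := ler_normD (y ord0 i - q ord0 i) ((x ord0 i - p ord0 i) - (x ord0 i - q ord0 i)).
    have := ler_normB (x ord0 i - p ord0 i) (x ord0 i - q ord0 i).
    have : c * r p <= 8^-1 * r p by rewrite ler_pM2r.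
    have : c * r q <= 8^-1 * r q by rewrite ler_pM2r.
    lra.
  have qq : ocube q (r q / 2) `<=` ocube q (r q) by apply: ocubeS; lra.
  apply: (@monogenic_sphere_eq R n q (r q / 2)) => //.
  - by rewrite divr_gt0.
  - by lra.
  - exact: monogenic_onS qp mp.
  - exact: monogenic_onS qq mq.
  - by move=> y B qy y1; rewrite fp ?fq //; [apply: qq|apply: qp].
  - by apply: ocubeS qx; rewrite /c -mulrA [2^-1 * _]mulrC.
pose U : set 'rV[R]_n := [set x | exists p, sqn p = 1 /\ ocube p (c * r p) x].
pose F (x : 'rV[R]_n) : Cl R n := match pselect (U x) with
  | left h => [ffun A => Fp (sval (cid h)) x A] | right _ => 0 end.
have FE p x A : sqn p = 1 -> ocube p (c * r p) x -> F x A = Fp p x A.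
  move=> p1 px; rewrite /F; case: pselect => [h|[]]; last by exists p.
  by rewrite ffunE; case: cid => q /= [q1 qx]; apply: cons.
have cr p : sqn p = 1 -> 0 < c * r p /\ c * r p <= r p.
  move=> p1; have [rp0 _ _ _] := rFP p p1; have [c00 c04] := uniq_radius_bounds R (sqn_dim_gt0 p1).
  have c0' : 0 < c by rewrite divr_gt0.
  by split; [rewrite mulr_gt0|rewrite ler_piMl ?(ltW rp0) // /c; lra].
have oU : open U.
  rewrite openE => x [p [p1 px]].
  have /nbhs_ocubeP[d d0 dp] : nbhs x (ocube p (c * r p)).
    by apply: open_nbhs_nbhs; split=> //; apply: ocube_open.
  by apply/nbhs_ocubeP; exists d => // y /dp py; exists p.
exists U, F; split.
- by move=> x x1; exists x; split=> //; apply: ocube_center; case: (cr x x1).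
- apply/left_clifford_holomorphicP; split=> //.
  apply: monogenic_on_local => x [p [p1 px]].
  have [d d0 dp] : exists2 d, 0 < d & ocube x d `<=` ocube p (c * r p).
    by apply/nbhs_ocubeP/open_nbhs_nbhs; split=> //; apply: ocube_open.
  have [_ _ mp _] := rFP p p1; exists d, (Fp p); split=> //.
    by apply: monogenic_onS mp => y /dp; apply: ocubeS; case: (cr p p1).
  by move=> y A /dp; apply: FE.
- move=> x x1; apply/ffunP => A; have [c1 c2] := cr x x1; have [rp0 _ _ fp] := rFP x x1.
  rewrite (FE x) //; last exact: ocube_center.
  by apply: fp => //; apply: ocube_center.
Qed.

Theorem theorem8 (R : realType) (n : nat) (f : 'rV[R]_n -> Cl R n) :
  real_analytic_on_sphere f ->
  exists (U : set 'rV[R]_n) (F : 'rV[R]_n -> Cl R n),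
    [/\ sphere R n `<=` U,
        left_clifford_holomorphic U F,
        (forall x, sphere R n x -> F x = f x) &
        (forall (V : set 'rV[R]_n) (G : 'rV[R]_n -> Cl R n),
           sphere R n `<=` V -> left_clifford_holomorphic V G ->
           (forall x, sphere R n x -> G x = f x) ->
           exists W : set 'rV[R]_n,
             [/\ open W, sphere R n `<=` W, W `<=` U `&` V &
                 forall x, W x -> G x = F x])].
Proof.
move=> fa; have [U [F [SU hF Ff]]] := global_existence fa.
exists U, F; split=> // V G SV hG Gf.
have /left_clifford_holomorphicP[oU mF] := hF.
have /left_clifford_holomorphicP[oV mG] := hG.
(* [U] and [V] may have components away from the sphere, so agreement is claimed on the cubes
   reached by uniqueness from cubes inside [U] and [V]. *)
exists [set x | exists p (r : R), [/\ sqn p = 1, 0 < r <= 1, ocube p r `<=` U `&` V &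
  ocube p (uniq_radius R n * r) x]]; split.
- rewrite openE => x [p [r [p1 r01 pUV px]]].
  have /nbhs_ocubeP[d d0 dp] : nbhs x (ocube p (uniq_radius R n * r)).
    by apply: open_nbhs_nbhs; split=> //; apply: ocube_open.
  by apply/nbhs_ocubeP; exists d => // y /dp py; exists p, r.
- move=> p p1.
  have [d d0 dp] : exists2 d, 0 < d & ocube p d `<=` U `&` V.
    apply/nbhs_ocubeP/open_nbhs_nbhs; split; first exact: openI.
    by split; [apply: SU|apply: SV].
  exists p, (Num.min d 1); split=> //.
  + by rewrite lt_min d0 ltr01 /= ge_min lexx orbT.
  + by apply: subset_trans dp; apply: ocubeS; rewrite ge_min lexx.
  + have [c00 _] := uniq_radius_bounds R (sqn_dim_gt0 p1).
    by apply: ocube_center; rewrite mulr_gt0 // lt_min d0 ltr01.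
- move=> x [p [r [p1 /andP[r0 r1] pUV px]]]; apply: pUV.
  have [c00 c04] := uniq_radius_bounds R (sqn_dim_gt0 p1).
  by apply: ocubeS px; rewrite ler_piMl ?(ltW r0) //; lra.
move=> x [p [r [p1 /andP[r0 r1] pUV px]]]; apply/ffunP => A.
apply: (@monogenic_sphere_eq R n p r (fun x A => G x A) (fun x A => F x A)) => //.
- by apply: monogenic_onS mG => y /pUV[].
- by apply: monogenic_onS mF => y /pUV[].
- by move=> y B _ y1; rewrite Gf // Ff.
Qed.
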